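(* Let $E\subseteq\mathbb{R}^d$ be a bounded measurable set, let $K$ be a countable index set, and let $\Lambda=\{\lambda_k\}_{k\in K}\subseteq\mathbb{R}^d$ be such that $\{e_{\lambda_k}\}_{k\in K}$ is a frame for $L^2(E)$. Let $h\in P_E$. Then: (1) $\{T_{\lambda_k}h\}_{k\in K}$ is a Bessel sequence in $L^2(\mathbb{R}^d)$ if and only if there exists $B>0$ such that $|\hat h(\omega)|\le B$ for a.e. $\omega$. (2) $\{T_{\lambda_k}h\}_{k\in K}$ is a frame for $P_E$ if and only if there exist $B\ge A>0$ such that $A\le|\hat h(\omega)|\le B$ for a.e. $\omega\in E$. (3) $\{T_{\lambda_k}h\}_{k\in K}$ is a frame sequence in $L^2(\mathbb{R}^d)$ if and only if there exist $B\ge A>0$ such that $A\le|\hat h(\omega)|\le B$ for a.e. $\omega\in\operatorname{supp}\hat h$.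
   Context: $e_\lambda(x)=e^{-2\pi i\lambda\cdot x}$ and $T_\lambda f(x)=f(x-\lambda)$. The Fourier transform is $\hat f(\omega)=\int_{\mathbb{R}^d}f(x)e^{-2\pi i\omega\cdot x}\,dx$, extended to $L^2(\mathbb{R}^d)$. ''$\{e_{\lambda_k}\}_{k\in K}$ is a frame for $L^2(E)$'' means that $\{e_{\lambda_k}\chi_E\}_{k\in K}$ is. $P_E=\{f\in L^2(\mathbb{R}^d):\operatorname{supp}\hat f\subseteq E\}$. Supports are understood up to null sets: $\operatorname{supp}\hat f=\{\omega:\hat f(\omega)\ne0\}$, so $f\in P_E$ means $\hat f=0$ a.e. outside $E$. A sequence $\{\psi_k\}_{k\in K}$ in a separable Hilbert space $\mathcal{H}$ is a frame for $\mathcal{H}$ if there are constants $A,B>0$ with $A\|f\|^2\le\sum_k|\langle f,\psi_k\rangle|^2\le B\|f\|^2$ for all $f\in\mathcal{H}$; a Bessel sequence if the right-hand inequality holds for some $B>0$; and a frame sequence if it is a frame for the closure of its linear span. $P_E$ is a Hilbert space with the $L^2(\mathbb{R}^d)$ norm. *)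

(* Defs.v *)
From HB Require Import structures.
From mathcomp Require Import all_boot all_order all_algebra.
From mathcomp Require Import all_classical all_reals all_analysis.
From mathcomp Require Import complex.

Set Implicit Arguments.
Unset Strict Implicit.
Unset Printing Implicit Defensive.

Import Order.TTheory GRing.Theory Num.Theory.
Import numFieldNormedType.Exports.
Import ComplexField.Normc.

Local Open Scope classical_set_scope.
Local Open Scope ring_scope.
Local Open Scope complex_scope.

Section LebesgueMeasure.
Context {R : realType}.

Definition coords d (x : 'rV[R]_d) : d.-tuple (measurableTypeR R) :=
  [tuple x 0 i | i < d].

(* 'rV[R]_d with the Borel sigma-algebra, generated by the coordinates. *)
Definition borelRd d : Type := 'rV[R]_d.

HB.instance Definition _ d := Pointed.on (borelRd d).
HB.instance Definition _ d :=
  @isMeasurable.Build default_measure_display (borelRd d)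
    (g_sigma_algebra_preimage (@coords d))
    (@measurable0 _ (g_sigma_algebra_preimageType (@coords d)))
    (@measurableC _ (g_sigma_algebra_preimageType (@coords d)))
    (@bigcupT_measurable _ (g_sigma_algebra_preimageType (@coords d))).

Definition consRd d (p : measurableTypeR R * borelRd d) : borelRd d.+1 :=
  \row_i oapp (p.2 0) p.1 (unlift ord0 i).

Lemma measurable_coord d (i : 'I_d) :
  measurable_fun setT (fun x : borelRd d => x 0 i : measurableTypeR R).
Proof.
move=> _ Y mY; exists ((fun t => tnth t i) @^-1` Y).
  by rewrite -[X in measurable X]setTI; exact: measurable_tnth.
by apply/seteqP; split => x /=; rewrite tnth_mktuple.
Qed.

Lemma measurable_borelRd d0 (T : measurableType d0) d (f : T -> borelRd d) :
  (forall i, measurable_fun setT (fun x => f x 0 i : measurableTypeR R)) ->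
  measurable_fun setT f.
Proof.
move=> mf _ _ [B mB <-]; rewrite !setTI.
have mcf : measurable_fun setT (@coords d \o f).
  apply/measurable_fun_tnthP => i; rewrite (_ : _ \o _ = fun x => f x 0 i) //.
  by apply/funext => x /=; rewrite tnth_mktuple.
by rewrite -comp_preimage -[X in measurable X]setTI; exact: mcf.
Qed.

Lemma measurable_consRd d : measurable_fun setT (@consRd d).
Proof.
apply: measurable_borelRd => i.
case: (unliftP ord0 i) => [j|] ->.
  rewrite (_ : (fun x => _) = (fun x : borelRd d => x 0 j) \o snd).
    by apply: measurableT_comp => //; exact: measurable_coord.
  by apply/funext => p; rewrite mxE liftK.
rewrite (_ : (fun x => _) = fst); first exact: measurable_fst.
by apply/funext => p; rewrite mxE unlift_none.
Qed.

Definition unconsRd d (x : borelRd d.+1) : measurableTypeR R * borelRd d :=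
  (x 0 ord0, \row_i x 0 (lift ord0 i)).

Lemma consRdK d : cancel (@consRd d) (@unconsRd d).
Proof.
case=> a y; rewrite /unconsRd mxE unlift_none /=; congr pair.
by apply/rowP => i; rewrite !mxE liftK.
Qed.

Lemma measurable_unconsRd d : measurable_fun setT (@unconsRd d).
Proof.
apply: measurable_fun_pair; first exact: measurable_coord.
apply: measurable_borelRd => i.
rewrite (_ : (fun x => _) = fun x : borelRd d.+1 => x 0 (lift ord0 i)).
  exact: measurable_coord.
by apply/funext => x; rewrite mxE.
Qed.

Section Cons.
Context d (m : {sigma_finite_measure set (borelRd d) -> \bar R}).

Definition cons_lebesgue : set (borelRd d.+1) -> \bar R :=
  pushforward (@lebesgue_measure R \x m)%E (@consRd d).

Let cons0 : cons_lebesgue set0 = 0%E.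
Proof. by rewrite /cons_lebesgue /pushforward preimage_set0 measure0. Qed.

Let cons_ge0 A : (0 <= cons_lebesgue A)%E.
Proof. by rewrite /cons_lebesgue /pushforward measure_ge0. Qed.

Let cons_sigma_additive : semi_sigma_additive cons_lebesgue.
Proof.
move=> F mF tF mUF; rewrite /cons_lebesgue /pushforward preimage_bigcup.
have mpre A : measurable A -> measurable (@consRd d @^-1` A).
  by move=> mA; rewrite -[X in measurable X]setTI; exact: measurable_consRd.
apply: measure_semi_sigma_additive.
- by move=> n; exact: mpre.
- apply/trivIsetP => i j _ _ ij; rewrite -preimage_setI.
  by move/trivIsetP : tF => /(_ _ _ _ _ ij) ->//; rewrite preimage_set0.
- by rewrite -preimage_bigcup; exact: mpre.
Qed.

HB.instance Definition _ := isMeasure.Build _ _ _ cons_lebesgue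
  cons0 cons_ge0 cons_sigma_additive.

Let cons_sigma_finite : sigma_finite setT cons_lebesgue.
Proof.
have /sigma_finiteP[F [FT ndF mF]] := sigma_finiteT (@lebesgue_measure R).
have /sigma_finiteP[G [GT ndG mG]] := sigma_finiteT m.
exists (fun n => @unconsRd d @^-1` (F n `*` G n)).
  rewrite -preimage_bigcup (_ : \bigcup_n _ = setT) ?preimage_setT//.
  apply/seteqP; split => // -[x y] _.
  have [i _ Fix] : (\bigcup_n F n) x by rewrite -FT.
  have [j _ Gjy] : (\bigcup_n G n) y by rewrite -GT.
  exists (maxn i j) => //; split => /=.
    by move: x Fix; exact/subsetPset/ndF/leq_maxl.
  by move: y Gjy; exact/subsetPset/ndG/leq_maxr.
move=> n; have [mFn Fnoo] := mF n; have [mGn Gnoo] := mG n; split.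
  rewrite -[X in measurable X]setTI; apply: measurable_unconsRd => //.
  exact: measurableX.
rewrite /cons_lebesgue /pushforward -comp_preimage.
rewrite (_ : _ \o _ = id) ?preimage_id.
  by rewrite product_measure1E// lte_mul_pinfty// ge0_fin_numE.
by apply/funext => p /=; rewrite consRdK.
Qed.

HB.instance Definition _ := @Measure_isSigmaFinite.Build _ _ _ cons_lebesgue
  cons_sigma_finite.

End Cons.

(* Lebesgue measure on Borel sets: the d-fold product of the one on R. *)
Fixpoint lebesgue_borel d : {sigma_finite_measure set (borelRd d) -> \bar R} :=
  match d return {sigma_finite_measure set (borelRd d) -> \bar R} with
  | 0 => @dirac _ (borelRd 0) (0 : 'rV[R]_0) R
  | d'.+1 => cons_lebesgue (lebesgue_borel d')
  end.

(* The completion: 'rV[R]_d with the sigma-algebra of Lebesgue sets. *)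
Definition Rd d := caratheodory_type (lebesgue_borel d)^*%mu.

Definition lebesgue d : set (Rd d) -> \bar R :=
  @completed_measure_extension _ _ _ (lebesgue_borel d).

HB.instance Definition _ d := Measure.on (@lebesgue d).

Let lebesgue_sigma_finite d : sigma_finite setT (@lebesgue d).
Proof. exact/completed_measure_extension_sigma_finite/sigma_finiteT. Qed.

HB.instance Definition _ d := @Measure_isSigmaFinite.Build _ _ _ (@lebesgue d)
  (@lebesgue_sigma_finite d).

End LebesgueMeasure.
Arguments Rd R d : clear implicits.
Arguments lebesgue R d : clear implicits.

(* Frames, for a Hilbert space given as a set H of vectors of V with a form ip.
   ip may be degenerate on H: an L^2 space is represented by its set of
   square-integrable functions, on which f with ip f f = 0 is the null class. *)
Section Frames.
Context {R : realType} {V : lmodType R[i]} {K : countType}.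
Variables (ip : V -> V -> R[i]) (H : set V) (psi : K -> V).

Definition normsq (f : V) : R := complex.Re (ip f f).

Definition coefsum (f : V) : \bar R :=
  \esum_(k in [set: K]) (normc (ip f (psi k)) ^+ 2)%:E.

Definition is_bessel : Prop :=
  (forall k, H (psi k)) /\
  exists2 B : R, 0 < B &
    forall f, H f -> (coefsum f <= (B * normsq f)%:E)%E.

Definition is_frame : Prop :=
  (forall k, H (psi k)) /\
  exists A B : R, [/\ 0 < A, 0 < B &
    forall f, H f ->
      ((A * normsq f)%:E <= coefsum f <= (B * normsq f)%:E)%E].

Definition closed_span : set V :=
  [set f | H f /\ forall eps : R, 0 < eps ->
     exists (s : seq K) (c : K -> R[i]),
       normsq (f - \sum_(k <- s) c k *: psi k) < eps].

End Frames.

Definition is_frame_seq {R : realType} {V : lmodType R[i]} {K : countType}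
    (ip : V -> V -> R[i]) (H : set V) (psi : K -> V) : Prop :=
  is_frame ip (closed_span ip H psi) psi.

Section Fourier.
Context {R : realType} {d : nat}.
Local Notation mu := (lebesgue R d).

(* ^o makes this a vector space over R[i]. *)
Definition cfun := 'rV[R]_d -> R[i]^o.
Implicit Types (D E : set (Rd R d)) (f g : cfun).

Definition re f (x : Rd R d) : R := complex.Re (f x).
Definition im f (x : Rd R d) : R := complex.Im (f x).

Definition cmeasurable D f : Prop :=
  measurable_fun D (re f) /\ measurable_fun D (im f).

Definition cintegral D f : R[i] :=
  (\int[mu]_(x in D) re f x) +i* (\int[mu]_(x in D) im f x).

Definition sqint D f : \bar R :=
  (\int[mu]_(x in D) (normc (f x) ^+ 2)%:E)%E.

(* L^2(D); functions equal a.e. on D represent the same element. *)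
Definition L2 D : set cfun :=
  [set f | cmeasurable D f /\ (sqint D f < +oo)%E].

Definition L1 : set cfun :=
  [set f | cmeasurable setT f /\
           (\int[mu]_x (normc (f x))%:E < +oo)%E].

Definition ip D f g : R[i] := cintegral D (fun x => f x * conjc (g x)).

Definition dot (x y : 'rV[R]_d) : R := \sum_i x 0 i * y 0 i.

Definition expo (l : 'rV[R]_d) : cfun := fun x =>
  let t := - (2 * pi * dot l x) in cos t +i* sin t.

Definition translate (l : 'rV[R]_d) f : cfun := fun x => f (x - l).

Definition restr E f : cfun := fun x => f x * (\1_E x)%:C.

Definition fourier_int f : cfun := fun w =>
  cintegral setT (fun x => f x * expo w x).

(* g is the value at f of the L^2-continuous extension of fourier_int. *)
Definition is_fourier f g : Prop :=
  L2 setT g /\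
  exists u : nat -> cfun, [/\ forall n, (L1 `&` L2 setT) (u n),
    sqint setT (u n - f) @[n --> \oo] --> 0%E &
    sqint setT (fourier_int (u n) - g) @[n --> \oo] --> 0%E].

(* For f in L^2 such a g exists and is unique up to null sets (Plancherel);
   xget picks one. *)
Definition fourier f : cfun := xget 0 (is_fourier f).

Definition supp f : set (Rd R d) := [set w | f w != 0].

Definition PW E : set cfun :=
  [set f | L2 setT f /\ \forall w \ae mu, supp (fourier f) w -> E w].

End Fourier.
Arguments cfun R d : clear implicits.

(* Main.v *)
Require Import Defs.
From HB Require Import structures.
From mathcomp Require Import all_boot all_order all_algebra.
From mathcomp Require Import all_classical all_reals all_analysis measurable_realfun.
From mathcomp Require Import complex ring lra.

(* On the Fourier side the system T_{lam_k} h becomes e_{lam_k} H, where H is the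
   transform of h, so for f with transform F
     <f, T_{lam_k} h> = <F conj(H), e_{lam_k}>_{L^2(E)},
   and the frame property of the exponentials makes sum_k |<f, T_{lam_k} h>|^2
   comparable to the integral of |F|^2 |H|^2. Upper and lower bounds on |H| give the
   Bessel and frame inequalities; conversely testing on F = 1_S with S a level set of
   |H| inside E (a set of finite measure) shows that the bad level sets are null.
   For frame sequences one needs 1_S in the transform of the closed span: if |H| is
   bounded below on S, then 1_S / H is an L^2(E)-limit of exponential sums, and
   multiplication by the bounded function H preserves this.

   Plancherel in dimension one compares averages of a over intervals of length 2D with
   its transform: the square integral of the averages is the integral of |a^|^2 against
   a Fejer-type kernel, and D -> 0. Fubini then gives dimension d. *)

Set Implicit Arguments.
Unset Strict Implicit.
Unset Printing Implicit Defensive.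
Import Order.TTheory GRing.Theory Num.Theory.
Import numFieldNormedType.Exports.
Import ComplexField.Normc.
Local Open Scope classical_set_scope.
Local Open Scope ring_scope.
Local Open Scope complex_scope.

(** * Improper integrals on the line *)

(** Plancherel is reached without an inversion formula. For each D the square integral of the
    averages and that of the sinc-damped transform are double integrals of a(x) a(y) against one and
    the same kernel, the tent (2D - |x - y|)^+. Fatou's lemma, applied once in each direction as D
    -> 0, then gives equality even when the common value is infinite.

    Fubini works on the Borel sigma-algebra, while [lebesgue] is its completion. Hence functions are
    exchanged for Borel versions, off a Borel null set, before a transform is computed or
    translated.

    Beyond isometry, the frame argument needs 1_S to be a transform. Since 1_S is integrable, the
    multiplication formula and equality of norms suffice for this.

    Density of exponential sums in L^2(E) is drawn from the frame inequalities by iterating an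
    approximate frame operator, instead of by orthogonal complements. In the converse directions an
    upper bound on |H| has to be proved first: until then F conj(H) may fail to be square
    integrable, except for bounded F such as indicators. *)

Section Deriv.
Context {R : realType}.
Implicit Types (f g F : R -> R) (x a b : R).

Lemma isderive1_eq f x a b : is_derive x 1 f a -> a = b -> is_derive x 1 f b.
Proof. by move=> h <-. Qed.

Lemma isderive1_cst (c x : R) : is_derive x 1 (fun _ : R => c) 0.
Proof. exact: is_derive_cst. Qed.

Lemma isderive1_id x : is_derive x 1 (fun y : R => y) 1.
Proof. exact: is_derive_id. Qed.

Lemma isderive1_D f g x a b : is_derive x 1 f a -> is_derive x 1 g b ->
  is_derive x 1 (fun y => f y + g y) (a + b).
Proof. move=> ? ?; exact: is_deriveD. Qed.

Lemma isderive1_M f g x a b : is_derive x 1 f a -> is_derive x 1 g b ->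
  is_derive x 1 (fun y => f y * g y) (f x * b + g x * a).
Proof. move=> ? ?; exact: is_deriveM. Qed.

Lemma isderive1_Z f (k : R) x a : is_derive x 1 f a ->
  is_derive x 1 (fun y => k * f y) (k * a).
Proof. move=> ?; exact: is_deriveZ. Qed.

Lemma isderive1_lin (k x : R) : is_derive x 1 (fun y : R => k * y) k.
Proof. by apply: isderive1_eq (isderive1_Z k (isderive1_id x)) _; rewrite mulr1. Qed.

Lemma isderive1_N f x a : is_derive x 1 f a -> is_derive x 1 (fun y => - f y) (- a).
Proof. move=> ?; exact: is_deriveN. Qed.

Lemma isderive1_comp f g x a b : is_derive (g x) 1 f a -> is_derive x 1 g b ->
  is_derive x 1 (fun y => f (g y)) (a * b).
Proof. exact: is_derive1_comp. Qed.

Lemma isderive1_exp f x a : is_derive x 1 f a ->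
  is_derive x 1 (fun y => expR (f y)) (expR (f x) * a).
Proof. exact: isderive1_comp. Qed.

Lemma isderive1_cos f x a : is_derive x 1 f a ->
  is_derive x 1 (fun y => cos (f y)) (- sin (f x) * a).
Proof. exact: isderive1_comp. Qed.

Lemma isderive1_sin f x a : is_derive x 1 f a ->
  is_derive x 1 (fun y => sin (f y)) (cos (f x) * a).
Proof. exact: isderive1_comp. Qed.

Lemma isderive1_cont F f : (forall x, is_derive x 1 F (f x)) -> continuous F.
Proof.
move=> dF x; apply/differentiable_continuous/derivable1_diffP.
by have [] := dF x.
Qed.

Lemma ge0_FTC0y f F (l : R) : (forall x, 0 <= x -> 0 <= f x) ->
  continuous f -> (forall x, is_derive x 1 F (f x)) ->
  F x @[x --> +oo%R] --> l ->
  (\int[lebesgue_measure]_(x in `[0%R, +oo[) (f x)%:E = (l - F 0)%:E)%E.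
Proof.
move=> f0 cf dF Fl.
have dF' x : derivable F x 1 by have [] := dF x.
rewrite (@ge0_continuous_FTC2y _ f F 0 l) //.
- apply/continuous_within_itvcyP; split; first by move=> x _; exact: cf.
  by apply: cvg_at_right_filter; exact: cf.
- by apply: cvg_at_right_filter; exact: (isderive1_cont dF).
- by move=> x _; rewrite derive1E; have /@derive_val := dF x.
Qed.

Lemma cvg_expRNZ (k : R) : 0 < k -> expR (- (k * x)) @[x --> +oo%R] --> (0:R).
Proof.
move=> k0; apply: (@cvg_comp _ _ _ (fun x => k * x) (fun x => expR (- x)) _ (pinfty_nbhs R)); last exact: cvgr_expR.
by apply: gt0_cvgMry => //; exact: cvg_id.
Qed.

Lemma cvg_bndM0 (u v : R -> R) (M : R) : (forall x, `|v x| <= M) ->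
  u x @[x --> +oo%R] --> 0 -> u x * v x @[x --> +oo%R] --> 0.
Proof.
move=> vM u0; apply/norm_cvg0P.
have M0 : 0 <= M by apply: le_trans (vM 0).
apply: (@squeeze_cvgr _ _ _ _ (fun=> 0) (fun x => `|u x| * M)).
- by apply: nearW => x; rewrite normrM mulr_ge0//= ler_wpM2l.
- exact: cvg_cst.
- rewrite -(mul0r M); apply: cvgMl; apply/norm_cvg0P; rewrite /comp.
  exact: u0.
Qed.

Lemma cvg_idM_expRN (w : R) : 0 < w -> x * expR (- (w * x)) @[x --> +oo%R] --> (0:R).
Proof.
move=> w0; have w20 : 0 < w / 2 by rewrite divr_gt0.
apply: (@squeeze_cvgr _ _ _ _ (fun=> 0) (fun x => (w / 2)^-1 * expR (- (w / 2 * x)))).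
- near=> x; have x0 : 0 <= x by near: x; exact: nbhs_pinfty_ge.
  rewrite mulr_ge0 ?expR_ge0//=.
  (* One half of the exponent absorbs the factor [x], because t * exp(-t) <= 1; the other half still
     decays. *)
  have -> : - (w * x) = - (w / 2 * x) + - (w / 2 * x) by field.
  rewrite expRD mulrA ler_wpM2r ?expR_ge0//.
  rewrite -(ler_pM2l w20) mulrA mulfV ?gt_eqF// expRN ler_pdivrMr ?expR_gt0// mul1r.
  by apply: le_trans (expR_ge1Dx _); rewrite lerDr.
- exact: cvg_cst.
- by rewrite -(mulr0 (w / 2)^-1); apply: cvgMr; exact: cvg_expRNZ.
Unshelve. all: by end_near. Qed.

(** Represents 1/w^2 as a Laplace integral, so that (1 - cos(s w))/w^2 becomes a double integral
    whose order can be exchanged. *)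
Lemma int0y_idM_expRN (w : R) : 0 < w ->
  (\int[lebesgue_measure]_(y in `[0%R, +oo[) (y * expR (- (w * y)))%:E = (w ^- 2)%:E)%E.
Proof.
move=> w0; have wN : w != 0 by rewrite gt_eqF.
pose F (y : R) := - (w^-1 * (y * expR (- (w * y))) + w ^- 2 * expR (- (w * y))).
transitivity ((0 - F 0)%:E); [apply: ge0_FTC0y|]; rewrite /F; last 1 first.
- by congr EFin; rewrite mul0r !mulr0 oppr0 expR0 mulr1 add0r add0r opprK.
- by move=> x x0; rewrite mulr_ge0// expR_ge0.
- have dd x : is_derive x 1 (fun y => y * expR (- (w * y))) (x * (expR (- (w * x)) * - w) + expR (- (w * x)) * 1).
    by apply: isderive1_M (isderive1_id _) _; apply/isderive1_exp/isderive1_N/isderive1_lin.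
  exact: isderive1_cont dd.
- move=> x; apply: isderive1_eq; rewrite /GRing.scale/=.
  by field.
- rewrite [X in _ --> X](_ : 0 = - (w^-1 * 0 + w ^- 2 * 0)); last by rewrite !mulr0 addr0 oppr0.
  by apply: cvgN; apply: cvgD; apply: cvgMr; [exact: cvg_idM_expRN|exact: cvg_expRNZ].
Qed.

(** The inner integral after that exchange: the Laplace transform of 1 - cos, found from an explicit
    antiderivative. *)
Lemma int0y_1BcosM_expRN (s y : R) : 0 < y ->
  (\int[lebesgue_measure]_(w in `[0%R, +oo[) ((1 - cos (s * w)) * expR (- (y * w)))%:E =
    (s ^+ 2 / (y * (y ^+ 2 + s ^+ 2)))%:E)%E.
Proof.
move=> y0; have yN : y != 0 by rewrite gt_eqF.
have ysN : y ^+ 2 + s ^+ 2 != 0 by rewrite gt_eqF// ltr_wpDr ?sqr_ge0// exprn_gt0.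
pose F (w : R) := expR (- (y * w)) * (- y^-1 + (y ^+ 2 + s ^+ 2)^-1 * (y * cos (s * w) + - s * sin (s * w))).
transitivity ((0 - F 0)%:E); [apply: ge0_FTC0y|]; rewrite /F; last 1 first.
- rewrite !mulr0 oppr0 expR0 mul1r cos0 sin0 mulr0 addr0 mulr1; congr EFin.
  by field; rewrite ysN yN.
- by move=> x x0; rewrite mulr_ge0 ?expR_ge0// subr_ge0 cos_le1.
- have dd x : is_derive x 1 (fun w => (1 + - cos (s * w)) * expR (- (y * w)))
     ((1 + - cos (s * x)) * (expR (- (y * x)) * - y) + expR (- (y * x)) * (0 + - (- sin (s * x) * s))).
    apply: isderive1_M; last by apply/isderive1_exp/isderive1_N/isderive1_lin.
    by apply: isderive1_D (isderive1_cst _ _) _; apply/isderive1_N/isderive1_cos/isderive1_lin.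
  exact: isderive1_cont dd.
- move=> x; apply: isderive1_eq; rewrite /GRing.scale/=.
  by field; rewrite ysN yN.
- apply: (@cvg_bndM0 _ _ (`|y^-1| + `|(y ^+ 2 + s ^+ 2)^-1| * (`|y| + `|s|))); last exact: cvg_expRNZ.
  move=> x; apply: le_trans (ler_normD _ _) _; rewrite normrN lerD2l normrM ler_wpM2l//.
  apply: le_trans (ler_normD _ _) _; rewrite !normrM normrN lerD// ler_piMr//.
    by rewrite ler_norml cos_geN1 cos_le1.
  by rewrite ler_norml sin_geN1 sin_le1.
Qed.

Lemma int0y_atan (s : R) : 0 < s ->
  (\int[lebesgue_measure]_(y in `[0%R, +oo[) (s ^+ 2 / (y ^+ 2 + s ^+ 2))%:E = (s * (pi / 2))%:E)%E.
Proof.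
move=> s0; have sN : s != 0 by rewrite gt_eqF.
have ysN (y : R) : y ^+ 2 + s ^+ 2 != 0 by rewrite gt_eqF// ltr_wpDl ?sqr_ge0// exprn_gt0.
pose F (y : R) := s * atan (s^-1 * y).
transitivity ((s * (pi / 2) - F 0)%:E); [apply: ge0_FTC0y|]; rewrite /F; last 1 first.
- by rewrite mulr0 atan0 mulr0 subr0.
- by move=> x x0; rewrite divr_ge0// ?addr_ge0// sqr_ge0.
- move=> x; apply: cvgM; first exact: cvg_cst.
  apply: cvgV => //; apply: cvgD; last exact: cvg_cst.
  by rewrite expr2; under eq_fun do rewrite expr2; apply: cvgM; exact: cvg_id.
- move=> x; apply: isderive1_eq; rewrite /GRing.scale/=.
  have := ysN x; have : 1 + (s^-1 * x) ^+ 2 != 0 by rewrite gt_eqF// ltr_wpDr ?sqr_ge0.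
  by move=> h1 h2; field; rewrite sN h2 ?h1.

- apply: cvgMr; apply: (@cvg_comp _ _ _ (fun x => s^-1 * x) atan _ (pinfty_nbhs R)); last exact: cvgy_atan.
  by apply: gt0_cvgMry; [rewrite invr_gt0|exact: cvg_id].
Qed.

End Deriv.

Section Meas.
Context d (T : measurableType d) {R : realType}.
Implicit Types (f g : T -> R).

(** Inversion is continuous on the open complement of 0, and the remaining point is a measurable
    singleton. *)
Lemma measurable_funV_R : measurable_fun setT (fun x : R => x^-1).
Proof.
rewrite (_ : setT = ~` [set 0] `|` [set (0:R)]); last by rewrite setUC setUv.
apply/measurable_funU => //; first exact: measurableC.
split; last exact: measurable_fun_set1.
apply: open_continuous_measurable_fun; first exact/closed_openC/accessible_closed_set1/hausdorff_accessible/norm_hausdorff.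
move=> x /set_mem/= /eqP x0; exact: inv_continuous.
Qed.

Lemma measurable_funV f : measurable_fun setT f -> measurable_fun setT (fun x => (f x)^-1).
Proof. by move=> mf; apply: (measurableT_comp measurable_funV_R). Qed.

Lemma measurable_cos f : measurable_fun setT f -> measurable_fun setT (fun x => cos (f x)).
Proof. move=> mf; apply: (measurableT_comp _ mf); apply: continuous_measurable_fun; exact: continuous_cos. Qed.

Lemma measurable_sin f : measurable_fun setT f -> measurable_fun setT (fun x => sin (f x)).
Proof. move=> mf; apply: (measurableT_comp _ mf); apply: continuous_measurable_fun; exact: continuous_sin. Qed.

Lemma measurable_exp f : measurable_fun setT f -> measurable_fun setT (fun x => expR (f x)).
Proof. move=> mf; apply: (measurableT_comp _ mf); exact: measurable_expR. Qed.

End Meas.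

(** * Tonelli on rectangles and the integral of (1 - cos(s w))/w^2 *)

Section TonelliOn.
Local Open Scope ereal_scope.
Context d1 d2 (T1 : measurableType d1) (T2 : measurableType d2) (R : realType).
Context (m1 : {sigma_finite_measure set T1 -> \bar R}) (m2 : {sigma_finite_measure set T2 -> \bar R}).

(** Extending [f] by 0 off the rectangle reduces this to the whole space; nonnegativity is then a
    condition on the rectangle alone, as the Laplace integrands over the half-lines require. *)
Lemma fubini_tonelli_in (D1 : set T1) (D2 : set T2) (f : T1 * T2 -> \bar R) :
  measurable D1 -> measurable D2 -> measurable_fun setT f ->
  (forall p, D1 p.1 -> D2 p.2 -> 0 <= f p) ->
  \int[m1]_(x in D1) \int[m2]_(y in D2) f (x, y) = \int[m2]_(y in D2) \int[m1]_(x in D1) f (x, y).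
Proof.
move=> mD1 mD2 mf f0; pose g := f \_ (D1 `*` D2).
have mg : measurable_fun setT g.
  apply/(measurable_restrictT _ _).1; first exact: measurableX.
  exact: measurable_funTS.
have g0 p : 0 <= g p.
  by rewrite /g patchE; case: ifPn => // /set_mem[]; exact: f0.
have -> : \int[m1]_(x in D1) \int[m2]_(y in D2) f (x, y) = \int[m1]_x \int[m2]_y g (x, y).
  rewrite integral_mkcond; apply: eq_integral => x _; rewrite patchE; case: ifPn => xD.
    rewrite integral_mkcond; apply: eq_integral => y _; rewrite /g !patchE in_setX xD /=.
    by [].
  by rewrite integral0_eq// => y _; rewrite /g patchE in_setX (negbTE xD).
rewrite (fubini_tonelli _ mg g0).
rewrite [RHS]integral_mkcond; apply: eq_integral => y _; rewrite patchE; case: ifPn => yD.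
  by rewrite [RHS]integral_mkcond; apply: eq_integral => x _; rewrite /g !patchE in_setX yD andbT.
by rewrite integral0_eq// => x _; rewrite /g patchE in_setX (negbTE yD) andbF.
Qed.

End TonelliOn.

Section SincInt.
Context {R : realType}.
Local Notation mu := (@lebesgue_measure R).

(** Insert 1/w^2 = int y exp(-w y) dy and exchange the integrals: the inner one is the Laplace
    transform of 1 - cos, and what remains is an arctangent integral. *)
Lemma int0y_1Bcos_sqr (s : R) : 0 < s ->
  (\int[mu]_(w in `]0%R, +oo[) ((1 - cos (s * w)) / w ^+ 2)%:E = (s * (pi / 2))%:E)%E.
Proof.
move=> s0.
pose f (p : R * R) := ((1 - cos (s * p.1)) * (p.2 * expR (- (p.1 * p.2))))%:E.
have c0 w : 0 <= 1 - cos (s * w) by rewrite subr_ge0 cos_le1.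
have mf : measurable_fun setT f.
  apply/measurable_EFinP; apply: measurable_funM.
    by apply: measurable_funB => //; apply: measurable_cos; apply: measurable_funM.
  apply: measurable_funM => //.
  by apply: measurable_exp; apply: measurable_funN; apply: measurable_funM.
transitivity (\int[mu]_(w in `]0%R, +oo[) \int[mu]_(y in `]0%R, +oo[) f (w, y))%E.
  apply: eq_integral => w /set_mem; rewrite /= in_itv/= andbT => w0.
  rewrite /f /=; under [RHS]eq_integral do rewrite EFinM.
  rewrite ge0_integralZl_EFin//; last 2 first.
  - by move=> y; rewrite /= in_itv/= andbT => y0; rewrite lee_fin mulr_ge0 ?expR_ge0// ltW.
  - apply/measurable_EFinP; apply: measurable_funTS; apply: measurable_funM => //.
    by apply: measurable_exp; apply: measurable_funN; apply: measurable_funM.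
  rewrite integral_itv_obnd_cbnd; last first.
    apply/measurable_EFinP; apply: measurable_funTS; apply: measurable_funM => //.
    by apply: measurable_exp; apply: measurable_funN; apply: measurable_funM.
  by rewrite int0y_idM_expRN.
rewrite (@fubini_tonelli_in _ _ _ _ _ mu mu)//; last first.
  move=> -[w y]/=; rewrite !in_itv/= !andbT => w0 y0.
  by rewrite lee_fin !mulr_ge0 ?expR_ge0// ltW.
transitivity (\int[mu]_(y in `]0%R, +oo[) (s ^+ 2 / (y ^+ 2 + s ^+ 2))%:E)%E.
  apply: eq_integral => y /set_mem; rewrite /= in_itv/= andbT => y0.
  have mg : measurable_fun setT (fun w : R => (1 - cos (s * w)) * expR (- (y * w))).
    apply: measurable_funM.
      by apply: measurable_funB => //; apply: measurable_cos; apply: measurable_funM.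
    by apply: measurable_exp; apply: measurable_funN; apply: measurable_funM.
  rewrite /f /=.
  under eq_integral => w _ do rewrite mulrCA (mulrC w y) EFinM.
  rewrite ge0_integralZl_EFin//=; last 2 first.
  - by apply/measurable_EFinP; exact: measurable_funTS.
  - exact: ltW.
  rewrite integral_itv_obnd_cbnd; last by apply/measurable_EFinP; exact: measurable_funTS.
  rewrite int0y_1BcosM_expRN// -EFinM; congr EFin; field.
  by rewrite !gt_eqF// ltr_wpDr ?sqr_ge0// exprn_gt0.
rewrite integral_itv_obnd_cbnd; first exact: int0y_atan.
apply/measurable_EFinP; apply: measurable_funTS; apply: measurable_funM => //.
by apply: measurable_funV; apply: measurable_funD => //; apply: measurable_funX.
Qed.

Lemma ge0_integral_even (g : R -> \bar R) : measurable_fun setT g ->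
  (forall x, 0 <= g x)%E -> (forall x, g (- x) = g x) ->
  (\int[mu]_x g x = \int[mu]_(x in `]0%R, +oo[) g x + \int[mu]_(x in `]0%R, +oo[) g x)%E.
Proof.
move=> mg g0 ge.
have -> : [set: R] = `]-oo, 0%R] `|` `]0%R, +oo[.
  by apply/seteqP; split => // x _ /=; rewrite !in_itv/= andbT; case: (leP x 0) => ?; [left|right].
rewrite ge0_integral_setU//=; last 2 first.
- exact: measurable_funTS.
- apply/disj_setPLR => x /=; rewrite !in_itv/= andbT => x0; apply/negP; rewrite -leNgt//.
congr (_ + _)%E; rewrite integral_itv_obnd_cbnd; last exact: measurable_funTS.
by rewrite ge0_integration_by_substitution0//; apply: eq_integral => x _; rewrite ge.
Qed.

(** The absolute value on the right is what later produces tents, since these are second differences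
    of |s|. *)
Lemma integral_1Bcos_sqr (s : R) :
  (\int[mu]_w ((1 - cos (s * w)) / w ^+ 2)%:E = (pi * `|s|)%:E)%E.
Proof.
wlog s0 : s / 0 <= s.
  move=> h; have [|s0] := leP 0 s; first exact: h.
  rewrite -normrN -h ?oppr_ge0 ?ltW//; apply: eq_integral => w _.
  by rewrite mulNr cosN.
move: s0; rewrite le_eqVlt => /orP[/eqP<-|s0].
  rewrite normr0 mulr0; apply: integral0_eq => w _.
  by rewrite mul0r cos0 subrr mul0r.
rewrite ge0_integral_even; last 3 first.
- apply/measurable_EFinP; apply: measurable_funM.
    by apply: measurable_funB => //; apply: measurable_cos; apply: measurable_funM.
  by apply: measurable_funV; exact: measurable_funX.
- by move=> x; rewrite lee_fin divr_ge0 ?sqr_ge0// subr_ge0 cos_le1.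
- by move=> x; rewrite mulrN cosN sqrrN.
rewrite int0y_1Bcos_sqr// -EFinD; congr EFin; rewrite gtr0_norm//; by field.
Qed.

End SincInt.

(* The library's sigma-finite structure on [m1 \x m2] is shadowed by its probability instances; an alias recovers it. *)
Section SigmaFiniteProduct.
Local Open Scope ereal_scope.
Context d1 d2 (T1 : measurableType d1) (T2 : measurableType d2) (R : realType).
Context (m1 : {sigma_finite_measure set T1 -> \bar R}) (m2 : {sigma_finite_measure set T2 -> \bar R}).

Definition prodm : set (T1 * T2) -> \bar R := m1 \x m2.

HB.instance Definition _ := Measure.on prodm.

Lemma sigma_finite_prodm : sigma_finite setT prodm.
Proof.
have /sigma_finiteP[F [TF ndF Foo]] := sigma_finiteT m1.
have /sigma_finiteP[G [TG ndG Goo]] := sigma_finiteT m2.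
exists (fun n => F n `*` G n).
  apply/seteqP; split => // -[x y] _.
  have [i _ Fi] : (\bigcup_n F n) x by rewrite -TF.
  have [j _ Gj] : (\bigcup_n G n) y by rewrite -TG.
  exists (maxn i j) => //; split => /=.
    by move: x Fi; exact/subsetPset/ndF/leq_maxl.
  by move: y Gj; exact/subsetPset/ndG/leq_maxr.
move=> k; have [? ?] := Foo k; have [? ?] := Goo k.
split; first exact: measurableX.
by rewrite /prodm product_measure1E// lte_mul_pinfty// ge0_fin_numE.
Qed.

HB.instance Definition _ := Measure_isSigmaFinite.Build _ _ _ prodm sigma_finite_prodm.

End SigmaFiniteProduct.

(** * Tensor products and measurability of partial integrals *)

Section ProdInt.
Local Open Scope ereal_scope.
Context d1 d2 (X : measurableType d1) (Y : measurableType d2) (R : realType).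
Context (m1 : {sigma_finite_measure set X -> \bar R}) (m2 : {sigma_finite_measure set Y -> \bar R}).

Lemma integrable_tensor (b : X -> R) (c : Y -> R) :
  m1.-integrable setT (EFin \o b) -> m2.-integrable setT (EFin \o c) ->
  (m1 \x m2).-integrable setT (fun p => (b p.1 * c p.2)%:E).
Proof.
move=> ib ic.
have mb : measurable_fun setT b by apply/measurable_EFinP; exact: measurable_int ib.
have mc : measurable_fun setT c by apply/measurable_EFinP; exact: measurable_int ic.
apply/integrable12ltyP => /=.
  apply/measurable_EFinP; apply: measurable_funM; first exact: (measurableT_comp mb).
  exact: (measurableT_comp mc).
have [_ jc] := integrableP _ _ _ ic; have [_ jb] := integrableP _ _ _ ib.
have E x : \int[m2]_y `|b x * c y|%:E = `|b x|%:E * \int[m2]_y `|c y|%:E.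
  under eq_integral do rewrite normrM EFinM.
  by rewrite ge0_integralZl_EFin//; apply/measurable_EFinP; exact: measurableT_comp.
under eq_integral do rewrite E.
rewrite ge0_integralZr//; last 2 first.
- by apply/measurable_EFinP; exact: measurableT_comp.
- exact: integral_ge0.
by apply: lte_mul_pinfty => //; [exact: integral_ge0|rewrite ge0_fin_numE//; exact: integral_ge0].
Qed.

Lemma integral_tensor (b : X -> R) (c : Y -> R) :
  m1.-integrable setT (EFin \o b) -> m2.-integrable setT (EFin \o c) ->
  \int[m1 \x m2]_p (b p.1 * c p.2)%:E = (\int[m1]_x (b x)%:E) * \int[m2]_y (c y)%:E.
Proof.
move=> ib ic; rewrite -integral12_prod_meas1; last exact: integrable_tensor.
have -> : \int[m1]_x fubini_F m2 (fun p : X * Y => (b p.1 * c p.2)%:E) x = \int[m1]_x ((b x)%:E * \int[m2]_y (c y)%:E).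
  apply: eq_integral => x _; rewrite /fubini_F/=.
  by under eq_integral do rewrite EFinM; rewrite integralZl.
have /fineK <- := integrable_fin_num measurableT ic.
by rewrite integralZr.
Qed.

(** The integral of a signed function is the difference of those of its positive and negative parts,
    and Tonelli makes each of these measurable in the parameter. *)
Lemma measurable_fun_integral_G (f : X * Y -> \bar R) : measurable_fun setT f ->
  measurable_fun setT (fun y => \int[m1]_x f (x, y)).
Proof.
move=> mf.
have -> : (fun y => \int[m1]_x f (x, y)) = (fun y => fubini_G m1 f^\+ y - fubini_G m1 f^\- y).
  apply/funext => y; rewrite [LHS]integralE.
  under eq_integral do rewrite funepos_comp/=.
  by under [X in _ - X = _]eq_integral do rewrite funeneg_comp/=.
apply: emeasurable_funB; apply: measurable_fun_fubini_tonelli_G => //.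
  exact: measurable_funepos.
exact: measurable_funeneg.
Qed.

Lemma measurable_fun_integral_F (f : X * Y -> \bar R) : measurable_fun setT f ->
  measurable_fun setT (fun x => \int[m2]_y f (x, y)).
Proof.
move=> mf.
have -> : (fun x => \int[m2]_y f (x, y)) = (fun x => fubini_F m2 f^\+ x - fubini_F m2 f^\- x).
  apply/funext => y; rewrite [LHS]integralE.
  under eq_integral do rewrite funepos_comp/=.
  by under [X in _ - X = _]eq_integral do rewrite funeneg_comp/=.
apply: emeasurable_funB; apply: measurable_fun_fubini_tonelli_F => //.
  exact: measurable_funepos.
exact: measurable_funeneg.
Qed.

Lemma measurable_fun_Rintegral_G (f : X * Y -> R) : measurable_fun setT f ->
  measurable_fun setT (fun y => (\int[m1]_x f (x, y))%R).
Proof.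
move=> mf; apply: (measurableT_comp (@fine_measurable R setT measurableT)).
by apply: (measurable_fun_integral_G (f := EFin \o f)); exact/measurable_EFinP.
Qed.

Lemma measurable_fun_Rintegral_F (f : X * Y -> R) : measurable_fun setT f ->
  measurable_fun setT (fun x => (\int[m2]_y f (x, y))%R).
Proof.
move=> mf; apply: (measurableT_comp (@fine_measurable R setT measurableT)).
by apply: (measurable_fun_integral_F (f := EFin \o f)); exact/measurable_EFinP.
Qed.

End ProdInt.

(** * Square integrals of integral operators *)

Section Kernel.
Local Open Scope ereal_scope.
Context dX dZ (X : measurableType dX) (Z : measurableType dZ) (R : realType).
Context (m : {sigma_finite_measure set X -> \bar R}) (nu : {sigma_finite_measure set Z -> \bar R}).
Variables (a : X -> R) (phi : X * Z -> R) (C : Z -> R) (M : R).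
Hypothesis ia : m.-integrable setT (EFin \o a).
Hypothesis mphi : measurable_fun setT phi.
Hypothesis phiC : forall p, (`|phi p| <= C p.2)%R.
Hypothesis phiM : forall x y, \int[nu]_z `|phi (x, z) * phi (y, z)|%:E <= M%:E.

Let ma : measurable_fun setT a.
Proof. by apply/measurable_EFinP; exact: measurable_int ia. Qed.

Lemma integrable_mul_kernel z : m.-integrable setT (fun x => (a x * phi (x, z))%:E).
Proof.
apply: (@le_integrable _ _ _ _ _ _ _ (fun x => (C z)%:E * (a x)%:E)) => //.
- apply/measurable_EFinP; apply: measurable_funM => //.
  exact: measurable_fun_pair1.
- move=> x _; rewrite -EFinM !abse_EFin lee_fin !normrM mulrC ler_wpM2r//.
  by rewrite (le_trans (phiC _))// ler_norm.
- exact: integrableZl.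
Qed.

Let mphi2 p : measurable_fun setT (fun z => phi (p.1, z) * phi (p.2, z) : R)%R.
Proof. by apply: measurable_funM; exact: measurable_fun_pair2. Qed.

Let iphi2 p : nu.-integrable setT (fun z => (phi (p.1, z) * phi (p.2, z))%:E).
Proof.
apply/integrableP; split; first exact/measurable_EFinP.
by under eq_integral do rewrite abse_EFin; rewrite (le_lt_trans (phiM _ _))// ltry.
Qed.

Let u (q : (X * X) * Z) := ((a q.1.1 * phi (q.1.1, q.2)) * (a q.1.2 * phi (q.1.2, q.2)))%:E.

Let uE p z : u (p, z) = (a p.1 * a p.2)%:E * (phi (p.1, z) * phi (p.2, z))%:E.
Proof. by rewrite /u /= -EFinM mulrACA. Qed.

(** Integrating over [z] first, [phiM] bounds the integral of |u| by [M] times the square of the L^1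
    norm of [a]; this licenses Fubini for the expanded square. *)
Let iu : (prodm m m \x nu).-integrable setT u.
Proof.
have iaa : (prodm m m).-integrable setT (fun p => (a p.1 * a p.2)%:E) := integrable_tensor ia ia.
have mu : measurable_fun setT u.
  have m11 : measurable_fun setT (fun q : (X * X) * Z => q.1.1) by apply: measurableT_comp.
  have m12 : measurable_fun setT (fun q : (X * X) * Z => q.1.2) by apply: measurableT_comp.
  apply/measurable_EFinP; apply: measurable_funM; apply: measurable_funM.
  - exact: (measurableT_comp ma).
  - by apply: (measurableT_comp mphi); exact: measurable_fun_pair.
  - exact: (measurableT_comp ma).
  - by apply: (measurableT_comp mphi); exact: measurable_fun_pair.
  apply: (proj2 (@integrable12ltyP _ _ _ _ _ (prodm m m) nu u mu)).
  apply: (@le_lt_trans _ _ (\int[prodm m m]_p (`|a p.1 * a p.2|%:E * M%:E))).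
    apply: ge0_le_integral => //.
    + by move=> p _; apply: integral_ge0.
    + have H := measurable_fun_fubini_tonelli_F (m2 := nu) (abse \o u).
      apply: H; last by move=> x; exact: abse_ge0.
      by apply: (measurableT_comp _ mu); exact: abse_measurable.
    + apply: emeasurable_funM => //; apply/measurable_EFinP; apply: measurableT_comp => //.
      by apply/measurable_EFinP; exact: measurable_int iaa.
    + move=> p _; under eq_integral do rewrite uE abseM.
      rewrite ge0_integralZl//; last by apply/measurable_EFinP; exact: measurableT_comp.
      by rewrite lee_wpmul2l//; exact: phiM.
  have [_ jaa] := integrableP _ _ _ iaa.
  rewrite ge0_integralZr//; last 2 first.
  - by apply/measurable_EFinP; apply: measurableT_comp => //;
      apply/measurable_EFinP; exact: measurable_int iaa.
  - by apply: le_trans (phiM point point); exact: integral_ge0.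
  apply: lte_mul_pinfty => //; first exact: integral_ge0.
    by rewrite ge0_fin_numE//; exact: integral_ge0.
  exact: ltry.
Qed.

Let kernelE : (fun p => (a p.1 * a p.2)%:E * \int[nu]_z (phi (p.1, z) * phi (p.2, z))%:E) = fubini_F nu u.
Proof.
apply/funext => p; rewrite /fubini_F.
by under [RHS]eq_integral do rewrite uE; rewrite integralZl.
Qed.

Lemma integrable_sqr_kernel : (prodm m m).-integrable setT
  (fun p => (a p.1 * a p.2)%:E * \int[nu]_z (phi (p.1, z) * phi (p.2, z))%:E).
Proof. by rewrite kernelE; exact: integrable_fubini_F. Qed.

Let sqr_kernelE : (fun z => ((\int[m]_x (a x * phi (x, z))) ^+ 2)%:E) = fubini_G (prodm m m) u.
Proof.
apply/funext => z; rewrite /fubini_G.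
have ib := integrable_mul_kernel z.
rewrite /u /= (integral_tensor ib ib) EFinM /Rintegral fineK//.
exact: integrable_fin_num.
Qed.

Lemma measurable_sqr_kernel :
  measurable_fun setT (fun z => ((\int[m]_x (a x * phi (x, z))) ^+ 2)%:E).
Proof. by rewrite sqr_kernelE; exact: (measurable_fubini_G iu). Qed.

(** The square is a double integral over (x, y), exchanged with the one over [z]. What survives of
    [phi] is its autocorrelation, so different kernels can be compared through their
    autocorrelations alone. *)
Lemma integral_sqr_kernel :
  \int[nu]_z ((\int[m]_x (a x * phi (x, z))) ^+ 2)%:E =
  \int[prodm m m]_p ((a p.1 * a p.2)%:E * \int[nu]_z (phi (p.1, z) * phi (p.2, z))%:E).
Proof. by rewrite sqr_kernelE kernelE -[LHS]Fubini. Qed.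

End Kernel.

Section Fatou.
Context d (T : measurableType d) (R : realType) (mu : {measure set T -> \bar R}).
Local Open Scope ereal_scope.

(** Fatou for a limit that exists a.e. and a bound common to all integrals, the shape in which both
    Plancherel inequalities and completeness of L^2 use it. *)
Lemma fatou_le (f : (T -> R)^nat) (g : T -> R) (c : \bar R) :
  (forall n, measurable_fun setT (f n)) -> measurable_fun setT g ->
  (forall n x, 0 <= f n x)%R -> (forall x, 0 <= g x)%R ->
  {ae mu, forall x, f n x @[n --> \oo] --> g x} ->
  (forall n, \int[mu]_x (f n x)%:E <= c) -> \int[mu]_x (g x)%:E <= c.
Proof.
move=> mf mg f0 g0 fg fc.
have mF n : measurable_fun setT (EFin \o f n) by exact/measurable_EFinP.
have F0 n x : 0 <= (EFin \o f n) x by rewrite lee_fin.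
have E0 x : 0 <= limn_einf (fun n => (f n x)%:E).
  rewrite limn_einf_lim; apply: lime_ge; first exact: is_cvg_einfs.
  by apply: nearW => n; apply: le_ereal_inf_tmp => _ [m _ <-]; rewrite lee_fin.
have m1 : measurable_fun setT (fun x => limn_einf (fun n => (f n x)%:E)).
  rewrite (_ : (fun x => _) = (fun x => - limn_esup (fun n => - (f n x)%:E))) //.
  apply: measurableT_comp => //; apply: measurable_fun_limn_esup => n.
  by apply: measurableT_comp => //; exact/measurable_EFinP.
have m2 : measurable_fun setT (EFin \o g) by exact/measurable_EFinP.
have ale : {ae mu, forall x, setT x -> (EFin \o g) x <= limn_einf (fun n => (f n x)%:E)}.
  apply: filterS fg => x /= fgx _.
  have h : (f n x)%:E @[n --> \oo] --> (g x)%:E by apply: cvg_EFin => //; exact: nearW.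
  by rewrite (cvg_limn_einf_sup h).1.
have G0 x : setT x -> 0 <= (EFin \o g) x by rewrite lee_fin.
have := ae_ge0_le_integral measurableT G0 m2 (fun x _ => E0 x) m1 ale.
move/le_trans; apply.
apply: le_trans (fatou mu measurableT mF (fun n x _ => F0 n x)) _.
rewrite limn_einf_lim; apply: lime_le; first exact: is_cvg_einfs.
by apply: nearW => n; apply: le_trans (fc n); apply: ereal_inf_lbound; exists n => /=.
Qed.

End Fatou.

Section SinBounds.
Context {R : realType}.

Lemma normr_sin_le (x : R) : `|sin x| <= `|x|.
Proof.
wlog x0 : x / 0 <= x.
  move=> h; have [|x0] := leP 0 x; first exact: h.
  by rewrite -normrN -sinN -[leRHS]normrN; apply: h; rewrite oppr_ge0 ltW.
have [c _] := @MVT_segment R sin cos 0 x x0 (fun y _ => is_derive_sin y)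
  (continuous_subspaceT (@continuous_sin R)).
rewrite sin0 !subr0 => ->; rewrite normrM ler_piMl// ler_norml cos_geN1 cos_le1//.
Qed.

(** The quotient is the difference quotient of [sin] at 0; [u n != 0] places the sequence in the
    punctured neighbourhood filter. *)
Lemma cvg_sinc (u : R^nat) : u n @[n --> \oo] --> 0 -> (forall n, u n != 0) ->
  sin (u n) / u n @[n --> \oo] --> (1 : R).
Proof.
move=> u0 uN.
have [ds dv] := is_derive_sin (0:R).
have h : h^-1 *: ((sin \o shift 0) (h *: 1) - sin 0) @[h --> 0^'] --> (1:R).
  move/cvg_ex : (ds) => [l hl].
  have l1 : l = 1 by rewrite -(cos0 R) -dv; apply/esym/cvg_lim => //; exact: norm_hausdorff.
  by rewrite l1 in hl; exact: hl.
have uw : u n @[n --> \oo] --> (0:R)^'.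
  move=> A /= [e e0 eA]; move/cvgrPdist_lt : u0 => /(_ e e0) [N _ NA].
  by exists N => // n /NA ne; apply: eA => //; exact: uN.
have := cvg_comp _ _ uw h; apply: cvg_trans; apply: near_eq_cvg; apply: nearW => n /=.
by rewrite sin0 subr0 addr0 /GRing.scale/= mulr1 mulrC.
Qed.

End SinBounds.

(** * Plancherel for real functions on the line *)

Section Plancherel1.
Context {R : realType}.
Local Notation mu := (@lebesgue_measure R).

Definition box (D : R) (p : R * R) : R := \1_(ball p.1 D) p.2.
(** For w != 0 this is the Fourier transform of the indicator of the interval of radius [D] about 0.
    At w = 0 division by zero gives 0 instead of 2D, which affects only a null set. [wcos] and
    [wsin] are, up to sign, the real and imaginary parts of the transform of [box D (x, _)]. *)
Definition sincw (D w : R) : R := sin (2 * pi * D * w) / (pi * w).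
Definition wcos (D : R) (p : R * R) : R := sincw D p.2 * cos (2 * pi * (p.2 * p.1)).
Definition wsin (D : R) (p : R * R) : R := sincw D p.2 * sin (2 * pi * (p.2 * p.1)).

(** Two intervals of radius [D] overlap in an interval, possibly empty, whose length is the tent.
    The same tent comes out of [integral_sincw2_cos]. *)
Lemma integral_box2 (D x y : R) : 0 < D ->
  (\int[mu]_z (box D (x, z) * box D (y, z))%:E = (Num.max 0 (2 * D - `|x - y|))%:E)%E.
Proof.
move=> D0; wlog xy : x y / x <= y.
  move=> h; have [xy|/ltW xy] := leP x y; first exact: h.
  by rewrite distrC -(h y x xy); apply: eq_integral => z _; rewrite mulrC.
transitivity (\int[mu]_z (\1_(`]y - D, x + D[ : set R) z)%:E)%E.
  apply: eq_integral => z _; congr EFin; rewrite /box /= !indicE -natrM mulnb; congr (_%:R).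
  congr nat_of_bool; rewrite -in_setI; congr (_ \in _).
  apply/seteqP; split => t; rewrite /ball/= in_itv/= !ltr_distl; lra.
transitivity (lebesgue_measure (`]y - D, x + D[%classic : set R)); first by rewrite integral_indic// setIT.
rewrite lebesgue_measure_itv/= lte_fin ler0_norm ?subr_le0//.
case: ifPn => h; rewrite -?EFinB; congr EFin.
  rewrite max_r; lra.
by rewrite max_l //; lra.
Qed.

Lemma measurable_box D : measurable_fun setT (box D).
Proof.
rewrite (_ : box D = \1_[set q : R * R | `|q.1 - q.2| < D]).
  apply: measurable_indic; rewrite -[X in measurable X]setTI.
  have mf : measurable_fun setT (fun q : R * R => `|q.1 - q.2|).
    by apply: measurableT_comp => //; apply: measurable_funB.
  rewrite (_ : [set q : R * R | _] = (fun q : R * R => `|q.1 - q.2|) @^-1` `]-oo, D[).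
    exact: (mf measurableT _ (measurable_itv `]-oo, D[)).
  by apply/seteqP; split => q /=; rewrite in_itv.
by apply/funext => q; rewrite /box !indicE; congr (_%:R); congr nat_of_bool; apply/idP/idP; rewrite !inE.
Qed.

Let c (s w : R) : R := (1 - cos (s * w)) / w ^+ 2.

Let c_ge0 s w : 0 <= c s w.
Proof. by rewrite divr_ge0 ?sqr_ge0// subr_ge0 cos_le1. Qed.

Let ic s : mu.-integrable setT (EFin \o c s).
Proof.
apply/integrableP; split.
  apply/measurable_EFinP; apply: measurable_funM.
    by apply: measurable_funB => //; apply: measurable_cos; apply: measurable_funM.
  by apply: measurable_funV; exact: measurable_funX.
under eq_integral do rewrite /= ger0_norm//.
by rewrite integral_1Bcos_sqr ltry.
Qed.

(** By 2 sin(A)^2 cos(B) = cos(B) - (cos(2A + B) + cos(2A - B))/2, the left side is a second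
    difference of [c] in its frequency. At w = 0 both sides are 0 by the convention for inverses. *)
Lemma sincw2_cos D t w : sincw D w ^+ 2 * cos (2 * pi * t * w) =
  (2 * pi ^+ 2)^-1 * (2^-1 * c (2 * pi * (2 * D + t)) w + 2^-1 * c (2 * pi * (2 * D - t)) w - c (2 * pi * t) w).
Proof.
have [->|w0] := eqVneq w 0.
  by rewrite /sincw /c !mulr0 invr0 expr0n/= invr0 !mulr0 expr0n/= mul0r addr0 subr0 mulr0.
have pi0 : (pi : R) != 0 by rewrite gt_eqF// pi_gt0.
rewrite /sincw /c.
have -> : 2 * pi * (2 * D + t) * w = (2 * pi * D * w + 2 * pi * D * w) + 2 * pi * t * w by ring.
have -> : 2 * pi * (2 * D - t) * w = (2 * pi * D * w + 2 * pi * D * w) - 2 * pi * t * w by ring.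
set A := 2 * pi * D * w; set B := 2 * pi * t * w.
rewrite cosB !cosD !sinD.
have := cos2Dsin2 A => h.
have -> : cos A * cos A = 1 - sin A ^+ 2 by rewrite -h; ring.
clearbody A B; move: (pi : R) pi0 => P P0; by field; rewrite P0 w0.
Qed.

(** Term by term, the integral is half the second difference of |.| at [t] with step 2D, which
    equals the tent (2D - |t|)^+. *)
Lemma integral_sincw2_cos (D t : R) : 0 < D ->
  mu.-integrable setT (fun w => (sincw D w ^+ 2 * cos (2 * pi * t * w))%:E) /\
  (\int[mu]_w (sincw D w ^+ 2 * cos (2 * pi * t * w))%:E = (Num.max 0 (2 * D - `|t|))%:E)%E.
Proof.
move=> D0.
pose g w := ((2 * pi ^+ 2)^-1%:E * (2^-1%:E * (c (2 * pi * (2 * D + t)) w)%:E +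
    2^-1%:E * (c (2 * pi * (2 * D - t)) w)%:E - (c (2 * pi * t) w)%:E))%E.
have -> : (fun w => (sincw D w ^+ 2 * cos (2 * pi * t * w))%:E) = g.
  by apply/funext => w; rewrite sincw2_cos.
have i1 s : mu.-integrable setT (fun w => 2^-1%:E * (c s w)%:E)%E by exact: (integrableZl measurableT (2^-1) (ic s)).
have i2 := integrableD measurableT (i1 (2 * pi * (2 * D + t))) (i1 (2 * pi * (2 * D - t))).
have i3 := integrableB measurableT i2 (ic (2 * pi * t)).
split; first exact: integrableZl.
rewrite /g integralZl// integralB//; last exact: ic.
rewrite integralD//= !integralZl//; try exact: ic.
rewrite !integral_1Bcos_sqr; congr EFin.
rewrite !normrM normr_nat (ger0_norm (pi_ge0 R)).
have pi0 : (pi : R) != 0 by rewrite gt_eqF// pi_gt0.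
transitivity (2^-1 * `|2 * D + t| + 2^-1 * `|2 * D - t| - `|t|); first by move: (pi : R) pi0 => P P0; field.
by case: (ger0P t) => t0; [case: (leP 0 (2 * D - t))|case: (leP 0 (2 * D - - t))] => h3;
  case: (ger0P (2 * D + t)) => h1; case: (ger0P (2 * D - t)) => h2; lra.
Qed.

Lemma measurable_sincw D : measurable_fun setT (sincw D).
Proof.
apply: measurable_funM; first by apply: measurable_sin; apply: measurable_funM.
by apply: measurable_funV; apply: measurable_funM.
Qed.

Lemma measurable_wcos D : measurable_fun setT (wcos D).
Proof.
apply: measurable_funM; first by apply: (measurableT_comp (measurable_sincw D)).
by apply: measurable_cos; apply: measurable_funM => //; apply: measurable_funM.
Qed.

Lemma measurable_wsin D : measurable_fun setT (wsin D).
Proof.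
apply: measurable_funM; first by apply: (measurableT_comp (measurable_sincw D)).
by apply: measurable_sin; apply: measurable_funM => //; apply: measurable_funM.
Qed.

Lemma normr_wcos D p : `|wcos D p| <= `|sincw D p.2|.
Proof. by rewrite normrM ler_piMr// ler_norml cos_geN1 cos_le1. Qed.

Lemma normr_wsin D p : `|wsin D p| <= `|sincw D p.2|.
Proof. by rewrite normrM ler_piMr// ler_norml sin_geN1 sin_le1. Qed.

Lemma integral_sincw2 D : 0 < D -> (\int[mu]_w (sincw D w ^+ 2)%:E = (2 * D)%:E)%E.
Proof.
move=> D0; have [_] := integral_sincw2_cos 0 D0.
under eq_integral do rewrite mulr0 mul0r cos0 mulr1.
by move=> ->; rewrite normr0 subr0 max_r// mulr_ge0// ltW.
Qed.

(** Supplies the uniform correlation bound [phiM] for the kernels [wcos] and [wsin]. *)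
Lemma integral_norm_sincw_le (f g : R -> R) D : 0 < D -> measurable_fun setT f -> measurable_fun setT g ->
  (forall w, `|f w| <= `|sincw D w|) -> (forall w, `|g w| <= `|sincw D w|) ->
  (\int[mu]_w `|f w * g w|%:E <= (2 * D)%:E)%E.
Proof.
move=> D0 mf mg fS gS; rewrite -integral_sincw2//; apply: ge0_le_integral => //.
- by apply/measurable_EFinP; apply: measurableT_comp => //; exact: measurable_funM.
- by apply/measurable_EFinP; apply: measurable_funX; exact: measurable_sincw.
- by move=> w _; rewrite lee_fin normrM -[leRHS]ger0_norm ?sqr_ge0// normrX expr2 ler_pM.
Qed.

Section Real.
Variable a : R -> R.
Hypothesis ia : mu.-integrable setT (EFin \o a).

Definition fcos (w : R) : R := \int[mu]_x (a x * cos (2 * pi * (w * x))).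
Definition fsin (w : R) : R := \int[mu]_x (a x * sin (2 * pi * (w * x))).

(** Expand all squares by [integral_sqr_kernel]. The cosine and sine correlations add up to that of
    sincw^2 against cos(2 pi (x - y) w), whose integral is the overlap of the two boxes. *)
Lemma spectral_box (D : R) : 0 < D ->
  (\int[mu]_w (sincw D w ^+ 2 * (fcos w ^+ 2 + fsin w ^+ 2))%:E =
   \int[mu]_z ((\int[mu]_x (a x * box D (x, z))) ^+ 2)%:E)%E.
Proof.
move=> D0.
have mb := measurable_box D.
have mc := measurable_wcos D.
have ms := measurable_wsin D.
have bM x y : (\int[mu]_z `|box D (x, z) * box D (y, z)|%:E <= (2 * D)%:E)%E.
  under eq_integral do rewrite ger0_norm ?mulr_ge0//.
  rewrite integral_box2// lee_fin ge_max; have := normr_ge0 (x - y) => h; apply/andP; split; lra.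
have b1 p : `|box D p| <= 1 by rewrite /box indicE; case: (_ \in _); rewrite ?normr1// normr0.
have cM x y : (\int[mu]_z `|wcos D (x, z) * wcos D (y, z)|%:E <= (2 * D)%:E)%E.
  by apply: integral_norm_sincw_le => //; try (move=> w; exact: normr_wcos); exact: measurable_fun_pair2.
have sM x y : (\int[mu]_z `|wsin D (x, z) * wsin D (y, z)|%:E <= (2 * D)%:E)%E.
  by apply: integral_norm_sincw_le => //; try (move=> w; exact: normr_wsin); exact: measurable_fun_pair2.
pose KI := @integral_sqr_kernel _ _ _ _ R mu mu a.
pose KM := @measurable_sqr_kernel _ _ _ _ R mu mu a.
pose KB := @integrable_sqr_kernel _ _ _ _ R mu mu a.
rewrite (KI _ (fun=> 1) (2 * D) ia mb b1 bM).
have ifc w : mu.-integrable setT (EFin \o (fun x => a x * cos (2 * pi * (w * x)))).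
  apply: (@le_integrable _ _ _ mu setT measurableT _ (EFin \o a)) => //.
    apply/measurable_EFinP; apply: measurable_funM; first by apply/measurable_EFinP; exact: measurable_int ia.
    by apply: measurable_cos; apply: measurable_funM => //; apply: measurable_funM.
  by move=> x _; rewrite !abse_EFin lee_fin normrM ler_piMr// ler_norml cos_geN1 cos_le1.
have ifs w : mu.-integrable setT (EFin \o (fun x => a x * sin (2 * pi * (w * x)))).
  apply: (@le_integrable _ _ _ mu setT measurableT _ (EFin \o a)) => //.
    apply/measurable_EFinP; apply: measurable_funM; first by apply/measurable_EFinP; exact: measurable_int ia.
    by apply: measurable_sin; apply: measurable_funM => //; apply: measurable_funM.
  by move=> x _; rewrite !abse_EFin lee_fin normrM ler_piMr// ler_norml sin_geN1 sin_le1.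
have E w : ((sincw D w ^+ 2 * (fcos w ^+ 2 + fsin w ^+ 2))%:E =
   ((\int[mu]_x (a x * wcos D (x, w))) ^+ 2)%:E + ((\int[mu]_x (a x * wsin D (x, w))) ^+ 2)%:E)%E.
  rewrite /wcos /wsin /=.
  under eq_Rintegral do rewrite mulrCA.
  rewrite RintegralZl//.
  under [X in (_ + (X ^+ 2)%:E)%E]eq_Rintegral do rewrite mulrCA.
  by rewrite RintegralZl// -EFinD -/(fcos w) -/(fsin w) mulrDr !exprMn.
under eq_integral do rewrite E.
have ic2 : forall x y, mu.-integrable setT (fun w => (wcos D (x, w) * wcos D (y, w))%:E).
  move=> x y; apply/integrableP; split.
    by apply/measurable_EFinP; apply: measurable_funM; exact: measurable_fun_pair2.
  by under eq_integral do rewrite abse_EFin; rewrite (le_lt_trans (cM _ _))// ltry.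
have is2 : forall x y, mu.-integrable setT (fun w => (wsin D (x, w) * wsin D (y, w))%:E).
  move=> x y; apply/integrableP; split.
    by apply/measurable_EFinP; apply: measurable_funM; exact: measurable_fun_pair2.
  by under eq_integral do rewrite abse_EFin; rewrite (le_lt_trans (sM _ _))// ltry.
have nc p := normr_wcos D p.
have ns p := normr_wsin D p.
rewrite ge0_integralD//; first last.
- exact: (KM _ (fun w => `|sincw D w|) (2 * D) ia ms ns sM).
- by move=> w _; rewrite lee_fin sqr_ge0.
- exact: (KM _ (fun w => `|sincw D w|) (2 * D) ia mc nc cM).
- by move=> w _; rewrite lee_fin sqr_ge0.
rewrite (KI _ (fun w => `|sincw D w|) (2 * D) ia mc nc cM) (KI _ (fun w => `|sincw D w|) (2 * D) ia ms ns sM).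
rewrite -integralD//; first last.
- exact: (KB _ (2 * D) ia ms sM).
- exact: (KB _ (2 * D) ia mc cM).
apply: eq_integral => -[x y] _ /=.
have /fineK kc := integrable_fin_num measurableT (ic2 x y).
have /fineK ks := integrable_fin_num measurableT (is2 x y).
rewrite integral_box2// -kc -ks -!EFinM -EFinD -mulrDr; congr (_ * _)%:E.
apply: EFin_inj; rewrite EFinD kc ks -integralD//.
have [_ <-] := integral_sincw2_cos (x - y) D0.
apply: eq_integral => w _; rewrite -EFinD /wcos /wsin /=; congr EFin.
have -> : 2 * pi * (x - y) * w = 2 * pi * (w * x) - 2 * pi * (w * y) by ring.
by rewrite cosB; ring.
Qed.

Let ma : measurable_fun setT a.
Proof. by apply/measurable_EFinP; exact: measurable_int ia. Qed.

Lemma integral_box D x : 0 < D -> (\int[mu]_z (box D (x, z))%:E = (2 * D)%:E)%E.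
Proof.
move=> D0; transitivity (lebesgue_measure (ball x D)).
  by rewrite /box /= (integral_indic mu measurableT (measurable_ball _ _)) setIT.
by rewrite lebesgue_measure_ball ?ltW// mulr_natl.
Qed.

Lemma box_sym D x z : box D (x, z) = box D (z, x).
Proof.
rewrite /box !indicE/=; congr (nat_of_bool _)%:R.
by apply/idP/idP; rewrite !inE; exact: ball_sym.
Qed.

Let ibox D z : mu.-integrable setT (EFin \o (fun x => a x * box D (x, z))).
Proof.
apply: (@le_integrable _ _ _ mu setT measurableT _ (EFin \o a)) => //.
  apply/measurable_EFinP; apply: measurable_funM => //.
  by have := measurable_box D; exact: measurable_fun_pair1.
by move=> x _; rewrite !abse_EFin lee_fin normrM ler_piMr// /box indicE; case: (_ \in _); rewrite ?normr1// normr0.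
Qed.

Lemma avg_sqr_le D z : 0 < D ->
  (((\int[mu]_x (a x * box D (x, z))) ^+ 2)%:E <= (2 * D)%:E * \int[mu]_x (a x ^+ 2 * box D (x, z))%:E)%E.
Proof.
move=> D0; set G := Rintegral _ _ _.
have mb : measurable_fun setT (fun x => box D (x, z)).
  by have := measurable_box D; exact: measurable_fun_pair1.
have b0 x : 0 <= box D (x, z) by rewrite /box indicE.
(* [k] is the mean of [a] over the interval. Integrating 2 k a <= a^2 + k^2 yields Cauchy-Schwarz
   and stays meaningful when the integral of a^2 is infinite. *)
pose k := G / (2 * D).
have D2 : 2 * D != 0 by rewrite mulf_neq0// gt_eqF.
have h : ((2 * k * G)%:E <= \int[mu]_x (a x ^+ 2 * box D (x, z))%:E + (k ^+ 2 * (2 * D))%:E)%E.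
  apply: (@le_trans _ _ (\int[mu]_x `|2 * k * (a x * box D (x, z))|%:E)%E).
    have <- : (\int[mu]_x (2 * k * (a x * box D (x, z)))%:E)%E = (2 * k * G)%:E.
      under eq_integral do rewrite EFinM.
      rewrite integralZl//; last exact: ibox.
      by rewrite EFinM /G /Rintegral fineK//; apply: integrable_fin_num => //; exact: ibox.
    apply: (le_trans (lee_abs _)); apply: le_abse_integral => //.
    by apply/measurable_EFinP; apply: measurable_funM => //; apply: measurable_funM.
  have -> : ((k ^+ 2 * (2 * D))%:E = \int[mu]_x (k ^+ 2 * box D (x, z))%:E)%E.
    under eq_integral do rewrite EFinM box_sym.
    rewrite ge0_integralZl_EFin ?sqr_ge0// ?integral_box//.
    - by move=> x _; rewrite box_sym lee_fin.
    - by under eq_fun do rewrite box_sym; apply/measurable_EFinP.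
  rewrite -ge0_integralD//; last 4 first.
  - by move=> x _; rewrite lee_fin mulr_ge0// sqr_ge0.
  - by apply/measurable_EFinP; apply: measurable_funM => //; apply: measurable_funX.
  - by move=> x _; rewrite lee_fin mulr_ge0// sqr_ge0.
  - by apply/measurable_EFinP; apply: measurable_funM.
  apply: ge0_le_integral => //.
  - by apply/measurable_EFinP; apply: measurableT_comp => //; apply: measurable_funM => //; apply: measurable_funM.
  - by apply: emeasurable_funD; apply/measurable_EFinP; apply: measurable_funM => //; apply: measurable_funX.
  - move=> x _; rewrite -EFinD lee_fin mulrA normrM (ger0_norm (b0 x)) -mulrDl ler_wpM2r//.
    rewrite ler_norml; have := sqr_ge0 (a x - k); have := sqr_ge0 (a x + k).
    rewrite sqrrD sqrrB; lra.
have E : G = k * (2 * D) by rewrite /k divfK.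
have h2 : 2 * k * G = 2 * k * (k * (2 * D)) by rewrite -E.
rewrite h2 in h.
have : ((k ^+ 2 * (2 * D))%:E <= \int[mu]_x (a x ^+ 2 * box D (x, z))%:E)%E.
  move: h; case: (integral _ _ _) => [r| |]//=; rewrite ?lee_fin ?leey//.
  by move=> h; nra.
move=> h'; have -> : (G ^+ 2)%:E = ((2 * D)%:E * (k ^+ 2 * (2 * D))%:E)%E.
  by rewrite -EFinM [in LHS]E; congr EFin; ring.
by apply: lee_wpmul2l => //; rewrite lee_fin mulr_ge0// ltW.
Qed.

(** Integrate [avg_sqr_le] over [z] and exchange: one factor 2D comes from Cauchy-Schwarz, the other
    from the integral of the box in [z]. *)
Lemma integral_avg_sqr_le D : 0 < D ->
  (\int[mu]_z ((\int[mu]_x (a x * box D (x, z))) ^+ 2)%:E <= ((2 * D) ^+ 2)%:E * \int[mu]_x (a x ^+ 2)%:E)%E.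
Proof.
move=> D0; have mb := measurable_box D.
have b0 p : 0 <= box D p by rewrite /box indicE.
pose f (p : R * R) := (a p.1 ^+ 2 * box D p)%:E.
have mf : measurable_fun setT f.
  apply/measurable_EFinP; apply: measurable_funM => //; apply: measurable_funX.
  exact: (measurableT_comp ma).
have f0 p : (0 <= f p)%E by rewrite lee_fin mulr_ge0// sqr_ge0.
have mG := @measurable_fun_fubini_tonelli_G _ _ _ _ R mu f mf f0.
have G0 z : (0 <= fubini_G mu f z)%E by apply: integral_ge0.
apply: (@le_trans _ _ (\int[mu]_z ((2 * D)%:E * fubini_G mu f z))%E).
  have D20 : (0 <= (2 * D)%:E)%E by rewrite lee_fin mulr_ge0// ltW.
  apply: ge0_le_integral => //.
  - by move=> z _; rewrite lee_fin sqr_ge0.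
  - have b1 p : `|box D p| <= 1 by rewrite /box indicE; case: (_ \in _); rewrite ?normr1// normr0.
    have bM x y : (\int[mu]_z `|box D (x, z) * box D (y, z)|%:E <= (2 * D)%:E)%E.
      under eq_integral do rewrite ger0_norm ?mulr_ge0//.
      rewrite integral_box2// lee_fin ge_max; have := normr_ge0 (x - y) => h; apply/andP; split; lra.
    exact: (@measurable_sqr_kernel _ _ _ _ R mu mu a (box D) (fun=> 1) (2 * D) ia mb b1 bM).
  - exact: emeasurable_funM.
  - by move=> z _; exact: avg_sqr_le.
rewrite ge0_integralZl//; last by rewrite lee_fin mulr_ge0// ltW.
rewrite /fubini_G -(@fubini_tonelli _ _ _ _ R mu mu f mf f0).
rewrite (_ : ((2 * D) ^+ 2)%:E = (2 * D)%:E * (2 * D)%:E)%E; last by rewrite -EFinM expr2.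
rewrite -muleA; apply: lee_wpmul2l; first by rewrite lee_fin mulr_ge0// ltW.
rewrite -ge0_integralZl//; last 3 first.
- by apply/measurable_EFinP; apply: measurable_funX.
- by move=> x _; rewrite lee_fin sqr_ge0.
- by rewrite lee_fin mulr_ge0// ltW.
apply: ge0_le_integral => //.
- by move=> x _; apply: integral_ge0 => z _; exact: f0.
- exact: (@measurable_fun_fubini_tonelli_F _ _ _ _ R mu f mf f0).
- by apply: emeasurable_funM => //; apply/measurable_EFinP; apply: measurable_funX.
move=> x _; rewrite /f /=; under eq_integral do rewrite EFinM.
rewrite ge0_integralZl_EFin ?sqr_ge0//.
- by rewrite integral_box// muleC.
- by move=> z _; rewrite lee_fin.
- by apply/measurable_EFinP; exact: measurable_fun_pair2.
Qed.

Lemma measurable_box_avg D : 0 < D -> measurable_fun setT (fun z => \int[mu]_x (a x * box D (x, z))).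
Proof.
move=> D0; have mb := measurable_box D.
apply: (@measurable_fun_Rintegral_G _ _ _ _ R mu (fun p => a p.1 * box D p)).
by apply: measurable_funM => //; exact: (measurableT_comp ma).
Qed.

Lemma norm_box D p : `|box D p| = box D p.
Proof. by rewrite ger0_norm// /box indicE. Qed.

(** The error is at most [davg a z (D n)], the mean of |a - a z| over the ball, which tends to 0 at
    a Lebesgue point. *)
Lemma cvg_box_avg (D : R^nat) z : (forall n, 0 < D n) -> D n @[n --> \oo] --> 0 -> lebesgue_pt a z ->
  (2 * D n)^-1 * (\int[mu]_x (a x * box (D n) (x, z))) @[n --> \oo] --> a z.
Proof.
move=> D0 Dn; rewrite /lebesgue_pt => lz.
have Dp : D n @[n --> \oo] --> (0:R)^'+.
  move=> A /= [e e0 eA]; move/cvgrPdist_lt : Dn => /(_ e e0) [N _ NA].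
  by exists N => // n /NA ne; apply: eA.
have := cvg_comp _ _ Dp lz => /fine_cvgP[fn]/=.
have K n : (davg a z (D n) \is a fin_num) ->
    `|(2 * D n)^-1 * (\int[mu]_x (a x * box (D n) (x, z))) - a z| <= fine (davg a z (D n)).
  move=> fin; have D2 : 0 < 2 * D n by rewrite mulr_gt0.
  rewrite -lee_fin fineK// /davg /iavg lebesgue_measure_ball; last exact: ltW.
  rewrite -(mulr_natl (D n) 2) inver (gt_eqF D2).
  have ib : mu.-integrable setT (EFin \o (fun x => box (D n) (x, z))).
    apply/integrableP; split.
      by apply/measurable_EFinP; have := measurable_box (D n); exact: measurable_fun_pair1.
    under eq_integral do rewrite /= norm_box box_sym.
    by rewrite integral_box// ltry.
  have ib2 : mu.-integrable setT (EFin \o (fun x => (a x - a z) * box (D n) (x, z))).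
    rewrite (_ : _ \o _ = (fun x => (a x * box (D n) (x, z))%:E - (a z)%:E * (box (D n) (x, z))%:E)%E).
      by apply: integrableB => //; [exact: ibox|exact: (integrableZl measurableT (a z) ib)].
    by apply/funext => x /=; rewrite mulrBl.
  have -> : (2 * D n)^-1 * (\int[mu]_x (a x * box (D n) (x, z))) - a z =
      (2 * D n)^-1 * \int[mu]_x ((a x - a z) * box (D n) (x, z)).
    under [X in _ = _ * X]eq_Rintegral do rewrite mulrBl.
    rewrite RintegralB; [|by []|exact: ibox|exact: (integrableZl measurableT (a z) ib)].
    rewrite RintegralZl//.
    have -> : \int[mu]_x box (D n) (x, z) = 2 * D n.
      by under eq_Rintegral do rewrite box_sym; rewrite /Rintegral integral_box.
    by move: (Rintegral _ _ _) => I; field; rewrite gt_eqF.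
  rewrite normrM gtr0_norm ?invr_gt0// EFinM lee_wpmul2l//; first by rewrite lee_fin invr_ge0 ltW.
  rewrite EFin_normr_Rintegral//; apply: (le_trans (le_abse_integral _ _ _)) => //.
    exact: measurable_int ib2.
  rewrite [leRHS]integral_mkcond le_eqVlt; apply/orP; left; apply/eqP.
  apply: eq_integral => x _; rewrite patchE /= box_sym {1}/box indicE /=.
  by case: ifPn => xb; rewrite ?mulr1 ?mulr0 ?normr0.
move=> d0; apply/cvgrPdist_le => e e0.
move/cvgrPdist_le : d0 => /(_ e e0) d0; apply: filterS2 fn d0 => n fn.
rewrite sub0r normrN => h; rewrite distrC; apply: le_trans h; apply: le_trans (ler_norm _); exact: K.
Qed.

Let P w := fcos w ^+ 2 + fsin w ^+ 2.

Let P_ge0 w : 0 <= P w. Proof. by rewrite addr_ge0 ?sqr_ge0. Qed.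

Lemma measurable_fcos : measurable_fun setT fcos.
Proof.
rewrite /fcos /fsin; apply: (@measurable_fun_Rintegral_F _ _ (measurableTypeR R) (measurableTypeR R) R mu
  (fun p => a p.2 * cos (2 * pi * (p.1 * p.2)))).
apply: measurable_funM; first exact: (measurableT_comp ma).
by apply: measurable_cos; apply: measurable_funM => //; apply: measurable_funM.
Qed.

Lemma measurable_fsin : measurable_fun setT fsin.
Proof.
rewrite /fcos /fsin; apply: (@measurable_fun_Rintegral_F _ _ (measurableTypeR R) (measurableTypeR R) R mu
  (fun p => a p.2 * sin (2 * pi * (p.1 * p.2)))).
apply: measurable_funM; first exact: (measurableT_comp ma).
by apply: measurable_sin; apply: measurable_funM => //; apply: measurable_funM.
Qed.

Let D n : R := n.+1%:R^-1.
Let D0 n : 0 < D n. Proof. by rewrite invr_gt0. Qed.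

Let Dcv : D n @[n --> \oo] --> 0.
Proof. exact: cvg_harmonic. Qed.

(** Divide [spectral_box] by (2D)^2. The multiplier is at most 1 and tends to 1; normalised
    averaging contracts the L^2 norm and converges to [a] a.e. Fatou on the frequency side gives <=,
    on the space side >=. *)
Lemma plancherel_real : (\int[mu]_w (fcos w ^+ 2 + fsin w ^+ 2)%:E = \int[mu]_x (a x ^+ 2)%:E)%E.
Proof.
have mP : measurable_fun setT P.
  by apply: measurable_funD; apply: measurable_funX; [exact: measurable_fcos|exact: measurable_fsin].
have pi0 : 0 < pi :> R by exact: pi_gt0.
have D2 n : 0 < 2 * D n by rewrite mulr_gt0.
pose s n w := ((2 * D n)^-1 * sincw (D n) w) ^+ 2.
have s1 n w : s n w <= 1.
  rewrite /s -[leLHS]ger0_norm ?sqr_ge0// normrX expr_le1// normrM gtr0_norm ?invr_gt0// mulrC ler_pdivrMr// mul1r.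
  rewrite /sincw normrM normfV; have [->|w0] := eqVneq w 0; first by rewrite !mulr0 normr0 invr0 mulr0 ltW.
  rewrite ler_pdivrMr; last by rewrite normr_gt0 mulf_neq0// gt_eqF.
  apply: le_trans (normr_sin_le _) _.
  by rewrite !normrM normr_nat (gtr0_norm (D0 n)) mulrCA !mulrA; lra.
apply/eqP; rewrite eq_le; apply/andP; split.
- apply: (@fatou_le _ _ R mu (fun n w => s n w * P w)) => //.
  + move=> n; apply: measurable_funM => //; apply: measurable_funX; apply: measurable_funM => //.
    exact: measurable_sincw.
  + by move=> n w; rewrite mulr_ge0// sqr_ge0.
  (* The point 0 is excepted because [s n 0] is 0 for every [n], by the value of [sincw] there. *)
  + exists [set 0]; split => //; first exact: lebesgue_measure_set1.
    move=> w /= h; apply/eqP; apply: contraPT h => w0; apply.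
    rewrite -[X in _ --> X]mul1r; apply: cvgMl.
    rewrite -(expr1n R 2) expr2; under eq_fun do rewrite /s expr2.
    have h : (2 * D n)^-1 * sincw (D n) w @[n --> \oo] --> (1:R).
      have := @cvg_sinc R (fun n => 2 * pi * D n * w); set X := _ -> _ -> _ => HX.
      have : sin (2 * pi * D n * w) / (2 * pi * D n * w) @[n --> \oo] --> (1:R).
        apply: HX.
          rewrite -(mul0r w); apply: cvgMl; rewrite -(mulr0 (2 * pi)); exact: cvgMr.
        by move=> n; rewrite !mulf_neq0// gt_eqF.
      apply: cvg_trans; apply: near_eq_cvg; apply: nearW => n; rewrite /sincw.
      by have := D0 n; move: (D n) (pi : R) pi0 => E p p0 E0; field; rewrite w0 !gt_eqF.
    by apply: cvgM.
  + move=> n; rewrite (_ : (\int[mu]_x (s n x * P x)%:E = ((2 * D n) ^- 2)%:E * \int[mu]_w (sincw (D n) w ^+ 2 * P w)%:E)%E).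
      rewrite spectral_box//; have := integral_avg_sqr_le (D0 n).
      move/(lee_wpmul2l (x := ((2 * D n) ^- 2)%:E)); rewrite lee_fin invr_ge0 sqr_ge0 => /(_ isT).
      by rewrite muleA -EFinM mulVf ?mul1e// expf_neq0// gt_eqF.
    rewrite -ge0_integralZl_EFin//.
    * by apply: eq_integral => w _; rewrite -EFinM; congr EFin; rewrite /s exprMn exprVn -mulrA.
    * by move=> w _; rewrite lee_fin mulr_ge0 ?sqr_ge0.
    * by apply/measurable_EFinP; apply: measurable_funM => //; apply: measurable_funX; exact: measurable_sincw.
    * by rewrite invr_ge0 sqr_ge0.
- apply: (@fatou_le _ _ R mu (fun n z => ((2 * D n)^-1 * (\int[mu]_x (a x * box (D n) (x, z)))) ^+ 2)) => //.
  + by move=> n; apply: measurable_funX; apply: measurable_funM => //; exact: measurable_box_avg.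
  + exact: measurable_funX.
  + by move=> n z; exact: sqr_ge0.
  + by move=> z; exact: sqr_ge0.
  + have := lebesgue_differentiation (open_integrable_locally openT ia).
    apply: (@filterS _ _ (ae_filter_ringOfSetsType mu)) => z /(cvg_box_avg D0 Dcv) h.
    by rewrite expr2; under eq_fun do rewrite expr2; apply: cvgM.
  + move=> n; have E1 : (\int[mu]_z (((2 * D n)^-1 * (\int[mu]_x (a x * box (D n) (x, z)))) ^+ 2)%:E =
        ((2 * D n) ^- 2)%:E * \int[mu]_z ((\int[mu]_x (a x * box (D n) (x, z))) ^+ 2)%:E)%E.
      rewrite -ge0_integralZl_EFin//.
      * by apply: eq_integral => w _; rewrite -EFinM; congr EFin; rewrite exprMn exprVn.
      * by move=> w _; rewrite lee_fin sqr_ge0.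
      * by apply/measurable_EFinP; apply: measurable_funX; exact: measurable_box_avg.
      * by rewrite invr_ge0 sqr_ge0.
    have E2 : (((2 * D n) ^- 2)%:E * \int[mu]_w (sincw (D n) w ^+ 2 * P w)%:E =
        \int[mu]_w (s n w * P w)%:E)%E.
      rewrite -ge0_integralZl_EFin//.
      * by apply: eq_integral => w _; rewrite -EFinM; congr EFin; rewrite /s [in RHS]exprMn exprVn mulrA.
      * by move=> w _; rewrite lee_fin mulr_ge0 ?sqr_ge0.
      * by apply/measurable_EFinP; apply: measurable_funM => //; apply: measurable_funX; exact: measurable_sincw.
      * by rewrite invr_ge0 sqr_ge0.
    rewrite E1 -spectral_box// E2; apply: ge0_le_integral => //.
    * by move=> w _; rewrite lee_fin mulr_ge0 ?sqr_ge0.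
    * apply/measurable_EFinP; apply: measurable_funM => //; apply: measurable_funX; apply: measurable_funM => //.
      exact: measurable_sincw.
    * exact/measurable_EFinP.
    * by move=> w _; rewrite lee_fin ler_piMl.
Qed.

End Real.
End Plancherel1.

(** * Complex-valued integration *)

Section ComplexNorm.
Context {R : realType}.
Implicit Types z w : R[i].

Lemma normc2 z : normc z ^+ 2 = complex.Re z ^+ 2 + complex.Im z ^+ 2.
Proof. by case: z => a b /=; rewrite sqr_sqrtr// addr_ge0// sqr_ge0. Qed.

Lemma normc_ge0 z : 0 <= normc z.
Proof. by case: z => a b /=; exact: sqrtr_ge0. Qed.

Lemma Re_le_normc z : `|complex.Re z| <= normc z.
Proof.
rewrite -(ler_pXn2r (_ : 0 < 2)%N) ?nnegrE ?normc_ge0// normc2 real_normK ?num_real//.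
by rewrite lerDl sqr_ge0.
Qed.

Lemma Im_le_normc z : `|complex.Im z| <= normc z.
Proof.
rewrite -(ler_pXn2r (_ : 0 < 2)%N) ?nnegrE ?normc_ge0// normc2 real_normK ?num_real//.
by rewrite lerDr sqr_ge0.
Qed.

Lemma normc_le_ReIm z : normc z <= `|complex.Re z| + `|complex.Im z|.
Proof.
rewrite -(ler_pXn2r (_ : 0 < 2)%N) ?nnegrE ?normc_ge0 ?addr_ge0// normc2 sqrrD !real_normK ?num_real//.
by rewrite lerD2r lerDl mulrn_wge0// mulr_ge0.
Qed.

Lemma normc_conj z : normc z^* = normc z.
Proof. by case: z => a b /=; rewrite sqrrN. Qed.

Lemma normc_cos_sin (t : R) : normc (cos t +i* sin t) = 1.
Proof. by rewrite /= cos2Dsin2 sqrtr1. Qed.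

Lemma ReD z w : complex.Re (z + w) = complex.Re z + complex.Re w.
Proof. by case: z; case: w. Qed.

Lemma ImD z w : complex.Im (z + w) = complex.Im z + complex.Im w.
Proof. by case: z; case: w. Qed.

Lemma ReM z w : complex.Re (z * w) = complex.Re z * complex.Re w - complex.Im z * complex.Im w.
Proof. by case: z; case: w. Qed.

Lemma ImM z w : complex.Im (z * w) = complex.Re z * complex.Im w + complex.Im z * complex.Re w.
Proof. by case: z; case: w => *; rewrite /= addrC. Qed.

Lemma ReJ z : complex.Re z^* = complex.Re z. Proof. by case: z. Qed.

Lemma ImJ z : complex.Im z^* = - complex.Im z. Proof. by case: z. Qed.

Lemma ReN z : complex.Re (- z) = - complex.Re z. Proof. by case: z. Qed.

Lemma ImN z : complex.Im (- z) = - complex.Im z. Proof. by case: z. Qed.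

Lemma complex_eqP z w : complex.Re z = complex.Re w -> complex.Im z = complex.Im w -> z = w.
Proof. by case: z; case: w => /= ? ? ? ? -> ->. Qed.

Definition complexRI := (ReD, ImD, ReM, ImM, ReJ, ImJ, ReN, ImN).

Lemma mulcJ z : z * z^* = (normc z ^+ 2)%:C.
Proof. by apply: complex_eqP; rewrite normc2 !complexRI/=; ring. Qed.

Lemma normcD2_le z w : normc (z + w) ^+ 2 <= 2 * (normc z ^+ 2 + normc w ^+ 2).
Proof.
rewrite !normc2 !complexRI.
have := sqr_ge0 (complex.Re z - complex.Re w); have := sqr_ge0 (complex.Im z - complex.Im w).
rewrite !sqrrB !sqrrD; lra.
Qed.

Lemma conjcM z w : (z * w)^* = z^* * w^*. Proof. exact: rmorphM. Qed.

End ComplexNorm.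

Section CInt.
Context d (T : measurableType d) {R : realType} (mu : {measure set T -> \bar R}) (D : set T).
Hypothesis mD : measurable D.
Implicit Types f g : T -> R[i].

(** These notions are stated over any measure space so that they also serve the line, products and
    Borel measures. For [lebesgue R d] they are convertible to [cmeasurable], [cintegral], [sqint],
    [L2] and [ip]. *)
Definition cmeas f := measurable_fun D (fun x => complex.Re (f x)) /\ measurable_fun D (fun x => complex.Im (f x)).
Definition cintble f := mu.-integrable D (fun x => (complex.Re (f x))%:E) /\ mu.-integrable D (fun x => (complex.Im (f x))%:E).
Definition cint f : R[i] := (\int[mu]_(x in D) complex.Re (f x)) +i* (\int[mu]_(x in D) complex.Im (f x)).
Definition csq f : \bar R := (\int[mu]_(x in D) (normc (f x) ^+ 2)%:E)%E.
Definition cabs f : \bar R := (\int[mu]_(x in D) (normc (f x))%:E)%E.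
Definition cL2 f := cmeas f /\ (csq f < +oo)%E.
Definition cip f g := cint (fun x => f x * (g x)^*).

Lemma cmeas_cst (a : R[i]) : cmeas (fun=> a).
Proof. by split. Qed.

Lemma cmeasD f g : cmeas f -> cmeas g -> cmeas (fun x => f x + g x).
Proof.
move=> [rf jf] [rg jg]; split.
  by under eq_fun do rewrite ReD; exact: measurable_funD.
by under eq_fun do rewrite ImD; exact: measurable_funD.
Qed.

Lemma cmeasM f g : cmeas f -> cmeas g -> cmeas (fun x => f x * g x).
Proof.
move=> [rf jf] [rg jg]; split.
  by under eq_fun do rewrite ReM; apply: measurable_funB; exact: measurable_funM.
by under eq_fun do rewrite ImM; apply: measurable_funD; exact: measurable_funM.
Qed.

Lemma cmeas_conj f : cmeas f -> cmeas (fun x => (f x)^*).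
Proof.
move=> [rf jf]; split.
  by under eq_fun do rewrite ReJ.
by under eq_fun do rewrite ImJ; exact: measurable_funN.
Qed.

Lemma cmeasN f : cmeas f -> cmeas (fun x => - f x).
Proof.
by move=> [rf jf]; split; [under eq_fun do rewrite ReN|under eq_fun do rewrite ImN]; exact: measurable_funN.
Qed.

Lemma cmeasB f g : cmeas f -> cmeas g -> cmeas (fun x => f x - g x).
Proof. by move=> mf mg; apply: cmeasD => //; exact: cmeasN. Qed.

Lemma cmeas_ReC (f : T -> R) : measurable_fun D f -> cmeas (fun x => (f x)%:C).
Proof. by move=> mf; split. Qed.

Lemma cmeas_normc2 f : cmeas f -> measurable_fun D (fun x => normc (f x) ^+ 2).
Proof.
move=> [rf jf]; under eq_fun do rewrite normc2.
by apply: measurable_funD; exact: measurable_funX.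
Qed.

Lemma cmeas_normc f : cmeas f -> measurable_fun D (fun x => normc (f x)).
Proof.
move=> mf; rewrite (_ : (fun x => normc (f x)) = (fun x => Num.sqrt (normc (f x) ^+ 2))).
  have ms : measurable_fun setT (Num.sqrt : R -> R).
    by apply: continuous_measurable_fun; exact: sqrt_continuous.
  exact: (measurableT_comp ms (cmeas_normc2 mf)).
by apply/funext => x; rewrite sqrtr_sqr ger0_norm// normc_ge0.
Qed.

Lemma cabs_ge0 f : (0 <= cabs f)%E.
Proof. by apply: integral_ge0 => x _; rewrite lee_fin normc_ge0. Qed.

Lemma csq_ge0 f : (0 <= csq f)%E.
Proof. by apply: integral_ge0 => x _; rewrite lee_fin sqr_ge0. Qed.

Lemma cintble_cmeas f : cintble f -> cmeas f.
Proof. by case=> rf jf; split; apply/measurable_EFinP; [exact: measurable_int rf|exact: measurable_int jf]. Qed.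

Lemma cintbleP f : cmeas f -> cintble f <-> (cabs f < +oo)%E.
Proof.
move=> mf; have [rf jf] := mf; split.
  move=> [/integrableP[_ ir] /integrableP[_ ij]].
  apply: (@le_lt_trans _ _ (\int[mu]_(x in D) (`|complex.Re (f x)|%:E + `|complex.Im (f x)|%:E))%E).
    apply: ge0_le_integral => //.
    - by move=> x _; rewrite lee_fin normc_ge0.
    - by apply/measurable_EFinP; exact: cmeas_normc.
    - by apply/measurable_EFinP; apply: measurable_funD; exact: measurableT_comp.
    - by move=> x _; rewrite -EFinD lee_fin normc_le_ReIm.
  rewrite ge0_integralD//; first exact: lte_add_pinfty.
  - by apply/measurable_EFinP; exact: measurableT_comp.
  - by apply/measurable_EFinP; exact: measurableT_comp.
move=> lf; split; apply/integrableP; (split; first exact/measurable_EFinP);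
  apply: le_lt_trans lf; apply: ge0_le_integral => //;
  try (by move=> x _; rewrite lee_fin ?normc_ge0// ?Re_le_normc// Im_le_normc);
  apply/measurable_EFinP; try (exact: measurableT_comp); exact: cmeas_normc.
Qed.

Lemma eq_cint f g : (forall x, D x -> f x = g x) -> cint f = cint g.
Proof.
move=> fg; congr Complex; apply: eq_Rintegral => x /set_mem Dx; by rewrite fg.
Qed.

Lemma cintbleD f g : cintble f -> cintble g -> cintble (fun x => f x + g x).
Proof.
move=> [rf jf] [rg jg]; split.
  by under eq_fun do rewrite ReD EFinD; exact: integrableD.
by under eq_fun do rewrite ImD EFinD; exact: integrableD.
Qed.

Lemma cintD f g : cintble f -> cintble g -> cint (fun x => f x + g x) = cint f + cint g.
Proof.
move=> [rf jf] [rg jg]; apply: complex_eqP; rewrite !complexRI /cint /=.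
  by under eq_Rintegral do rewrite ReD; rewrite RintegralD.
by under eq_Rintegral do rewrite ImD; rewrite RintegralD.
Qed.

Let iZ (k : R) (u : T -> R) : mu.-integrable D (EFin \o u) -> mu.-integrable D (fun x => (k * u x)%:E).
Proof. by move=> iu; under eq_fun do rewrite EFinM; exact: (integrableZl mD k iu). Qed.

Lemma cintbleZ (a : R[i]) f : cintble f -> cintble (fun x => a * f x).
Proof.
move=> [rf jf]; split.
  by under eq_fun do rewrite ReM EFinB; apply: integrableB => //; exact: iZ.
by under eq_fun do rewrite ImM EFinD; apply: integrableD => //; exact: iZ.
Qed.

Lemma cintZ (a : R[i]) f : cintble f -> cint (fun x => a * f x) = a * cint f.
Proof.
move=> [rf jf]; apply: complex_eqP; rewrite !complexRI /cint /=.
  under eq_Rintegral do rewrite ReM.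
  by rewrite RintegralB//; [rewrite !RintegralZl|exact: iZ|exact: iZ].
under eq_Rintegral do rewrite ImM.
by rewrite RintegralD//; [rewrite !RintegralZl|exact: iZ|exact: iZ].
Qed.

Lemma cint_conj f : cintble f -> cint (fun x => (f x)^*) = (cint f)^*.
Proof.
move=> [rf jf]; apply: complex_eqP; rewrite !complexRI /cint /=.
  by apply: eq_Rintegral => x _; rewrite ReJ.
under eq_Rintegral do rewrite ImJ -mulN1r.
by rewrite RintegralZl// mulN1r.
Qed.

(** The constant 2 comes from bounding real and imaginary parts separately; the bound serves only to
    show finiteness. *)
Lemma normc_cint_le f : cmeas f -> ((normc (cint f))%:E <= 2%:E * cabs f)%E.
Proof.
move=> mf; have [lf|] := ltP (cabs f) +oo%E; last first.
  by rewrite leye_eq => /eqP ->; rewrite mulry gtr0_sg// mul1e leey.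
have [rf jf] := (cintbleP mf).2 lf.
apply: (@le_trans _ _ (cabs f + cabs f)%E).
  apply: (@le_trans _ _ (`|complex.Re (cint f)|%:E + `|complex.Im (cint f)|%:E)%E).
    by rewrite -EFinD lee_fin normc_le_ReIm.
  rewrite /cint /= !EFin_normr_Rintegral//; apply: leeD.
    apply: (le_trans (le_abse_integral _ _ _)) => //; first exact: measurable_int rf.
    apply: ge0_le_integral => //.
    - by have := measurable_int _ rf => h; apply: measurableT_comp.
    - by apply/measurable_EFinP; exact: cmeas_normc.
    - by move=> x _; rewrite lee_fin Re_le_normc.
  apply: (le_trans (le_abse_integral _ _ _)) => //; first exact: measurable_int jf.
  apply: ge0_le_integral => //.
  - by have := measurable_int _ jf => h; apply: measurableT_comp.
  - by apply/measurable_EFinP; exact: cmeas_normc.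
  - by move=> x _; rewrite lee_fin Im_le_normc.
by rewrite mule_natl mule2n.
Qed.

Lemma cL2M_cintble f g : cL2 f -> cL2 g -> cintble (fun x => f x * g x).
Proof.
move=> [mf lf] [mg lg]; apply/cintbleP; first exact: cmeasM.
apply: (@le_lt_trans _ _ (csq f + csq g)%E); last exact: lte_add_pinfty.
rewrite /csq -ge0_integralD//; last 4 first.
- by move=> x _; rewrite lee_fin sqr_ge0.
- by apply/measurable_EFinP; exact: cmeas_normc2.
- by move=> x _; rewrite lee_fin sqr_ge0.
- by apply/measurable_EFinP; exact: cmeas_normc2.
apply: ge0_le_integral => //.
- by move=> x _; rewrite lee_fin normc_ge0.
- by apply/measurable_EFinP; apply: cmeas_normc; exact: cmeasM.
- by apply/measurable_EFinP; apply: measurable_funD; exact: cmeas_normc2.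
- move=> x _; rewrite -EFinD lee_fin normcM.
  have := sqr_ge0 (normc (f x) - normc (g x)); have := normc_ge0 (f x); have := normc_ge0 (g x).
  rewrite sqrrB; nra.
Qed.

Lemma cL2_conj f : cL2 f -> cL2 (fun x => (f x)^*).
Proof.
move=> [mf lf]; split; first exact: cmeas_conj.
by rewrite /csq; under eq_integral do rewrite normc_conj.
Qed.

Lemma csqZ (a : R[i]) f : cmeas f -> csq (fun x => a * f x) = ((normc a ^+ 2)%:E * csq f)%E.
Proof.
move=> mf; rewrite /csq; under eq_integral do rewrite normcM exprMn EFinM.
rewrite ge0_integralZl_EFin ?sqr_ge0//.
- by move=> x _; rewrite lee_fin sqr_ge0.
- by apply/measurable_EFinP; exact: cmeas_normc2.
Qed.

Lemma csqD_le f g : cmeas f -> cmeas g -> (csq (fun x => f x + g x)%R <= 2%:E * (csq f + csq g))%E.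
Proof.
move=> mf mg.
have mf2 := cmeas_normc2 mf; have mg2 := cmeas_normc2 mg.
rewrite /csq -ge0_integralD//; last 4 first.
- by move=> x _; rewrite lee_fin sqr_ge0.
- exact/measurable_EFinP.
- by move=> x _; rewrite lee_fin sqr_ge0.
- exact/measurable_EFinP.
rewrite -ge0_integralZl_EFin//; last 2 first.
- by move=> x _; rewrite -EFinD lee_fin addr_ge0// sqr_ge0.
- by apply: emeasurable_funD; exact/measurable_EFinP.
apply: ge0_le_integral => //.
- by move=> x _; rewrite lee_fin sqr_ge0.
- by apply/measurable_EFinP; apply: cmeas_normc2; exact: cmeasD.
- by apply: emeasurable_funM => //; apply: emeasurable_funD; exact/measurable_EFinP.
- by move=> x _; rewrite -EFinD -EFinM lee_fin normcD2_le.
Qed.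

Lemma cL2D f g : cL2 f -> cL2 g -> cL2 (fun x => f x + g x).
Proof.
move=> [mf lf] [mg lg]; split; first exact: cmeasD.
apply: le_lt_trans (csqD_le mf mg) _.
by apply: lte_mul_pinfty => //; exact: lte_add_pinfty.
Qed.

Lemma cL2Z (a : R[i]) f : cL2 f -> cL2 (fun x => a * f x).
Proof.
move=> [mf lf]; split; first by apply: cmeasM => //; exact: cmeas_cst.
by rewrite csqZ//; apply: lte_mul_pinfty => //; rewrite lee_fin sqr_ge0.
Qed.

Lemma cL2N f : cL2 f -> cL2 (fun x => - f x).
Proof. by move/(cL2Z (-1)); congr cL2; apply/funext => x; rewrite mulN1r. Qed.

Lemma cL2B f g : cL2 f -> cL2 g -> cL2 (fun x => f x - g x).
Proof. by move=> lf lg; apply: cL2D => //; exact: cL2N. Qed.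

Lemma csq_le (k : R) f g : cmeas f -> cmeas g -> 0 <= k ->
  {ae mu, forall x, D x -> normc (f x) <= k * normc (g x)} ->
  (csq f <= (k ^+ 2)%:E * csq g)%E.
Proof.
move=> mf mg k0 fg.
have mf2 := cmeas_normc2 mf; have mg2 := cmeas_normc2 mg.
rewrite /csq -ge0_integralZl_EFin ?sqr_ge0//; last 2 first.
- by move=> x _; rewrite lee_fin sqr_ge0.
- exact/measurable_EFinP.
apply: ae_ge0_le_integral => //.
- by move=> x _; rewrite lee_fin sqr_ge0.
- exact/measurable_EFinP.
- by move=> x _; rewrite -EFinM lee_fin mulr_ge0 ?sqr_ge0.
- by apply: emeasurable_funM => //; exact/measurable_EFinP.
- apply: filterS fg => x fg Dx; rewrite -EFinM lee_fin -exprMn.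
  by rewrite ler_pXn2r ?nnegrE ?mulr_ge0 ?normc_ge0//; exact: fg.
Qed.

Lemma cL2_bndM (k : R) f g : cmeas f -> cL2 g -> 0 <= k ->
  {ae mu, forall x, D x -> normc (f x) <= k} -> cL2 (fun x => f x * g x).
Proof.
move=> mf [mg lg] k0 fk; have mfg := cmeasM mf mg; split => //.
apply: (@le_lt_trans _ _ ((k ^+ 2)%:E * csq g)%E).
  apply: csq_le => //; apply: filterS fk => x fk Dx.
  by rewrite normcM ler_wpM2r ?normc_ge0//; exact: fk.
by apply: lte_mul_pinfty => //; rewrite lee_fin sqr_ge0.
Qed.

Lemma cint_ae f g : cmeas f -> cmeas g -> {ae mu, forall x, D x -> f x = g x} -> cint f = cint g.
Proof.
move=> [rf jf] [rg jg] fg; congr Complex; rewrite /Rintegral; congr fine; apply: ae_eq_integral => //;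
  try exact/measurable_EFinP; by apply: filterS fg => x fg Dx /=; rewrite fg.
Qed.

Lemma csq_ae f g : cmeas f -> cmeas g -> {ae mu, forall x, D x -> f x = g x} -> csq f = csq g.
Proof.
move=> mf mg fg; apply: ae_eq_integral => //; try by apply/measurable_EFinP; exact: cmeas_normc2.
by apply: filterS fg => x fg Dx /=; rewrite fg.
Qed.

Lemma cabs_ae f g : cmeas f -> cmeas g -> {ae mu, forall x, D x -> f x = g x} -> cabs f = cabs g.
Proof.
move=> mf mg fg; apply: ae_eq_integral => //; try by apply/measurable_EFinP; exact: cmeas_normc.
by apply: filterS fg => x fg Dx /=; rewrite fg.
Qed.

Lemma csq0_ae f : cmeas f -> csq f = 0%E -> {ae mu, forall x, D x -> f x = 0}.
Proof.
move=> mf f0; have mf2 := cmeas_normc2 mf.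
have : (\int[mu]_(x in D) `|(normc (f x) ^+ 2)%:E| = 0)%E.
  by rewrite -f0; apply: eq_integral => x _; rewrite gee0_abs// lee_fin sqr_ge0.
move/(ae_eq_integral_abs mu mD); rewrite -/(measurable_fun _ _) => h.
have /h : measurable_fun D (fun x => (normc (f x) ^+ 2)%:E) by exact/measurable_EFinP.
apply: filterS => x fx Dx; have := fx Dx => -[] /eqP; rewrite expf_eq0/= => /eqP.
exact: eq0_normc.
Qed.

Lemma cip_ff f : cL2 f -> cip f f = (fine (csq f))%:C.
Proof.
move=> _; apply: complex_eqP => /=.
  by rewrite /Rintegral /csq; congr fine; apply: eq_integral => x _; rewrite mulcJ.
by rewrite /Rintegral (_ : integral _ _ _ = 0)%E//; apply: integral0_eq => x _; rewrite mulcJ.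
Qed.

Lemma cipDl (a : R[i]) f g h : cL2 f -> cL2 g -> cL2 h ->
  cip (fun x => a * f x + g x) h = a * cip f h + cip g h.
Proof.
move=> lf lg lh.
have i1 := cL2M_cintble lf (cL2_conj lh); have i2 := cL2M_cintble lg (cL2_conj lh).
rewrite /cip -cintZ// -cintD//; last exact: cintbleZ.
by apply: eq_cint => x _; rewrite mulrDl mulrA.
Qed.

Lemma cip_sym f g : cL2 f -> cL2 g -> cip g f = (cip f g)^*.
Proof.
move=> lf lg; rewrite /cip -cint_conj; last exact/cL2M_cintble/cL2_conj.
by apply: eq_cint => x _; apply: complex_eqP; rewrite !complexRI; ring.
Qed.

End CInt.

Section ErealCvg0.
Context {R : realType}.
Implicit Types u : nat -> \bar R.

Lemma cvge0_le u : (forall n, 0 <= u n)%E ->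
  (forall e : R, 0 < e -> exists N, forall n, (N <= n)%N -> (u n <= e%:E)%E) -> u n @[n --> \oo] --> 0%E.
Proof.
move=> u0 ue; apply/fine_cvgP; split.
  have [N HN] := ue 1 ltr01; exists N => // n /= Nn; rewrite ge0_fin_numE//.
  by rewrite (le_lt_trans (HN n Nn))// ltry.
apply/cvgrPdist_le => e e0; have [N HN] := ue e e0; exists N => // n /= Nn.
rewrite sub0r normrN ger0_norm ?fine_ge0//; rewrite -lee_fin fineK; first exact: HN.
by rewrite ge0_fin_numE// (le_lt_trans (HN n Nn))// ltry.
Qed.

Lemma cvge0_lt u : u n @[n --> \oo] --> 0%E -> (forall n, 0 <= u n)%E ->
  forall e : R, 0 < e -> exists N, forall n, (N <= n)%N -> (u n < e%:E)%E.
Proof.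
move=> /fine_cvgP[[N1 _ fn] ] /cvgrPdist_lt u0 un e e0.
have [N2 _ H2] := u0 e e0; exists (maxn N1 N2) => n; rewrite geq_max => /andP[n1 n2].
rewrite -[u n]fineK; last exact: fn.
by rewrite lte_fin; have := H2 n n2; rewrite /= sub0r normrN; apply: le_lt_trans; exact: ler_norm.
Qed.

End ErealCvg0.

(** * Completeness of L^2 *)

Section RieszFischer.
Context d (T : measurableType d) {R : realType} (mu : {measure set T -> \bar R}).

(** Weighted by 4^k, the squared increments still have a summable integral, so their sum is a.e. a
    finite [M]. Then the k-th increment is at most sqrt(M) 2^-k, and the series telescopes. *)
Lemma ae_cvg_of_fast_sqr (u : nat -> T -> R) : (forall k, measurable_fun setT (u k)) ->
  (forall k, \int[mu]_x ((u k.+1 x - u k x) ^+ 2)%:E <= ((4 ^+ k)^-1 / (2 ^ k.+1)%:R)%:E)%E ->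
  {ae mu, forall x, cvgn (u ^~ x)}.
Proof.
move=> mu_ uk; pose v k x := (4 ^+ k * (u k.+1 x - u k x) ^+ 2)%:E.
have v0 k x : (0 <= v k x)%E by rewrite lee_fin mulr_ge0 ?sqr_ge0 ?exprn_ge0.
have mv k : measurable_fun setT (v k).
  apply/measurable_EFinP; apply: measurable_funM => //; apply: measurable_funX.
  exact: measurable_funB.
have iv : (\int[mu]_x (\sum_(k <oo) v k x) < +oo)%E.
  rewrite integral_nneseries//.
  apply: (@le_lt_trans _ _ (\sum_(k <oo) (1 / (2 ^ k.+1)%:R)%:E)%E).
    apply: lee_nneseries => [k _ _|k _]; first exact: integral_ge0.
    rewrite /v; under eq_integral do rewrite EFinM.
    rewrite ge0_integralZl_EFin ?exprn_ge0//.
    - apply: (@le_trans _ _ ((4 ^+ k)%:E * ((4 ^+ k)^-1 / (2 ^ k.+1)%:R)%:E)%E).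
        by apply: lee_wpmul2l => //; rewrite lee_fin exprn_ge0.
      by rewrite -EFinM mulrA mulfV// expf_neq0.
    - by move=> x _; rewrite lee_fin sqr_ge0.
    - by apply/measurable_EFinP; apply: measurable_funX; exact: measurable_funB.
  by apply: le_lt_trans (epsilon_trick0 xpredT ler01) _; exact: ltry.
have sv0 x : (0 <= \sum_(k <oo) v k x)%E by exact: nneseries_ge0.
have msv : measurable_fun setT (fun x => \sum_(k <oo) v k x)%E.
  by apply: ge0_emeasurable_sum.
have : mu.-integrable setT (fun x => \sum_(k <oo) v k x)%E.
  by apply/integrableP; split => //; under eq_integral do rewrite (gee0_abs (sv0 _)).
move/integrable_ae => /(_ measurableT); apply: filterS => x /(_ I) fx.
set M := fine (\sum_(k <oo) v k x)%E.
have vM k : 4 ^+ k * (u k.+1 x - u k x) ^+ 2 <= M.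
  rewrite -lee_fin /M fineK//.
  apply: (@le_trans _ _ (\sum_(0 <= i < k.+1) v i x)%E).
    by rewrite big_nat_recr//= leeDr// sume_ge0.
  by apply: nneseries_lim_ge.
have M0 : 0 <= M by apply: le_trans (vM 0); rewrite mulr_ge0 ?sqr_ge0.
have dk k : `|u k.+1 x - u k x| <= geometric (Num.sqrt M) 2^-1 k.
  rewrite /geometric/= -(ler_pXn2r (_ : 0 < 2)%N) ?nnegrE ?mulr_ge0 ?sqrtr_ge0 ?exprn_ge0//.
  have e4 : 2^-1 ^+ 2 = 4^-1 :> R by field.
  rewrite real_normK ?num_real// exprMn sqr_sqrtr// -exprM mulnC exprM e4 exprVn.
  by rewrite ler_pdivlMr ?exprn_gt0// mulrC; exact: vM.
have cs : cvgn (series (fun k => u k.+1 x - u k x)).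
  apply: normed_cvg; apply: (series_le_cvg _ _ dk) => [k|k|]; first exact: normr_ge0.
    by rewrite mulr_ge0 ?sqrtr_ge0// exprn_ge0.
  by apply: is_cvg_geometric_series; rewrite ger0_norm// invf_lt1// ltr1n.
have -> : u ^~ x = (fun n => u 0 x + series (fun k => u k.+1 x - u k x) n).
  by apply/funext => n; rewrite /series/= telescope_sumr// addrC subrK.
by apply: is_cvgD => //; exact: is_cvg_cst.
Qed.

Lemma riesz_fischer (v : nat -> T -> R[i]) : (forall n, cL2 mu setT (v n)) ->
  (forall e : R, 0 < e -> exists N, forall m n, (N <= m)%N -> (N <= n)%N ->
     (csq mu setT (fun x => v m x - v n x)%R <= e%:E)%E) ->
  exists2 g, cL2 mu setT g & csq mu setT (fun x => v n x - g x) @[n --> \oo] --> 0%E.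
Proof.
move=> vL2 vC.
pose b k : R := (4 ^+ k)^-1 / (2 ^ k.+1)%:R.
have b0 k : 0 < b k by rewrite divr_gt0 ?invr_gt0 ?exprn_gt0// ltr0n expn_gt0.
have [N HN] := choice (fun k => vC (b k) (b0 k)).
(* Adding up all earlier thresholds makes [s] monotone and at least [N k]; the summand [k] makes it
   cofinal. *)
pose s k := (k + \sum_(j < k.+1) N j)%N.
have leq_s k : (k <= s k)%N by exact: leq_addr.
have sN k : (N k <= s k)%N by rewrite /s big_ord_recr addnA leq_addl.
have sS k : (s k <= s k.+1)%N.
  by rewrite /s [X in (_ <= _ + X)%N]big_ord_recr leq_add// leq_addr.
have vM n := (vL2 n).1.
pose U k x := complex.Re (v (s k) x); pose W k x := complex.Im (v (s k) x).
have mU k : measurable_fun setT (U k) := (vM _).1.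
have mW k : measurable_fun setT (W k) := (vM _).2.
have bnd k : (csq mu setT (fun x => v (s k.+1) x - v (s k) x)%R <= (b k)%:E)%E.
  by apply: HN; rewrite ?sN// (leq_trans (sN k)).
have hU : {ae mu, forall x, cvgn (U ^~ x)}.
  apply: ae_cvg_of_fast_sqr => // k; apply: le_trans (bnd k); apply: ge0_le_integral => //.
  - by move=> x _; rewrite lee_fin sqr_ge0.
  - by apply/measurable_EFinP; apply: measurable_funX; exact: measurable_funB.
  - by apply/measurable_EFinP; apply: cmeas_normc2; exact: cmeasB.
  - by move=> x _; rewrite lee_fin normc2 !complexRI lerDl sqr_ge0.
have hW : {ae mu, forall x, cvgn (W ^~ x)}.
  apply: ae_cvg_of_fast_sqr => // k; apply: le_trans (bnd k); apply: ge0_le_integral => //.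
  - by move=> x _; rewrite lee_fin sqr_ge0.
  - by apply/measurable_EFinP; apply: measurable_funX; exact: measurable_funB.
  - by apply/measurable_EFinP; apply: cmeas_normc2; exact: cmeasB.
  - by move=> x _; rewrite lee_fin normc2 !complexRI lerDr sqr_ge0.
(* A limsup is measurable everywhere and equals the limit wherever that exists, so the convergence
   set need not be singled out. *)
pose lims (z : nat -> T -> R) x := fine (limn_esup (fun n => (z n x)%:E)).
have mlims z : (forall k, measurable_fun setT (z k)) -> measurable_fun setT (lims z).
  move=> mz; apply: measurableT_comp; first exact: fine_measurable.
  by apply: measurable_fun_limn_esup => n; exact/measurable_EFinP.
have limsE (z : nat -> T -> R) x : cvgn (z ^~ x) -> z n x @[n --> \oo] --> lims z x.
  move=> cz; have h : (z n x)%:E @[n --> \oo] --> (limn (z ^~ x))%:E.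
    by apply: cvg_EFin => //; exact: nearW.
  by rewrite /lims (cvg_limn_einf_sup h).2.
pose g x : R[i] := (lims U x) +i* (lims W x).
have mg : cmeas setT g by split; exact: mlims.
(* Fatou along the subsequence turns the Cauchy estimate into an estimate against the limit; the
   shift by [K] discards the terms without a bound. *)
have fat n (e : R) : (exists K, forall k, (K <= k)%N -> csq mu setT (fun x => v n x - v (s k) x)%R <= e%:E)%E ->
    (csq mu setT (fun x => v n x - g x)%R <= e%:E)%E.
  move=> [K HK].
  apply: (@fatou_le _ _ R mu (fun k x => normc (v n x - v (s (k + K)%N) x) ^+ 2)).
  - by move=> k; apply: cmeas_normc2; exact: cmeasB.
  - by apply: cmeas_normc2; exact: cmeasB.
  - by move=> k x; exact: sqr_ge0.
  - by move=> x; exact: sqr_ge0.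
  - apply: filterS2 hU hW => x /limsE hU /limsE hW.
    rewrite normc2 !complexRI /=.
    under eq_fun do rewrite normc2 !complexRI.
    have hU' : U (k + K)%N x @[k --> \oo] --> lims U x by rewrite (cvg_shiftn K (U ^~ x)).
    have hW' : W (k + K)%N x @[k --> \oo] --> lims W x by rewrite (cvg_shiftn K (W ^~ x)).
    rewrite !expr2; under eq_fun do rewrite !expr2.
    by apply: cvgD; apply: cvgM; apply: cvgD; try exact: cvg_cst; exact: cvgN.
  - by move=> k; apply: HK; rewrite leq_addl.
have g2 : cL2 mu setT g.
  have [N1 H1] := vC 1 ltr01.
  have : (csq mu setT (fun x => v N1 x - g x)%R <= 1%:E)%E.
    apply: fat; exists N1 => k Nk; apply: H1 => //; exact: leq_trans Nk (leq_s k).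
  move=> h; have lB : cL2 mu setT (fun x => v N1 x - g x).
    by split; [exact: cmeasB|rewrite (le_lt_trans h)// ltry].
  have := cL2B (measurableT) (vL2 N1) lB; congr cL2; apply/funext => x; by rewrite opprB addrC subrK.
exists g => //.
apply: cvge0_le => [n|e e0]; first exact: csq_ge0.
have [N1 H1] := vC e e0; exists N1 => n Nn; apply: fat; exists N1 => k Nk.
by apply: H1 => //; apply: leq_trans Nk (leq_s k).
Qed.

End RieszFischer.

(** * Fubini for complex functions *)

Section ComplexFubini.
Context d1 d2 (X : measurableType d1) (Y : measurableType d2) (R : realType).
Context (m1 : {sigma_finite_measure set X -> \bar R}) (m2 : {sigma_finite_measure set Y -> \bar R}).

(** The inner real integral is [fine] of the extended one; the two agree where the latter is finite,
    hence almost everywhere. *)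
Lemma Rintegral_prod (F : X * Y -> R) : (m1 \x m2)%E.-integrable setT (EFin \o F) ->
  \int[m1]_x (\int[m2]_y F (x, y)) = \int[(m1 \x m2)%E]_p F p.
Proof.
move=> iF; rewrite /Rintegral; congr fine; rewrite -integral12_prod_meas1//.
have iG := integrable_fubini_F iF; have mG := measurable_int _ iG.
apply: ae_eq_integral => //.
  by apply/measurable_EFinP; apply: (measurableT_comp _ mG); exact: fine_measurable.
have := integrable_ae measurableT iG; apply: filterS => x h _ /=.
by rewrite fineK//; exact: h.
Qed.

Lemma Rintegral_Fubini (F : X * Y -> R) : (m1 \x m2)%E.-integrable setT (EFin \o F) ->
  \int[m1]_x (\int[m2]_y F (x, y)) = \int[m2]_y (\int[m1]_x F (x, y)).
Proof.
move=> iF; rewrite Rintegral_prod// /Rintegral -integral21_prod_meas1//; congr fine.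
have iG : m2.-integrable setT (fubini_G m1 (EFin \o F)).
  have mF := measurable_int _ iF.
  apply/integrableP; split; first exact: (measurable_fubini_G iF).
  have [+ _] := @integrable21ltyP _ _ _ _ _ m1 m2 _ mF => /(_ iF); apply: le_lt_trans.
  apply: ge0_le_integral => //.
  - by apply: measurableT_comp => //; exact: (measurable_fubini_G iF).
  - have := @measurable_fun_fubini_tonelli_G _ _ _ _ R m1 (abse \o (EFin \o F)).
    by apply => [|p]; [exact: measurableT_comp|exact: abse_ge0].
  - move=> y _; apply: le_abse_integral => //; exact: measurable_fun_pair1.
have mG := measurable_int _ iG; apply/esym.
apply: ae_eq_integral => //.
  by apply/measurable_EFinP; apply: (measurableT_comp _ mG); exact: fine_measurable.
have := integrable_ae measurableT iG; apply: filterS => x h _ /=.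
by rewrite fineK//; exact: h.
Qed.

Lemma cint_Fubini (F : X * Y -> R[i]) : cintble (m1 \x m2)%E setT F ->
  cint m1 setT (fun x => cint m2 setT (fun y => F (x, y))) =
  cint m2 setT (fun y => cint m1 setT (fun x => F (x, y))).
Proof.
move=> [rF jF]; apply: complex_eqP; rewrite /cint /=.
  exact: (Rintegral_Fubini (F := fun p => complex.Re (F p))).
exact: (Rintegral_Fubini (F := fun p => complex.Im (F p))).
Qed.

Lemma cint_prod (F : X * Y -> R[i]) : cintble (m1 \x m2)%E setT F ->
  cint (m1 \x m2)%E setT F = cint m1 setT (fun x => cint m2 setT (fun y => F (x, y))).
Proof.
move=> [rF jF]; apply: complex_eqP; rewrite /cint /=.
  by rewrite (Rintegral_prod (F := fun p => complex.Re (F p))).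
by rewrite (Rintegral_prod (F := fun p => complex.Im (F p))).
Qed.

Lemma cmeas_cint_F (F : X * Y -> R[i]) : cmeas setT F ->
  cmeas setT (fun x => cint m2 setT (fun y => F (x, y))).
Proof.
move=> [rF jF]; split; rewrite /cint/=.
  exact: (measurable_fun_Rintegral_F m2 rF).
exact: (measurable_fun_Rintegral_F m2 jF).
Qed.

End ComplexFubini.

(** * Semi-inner products and frames *)

Section SemiInner.
Context {R : realType} {V : lmodType R[i]}.
Variables (ip : V -> V -> R[i]) (H : set V).

(** The axioms are relative to [H], because integrals behave linearly only on integrable functions,
    and definiteness is absent, because functions equal a.e. are not identified. *)
Record semi_inner : Prop := SemiInner {
  si_0 : H 0;
  si_lin : forall a f g, H f -> H g -> H (a *: f + g);
  si_ipl : forall a f g h, H f -> H g -> H h -> ip (a *: f + g) h = a * ip f h + ip g h;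
  si_sym : forall f g, H f -> H g -> ip g f = (ip f g)^*;
  si_ge0 : forall f, H f -> 0 <= complex.Re (ip f f)
}.

Hypothesis SI : semi_inner.
Local Notation N := (normsq ip).

Lemma si_Z a f : H f -> H (a *: f).
Proof. by move=> Hf; rewrite -[_ *: _]addr0; exact: si_lin (si_0 SI). Qed.

Lemma si_D f g : H f -> H g -> H (f + g).
Proof. by move=> Hf Hg; rewrite -[f]scale1r; exact: si_lin. Qed.

Lemma si_B f g : H f -> H g -> H (f - g).
Proof. by move=> Hf Hg; rewrite addrC -scaleN1r; exact: si_lin. Qed.

Lemma si_sum (I : Type) (s : seq I) (F : I -> V) : (forall i, H (F i)) -> H (\sum_(i <- s) F i).
Proof.
by move=> HF; elim: s => [|i s ih]; [rewrite big_nil; exact: si_0|rewrite big_cons; exact: si_D].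
Qed.

Lemma ip0l h : H h -> ip 0 h = 0.
Proof.
move=> Hh; have := si_ipl SI 0 (si_0 SI) (si_0 SI) Hh; rewrite scale0r addr0 mul0r add0r => e.
have := si_ipl SI 1 (si_0 SI) (si_0 SI) Hh; rewrite scale1r addr0 mul1r => /eqP.
by rewrite -subr_eq0 opprD addrA subrr sub0r oppr_eq0 => /eqP.
Qed.

Lemma ip_suml (I : Type) (s : seq I) (c : I -> R[i]) (F : I -> V) h : (forall i, H (F i)) -> H h ->
  ip (\sum_(i <- s) c i *: F i) h = \sum_(i <- s) c i * ip (F i) h.
Proof.
move=> HF Hh; elim: s => [|i s ih]; first by rewrite !big_nil ip0l.
by rewrite !big_cons (si_ipl SI)// ?ih//; apply: si_sum => j; exact: si_Z.
Qed.

Lemma normsq_ge0 f : H f -> 0 <= N f. Proof. exact: (si_ge0 SI). Qed.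

Lemma ip_ff f : H f -> ip f f = (N f)%:C.
Proof.
move=> Hf; apply: complex_eqP => //=; have := si_sym SI Hf Hf.
by case: (ip f f) => a b [] /eqP; rewrite -subr_eq0 opprK -mulr2n mulrn_eq0/= => /eqP.
Qed.

Lemma normsqDZ a f g : H f -> H g ->
  N (a *: f + g) = normc a ^+ 2 * N f + 2 * complex.Re (a * ip f g) + N g.
Proof.
move=> Hf Hg; have Hfg := si_lin SI a Hf Hg; rewrite {1}/normsq.
rewrite (si_ipl SI)// (si_sym SI Hfg Hf) (si_sym SI Hfg Hg) !(si_ipl SI)//.
rewrite (ip_ff Hf) (ip_ff Hg) (si_sym SI Hf Hg) normc2 !complexRI/=; ring.
Qed.

Lemma normsqZ a f : H f -> N (a *: f) = normc a ^+ 2 * N f.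
Proof.
move=> Hf; have := normsqDZ a Hf (si_0 SI); rewrite addr0 => ->.
have H0 := si_0 SI.
by rewrite (si_sym SI H0 Hf) ip0l// conjc0 mulr0 /normsq ip0l//= mulr0 !addr0.
Qed.

Lemma normsqN f : H f -> N (- f) = N f.
Proof. by move=> Hf; rewrite -scaleN1r normsqZ// normcN normc1 expr1n mul1r. Qed.

Lemma normsqB_sym f g : H f -> H g -> N (f - g) = N (g - f).
Proof. by move=> Hf Hg; rewrite -normsqN ?opprB//; exact: si_B. Qed.

Lemma cauchy_schwarz f g : H f -> H g -> normc (ip f g) ^+ 2 <= N f * N g.
Proof.
move=> Hf Hg; set z := ip f g.
(* Nonnegativity of the form at g - t z^* f, a real quadratic in [t]. *)
have key (t : R) : 0 <= t ^+ 2 * normc z ^+ 2 * N f - 2 * t * normc z ^+ 2 + N g.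
  have := normsq_ge0 (si_lin SI (- (t%:C * z^*)) Hf Hg); rewrite normsqDZ//.
  rewrite normcN normcM exprMn normc_conj /= expr0n/= addr0 sqrtr_sqr real_normK ?num_real// -/z.
  suff -> : 2 * complex.Re (- (t%:C * z^*) * z) = - (2 * t * normc z ^+ 2) by [].
  by rewrite normc2 !complexRI/=; ring.
have F0 := normsq_ge0 Hf; have G0 := normsq_ge0 Hg.
have z0 : 0 <= normc z ^+ 2 by exact: sqr_ge0.
have [F0'|F0'] := eqVneq (N f) 0.
  (* A null vector [f] may be nonzero. The bound is then affine in [t], and this [t] would make it
     -1 unless [z] is 0. *)
  rewrite F0' mul0r; have := key ((N g + 1) / 2 / (normc z ^+ 2)); rewrite F0' mulr0 add0r.
  have [->//|zN] := eqVneq (normc z ^+ 2) 0.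
  have -> : 2 * ((N g + 1) / 2 / normc z ^+ 2) * normc z ^+ 2 = N g + 1.
    by move: (normc z ^+ 2) zN (N g) => p pN G; field.
  by lra.
have Fp : 0 < N f by rewrite lt_def F0'.
have := key (N f)^-1.
have -> : (N f)^-1 ^+ 2 * normc z ^+ 2 * N f - 2 * (N f)^-1 * normc z ^+ 2 + N g = N g - normc z ^+ 2 / N f by field.
by rewrite subr_ge0 ler_pdivrMr// mulrC.
Qed.

Lemma normsqD_le f g : H f -> H g -> N (f + g) <= 2 * (N f + N g).
Proof.
move=> Hf Hg; have := normsqDZ 1 Hf Hg; rewrite scale1r => ->.
have := normsq_ge0 (si_lin SI (-1) Hf Hg); rewrite normsqDZ//.
rewrite normcN normc1 expr1n !mul1r mulN1r ReN; lra.
Qed.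

(* By polarization, a map preserving the norms of all linear combinations preserves the form. *)
Lemma Re_ip_polar f g : H f -> H g -> 2 * complex.Re (ip f g) = N (f + g) - N f - N g.
Proof.
move=> Hf Hg; have := normsqDZ 1 Hf Hg; rewrite scale1r => ->.
rewrite normc1 expr1n !mul1r; ring.
Qed.

Lemma Im_ip_polar f g : H f -> H g -> 2 * complex.Im (ip f g) = N f + N g - N ('i *: f + g).
Proof.
move=> Hf Hg; rewrite normsqDZ// normc2 !complexRI /=; ring.
Qed.

End SemiInner.

Section FrameTheory.
Context {R : realType} {V : lmodType R[i]} {K : countType}.
Variables (ip : V -> V -> R[i]) (H : set V) (psi : K -> V).
Hypothesis SI : semi_inner ip H.
Hypothesis Hpsi : forall k, H (psi k).
Local Notation N := (normsq ip).

(** Indices are distinct, so that sums of squared coefficients over [s] are partial sums of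
    [coefsum]. *)
Definition fspan : set V :=
  [set g | exists s c, uniq s /\ g = \sum_(k <- s) c k *: psi k].

Lemma fspan_H g : fspan g -> H g.
Proof. by move=> [s [c [_ ->]]]; apply: (si_sum SI) => k; exact: (si_Z SI). Qed.

Let widen s t (c : K -> R[i]) : uniq s -> uniq t -> {subset s <= t} ->
  \sum_(k <- s) c k *: psi k = \sum_(k <- t) (if k \in s then c k else 0) *: psi k.
Proof.
move=> us ut st.
rewrite [RHS](eq_bigr (fun k => if k \in s then c k *: psi k else 0)); last first.
  by move=> k _; case: ifP => //; rewrite scale0r.
rewrite -big_mkcond -big_filter; apply: perm_big; apply: uniq_perm => //; first exact: filter_uniq.
by move=> k; rewrite mem_filter; case: (boolP (k \in s)) => //= /st ->.
Qed.

Lemma fspan_lin a f g : fspan f -> fspan g -> fspan (a *: f + g).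
Proof.
move=> [s [c [us ->]]] [t [e [ut ->]]]; pose r := undup (s ++ t).
exists r, (fun k => a * (if k \in s then c k else 0) + (if k \in t then e k else 0)).
have ur : uniq r by exact: undup_uniq.
split => //; rewrite (@widen s r c)// ?(@widen t r e)//; last 2 first.
- by move=> k; rewrite mem_undup mem_cat => ->; rewrite orbT.
- by move=> k; rewrite mem_undup mem_cat => ->.
by rewrite scaler_sumr -big_split /=; apply: eq_bigr => k _; rewrite scalerDl scalerA.
Qed.

Definition psum (s : seq K) f : R := \sum_(k <- s) normc (ip f (psi k)) ^+ 2.

Lemma psum_le_coefsum s f : uniq s -> ((psum s f)%:E <= coefsum ip psi f)%E.
Proof.
move=> us; rewrite /coefsum /psum -sumEFin.
apply: ereal_sup_ubound; exists [set` s]; first by split => //; exact: finite_seq.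
by rewrite -fsbig_seq.
Qed.

Lemma coefsum_le (B : \bar R) f : (forall s, uniq s -> ((psum s f)%:E <= B)%E) -> (coefsum ip psi f <= B)%E.
Proof.
move=> h; apply: ge_ereal_sup => _ [X [/finite_seqP[s ->] _] <-].
have -> : [set` s] = [set` undup s] by apply/seteqP; split => k /=; rewrite mem_undup.
rewrite -fsbig_seq ?undup_uniq// sumEFin; apply: h; exact: undup_uniq.
Qed.

Lemma lt_coefsum (b : R) f : (b%:E < coefsum ip psi f)%E -> exists2 s, uniq s & b < psum s f.
Proof.
move=> h; apply: contrapT => hn; move: h; apply/negP; rewrite -leNgt.
apply: coefsum_le => s us; rewrite lee_fin leNgt; apply/negP => h; apply: hn; by exists s.
Qed.

(** Restricted to finite combinations, because these certainly lie in [closed_span], where a frame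
    sequence provides its inequality; [bessel_extend] carries it to all of [H]. *)
Definition bessel_bound (B : R) := forall g, fspan g -> forall s, uniq s -> psum s g <= B * N g.

(** Synthesis is adjoint to analysis and has the same bound. Here [N g] is the real part of sum c_k
    <psi_k, g>; AM-GM with weight [B] bounds it by half the claim plus a multiple of [psum s g],
    which the Bessel bound reduces to half of [N g]. *)
Lemma bessel_dual B s (c : K -> R[i]) : 0 < B -> bessel_bound B -> uniq s ->
  N (\sum_(k <- s) c k *: psi k) <= B * \sum_(k <- s) normc (c k) ^+ 2.
Proof.
move=> B0 hB us; set g := \sum_(k <- s) _.
have sg : fspan g by exists s, c.
have Hg := fspan_H sg.
have E : N g = \sum_(k <- s) complex.Re (c k * ip (psi k) g).
  by rewrite {1}/normsq {1}/g (ip_suml SI)// raddf_sum.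
have : N g <= \sum_(k <- s) (2^-1 * B * normc (c k) ^+ 2 + 2^-1 * B^-1 * normc (ip g (psi k)) ^+ 2).
  rewrite E; apply: ler_sum => k _.
  apply: le_trans (ler_norm _) _; apply: le_trans (Re_le_normc _) _.
  rewrite normcM (si_sym SI Hg (Hpsi k)) normc_conj.
  have := sqr_ge0 (B * normc (c k) - normc (ip g (psi k))) => h.
  rewrite -(ler_pM2l B0) -subr_ge0.
  move: h; set p := normc _; set q := normc _ => h.
  have -> : B * (2^-1 * B * p ^+ 2 + 2^-1 * B^-1 * q ^+ 2) - B * (p * q) = 2^-1 * (B * p - q) ^+ 2.
    by field; rewrite gt_eqF.
  by rewrite mulr_ge0.
rewrite big_split /= -!mulr_sumr -/(psum s g) => h.
have := hB g sg s us; rewrite -(ler_pdivrMl _ _ B0) => h2.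
have h3 : 2^-1 * B^-1 * psum s g <= 2^-1 * N g by rewrite -mulrA ler_pM2l.
have : N g <= 2^-1 * B * (\sum_(k <- s) normc (c k) ^+ 2) + 2^-1 * N g.
  by apply: le_trans h _; rewrite lerD2l.
by rewrite -!mulrA; set W := B * _; lra.
Qed.

(* The residual of one step of the frame algorithm. *)
Lemma frame_step B s f : 0 < B -> bessel_bound B -> uniq s -> H f ->
  exists2 g, fspan g & N (f - g) <= N f - psum s f / B.
Proof.
move=> B0 hB us Hf; pose c k := ip f (psi k).
pose g := \sum_(k <- s) c k *: psi k.
have sg : fspan g by exists s, c.
have Hg := fspan_H sg.
(* With step t the residual is at most N f - 2 t psum + t^2 B psum, which is least at t = 1/B. *)
exists ((B^-1)%:C *: g).
  by rewrite -[_ *: _]addr0; apply: fspan_lin => //; exists [::], c; rewrite big_nil.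
have -> : f - B^-1%:C *: g = (- B^-1%:C) *: g + f by rewrite addrC scaleNr.
rewrite (normsqDZ SI)//.
have -> : ip g f = (psum s f)%:C.
  rewrite (ip_suml SI)//; rewrite /psum rmorph_sum; apply: eq_bigr => k _.
  by rewrite /c (si_sym SI Hf (Hpsi k)) mulcJ.
have := bessel_dual c B0 hB us; rewrite -/g -/(psum s f) => h.
rewrite normcN normc2 !complexRI /= expr0n/= addr0 mulr0 subr0.
have : B^-1 ^+ 2 * N g <= B^-1 ^+ 2 * (B * psum s f) by rewrite ler_pM2l// exprn_gt0// invr_gt0.
have -> : B^-1 ^+ 2 * (B * psum s f) = psum s f / B by field; rewrite gt_eqF.
rewrite mulNr [B^-1 * _]mulrC; lra.
Qed.

(** The residual of a frame step has nonnegative norm, which forces psum <= B N f for an arbitrary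
    [f]. *)
Lemma bessel_extend B f : 0 < B -> bessel_bound B -> H f -> (coefsum ip psi f <= (B * N f)%:E)%E.
Proof.
move=> B0 hB Hf; apply: coefsum_le => s us; rewrite lee_fin.
have [g sg h] := frame_step B0 hB us Hf.
have := normsq_ge0 SI (si_B SI Hf (fspan_H sg)) => h2.
have : psum s f / B <= N f by lra.
by rewrite ler_pdivrMr// mulrC.
Qed.

(** By the lower frame bound each frame step multiplies the squared residual by at most a fixed q <
    1, so finitely many steps reach any accuracy. *)
Lemma frame_dense f (e : R) : is_frame ip H psi -> H f -> 0 < e ->
  exists2 g, fspan g & N (f - g) < e.
Proof.
move=> [_ [A [B [A0 B0 hAB]]]] Hf e0.
have hB : bessel_bound B.
  move=> g sg s us; rewrite -lee_fin; apply: le_trans (psum_le_coefsum _ us) _.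
  by have /andP[] := hAB g (fspan_H sg).
(* The 2 appears because a finite partial sum captures only more than half of [A * N h]. The maximum
   keeps [q] nonnegative: A <= B cannot be deduced when all norms vanish. *)
pose q := Num.max 0 (1 - A / (2 * B)).
have q0 : 0 <= q by rewrite le_max lexx.
have q1 : q < 1 by rewrite gt_max ltr01/= gtrBl divr_gt0// mulr_gt0.
have step h : H h -> exists2 g, fspan g & N (h - g) <= q * N h.
  (* A null [h] is set apart because the choice of [s] needs the strict inequality A/2 * N h < A * N
     h. *)
  move=> Hh; have [h0|hN] := eqVneq (N h) 0.
    exists 0; first by exists [::], (fun=> 0); rewrite big_nil.
    by rewrite subr0 h0 mulr0.
  have hp : 0 < N h by rewrite lt_def hN (normsq_ge0 SI).
  have [s us hs] : exists2 s, uniq s & A / 2 * N h < psum s h.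
    apply: lt_coefsum; have /andP[+ _] := hAB h Hh; apply: lt_le_trans.
    by rewrite lte_fin ltr_pM2r//; lra.
  have [g sg hg] := frame_step B0 hB us Hh; exists g => //; apply: le_trans hg _.
  apply: (@le_trans _ _ ((1 - A / (2 * B)) * N h)); last by rewrite ler_pM2r// le_max lexx orbT.
  rewrite mulrBl mul1r lerB// ler_pdivlMr//.
  have -> : A / (2 * B) * N h * B = A / 2 * N h by field; rewrite gt_eqF.
  exact: ltW.
have iter n : exists2 g, fspan g & N (f - g) <= q ^+ n * N f.
  elim: n => [|n [g sg hg]].
    exists 0; first by exists [::], (fun=> 0); rewrite big_nil.
    by rewrite subr0 expr0 mul1r.
  have [g' sg' hg'] := step (f - g) (si_B SI Hf (fspan_H sg)).
  exists (g + g'); first by rewrite -[g]scale1r; exact: fspan_lin.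
  rewrite opprD addrA; apply: le_trans hg' _; rewrite exprS -mulrA.
  exact: ler_wpM2l.
have qn : q ^+ n * N f @[n --> \oo] --> 0.
  rewrite -(mul0r (N f)); apply: cvgMl; apply: cvg_expr; by rewrite ger0_norm.
move/cvgrPdist_lt : qn => /(_ e e0) [n _ /(_ n (leqnn n))].
rewrite /= sub0r normrN => hn; have [g sg hg] := iter n; exists g => //.
by apply: le_lt_trans hg _; apply: le_lt_trans hn; exact: ler_norm.
Qed.

Lemma fspan_closed_span g : fspan g -> closed_span ip H psi g.
Proof.
move=> sg; split; first exact: fspan_H.
move=> e e0; have [s [c [_ E]]] := sg; exists s, c; rewrite -E subrr /normsq.
by rewrite (ip0l SI)//; exact: (si_0 SI).
Qed.

End FrameTheory.

(** * Plancherel for integrable Borel functions *)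

Section CExp.
Context {R : realType}.
Implicit Types s t : R.

Definition expi t : R[i] := cos t +i* sin t.

Lemma expiD s t : expi (s + t) = expi s * expi t.
Proof. by apply: complex_eqP; rewrite !complexRI /= ?cosD ?sinD; ring. Qed.

Lemma expi0 : expi 0 = 1.
Proof. by rewrite /expi cos0 sin0. Qed.

Lemma normc_expi t : normc (expi t) = 1.
Proof. exact: normc_cos_sin. Qed.

Lemma cmeas_expi d (T : measurableType d) (f : T -> R) :
  measurable_fun setT f -> cmeas setT (fun x => expi (f x)).
Proof. by move=> mf; split; [exact: measurable_cos|exact: measurable_sin]. Qed.

Lemma cintble_expi d (T : measurableType d) (mu : {measure set T -> \bar R}) (f : T -> R[i]) (t : T -> R) :
  cmeas setT f -> (cabs mu setT f < +oo)%E -> measurable_fun setT t ->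
  cintble mu setT (fun x => f x * expi (t x)).
Proof.
move=> mf lf mt; apply/cintbleP => //; first exact/cmeasM/cmeas_expi.
by rewrite /cabs; under eq_integral do rewrite normcM normc_expi mulr1.
Qed.

End CExp.

Lemma add_ereal_inj {R : realType} (x y : \bar R) : (x + x = y + y)%E -> x = y.
Proof. by case: x => [x||]; case: y => [y||] //= [] e; congr EFin; lra. Qed.

Section Fourier1.
Context {R : realType}.
Local Notation mu := (@lebesgue_measure R).

Lemma ge0_integral_opp (g : R -> \bar R) : measurable_fun setT g -> (forall x, 0 <= g x)%E ->
  (\int[mu]_x g (- x)%R = \int[mu]_x g x)%E.
Proof.
move=> mg g0.
rewrite -[LHS](@ge0_integral_pushforward _ _ (measurableTypeR R) (measurableTypeR R) R -%R _ mu setT g)//.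
by apply: eq_measure_integral => A mA _; exact: lebesgue_measureN.
Qed.

Lemma integrable_mul_le1 (a u : R -> R) : mu.-integrable setT (EFin \o a) ->
  measurable_fun setT u -> (forall x, `|u x| <= 1) -> mu.-integrable setT (fun x => (a x * u x)%:E).
Proof.
move=> ia mu1 u1; apply: (@le_integrable _ _ _ mu setT measurableT _ (EFin \o a)) => //.
  apply/measurable_EFinP; apply: measurable_funM => //; apply/measurable_EFinP; exact: measurable_int ia.
by move=> x _ /=; rewrite lee_fin normrM ler_piMr.
Qed.

Definition fourier1 (f : R -> R[i]) (w : R) : R[i] :=
  cint mu setT (fun x => f x * expi (- (2 * pi * (w * x)))).

Variable f : R -> R[i].
Hypothesis mf : cmeas setT f.
Hypothesis lf : (cabs mu setT f < +oo)%E.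
Let a x := complex.Re (f x).
Let b x := complex.Im (f x).
Let ia : mu.-integrable setT (EFin \o a). Proof. by have [] := (cintbleP mu measurableT mf).2 lf. Qed.

Let ib : mu.-integrable setT (EFin \o b). Proof. by have [] := (cintbleP mu measurableT mf).2 lf. Qed.

Let icos (g : R -> R) w : mu.-integrable setT (EFin \o g) ->
  mu.-integrable setT (fun x => (g x * cos (2 * pi * (w * x)))%:E).
Proof.
move=> ig; apply: integrable_mul_le1 => //.
  by apply: measurable_cos; apply: measurable_funM => //; apply: measurable_funM.
by move=> x; rewrite ler_norml cos_geN1 cos_le1.
Qed.

Let isin (g : R -> R) w : mu.-integrable setT (EFin \o g) ->
  mu.-integrable setT (fun x => (g x * sin (2 * pi * (w * x)))%:E).
Proof.
move=> ig; apply: integrable_mul_le1 => //.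
  by apply: measurable_sin; apply: measurable_funM => //; apply: measurable_funM.
by move=> x; rewrite ler_norml sin_geN1 sin_le1.
Qed.

Lemma fourier1E w : fourier1 f w = (fcos a w + fsin b w) +i* (fcos b w - fsin a w).
Proof.
apply: complex_eqP; rewrite /fourier1 /cint /fcos /fsin /=.
  rewrite -RintegralD//; [|exact: icos|exact: isin].
  by apply: eq_Rintegral => x _; rewrite !complexRI /= cosN sinN -/(a x) -/(b x); ring.
rewrite -RintegralB//; [|exact: icos|exact: isin].
by apply: eq_Rintegral => x _; rewrite !complexRI /= cosN sinN -/(a x) -/(b x); ring.
Qed.

Lemma cmeas_fourier1 : cmeas setT (fourier1 f).
Proof.
split; under eq_fun do rewrite fourier1E /=.
  by apply: measurable_funD; [exact: measurable_fcos|exact: measurable_fsin].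
by apply: measurable_funB; [exact: measurable_fcos|exact: measurable_fsin].
Qed.

Let fcosN (g : R -> R) w : fcos g (- w) = fcos g w.
Proof. by apply: eq_Rintegral => x _; rewrite mulNr mulrN cosN. Qed.

Let fsinN (g : R -> R) w : mu.-integrable setT (EFin \o g) -> fsin g (- w) = - fsin g w.
Proof.
move=> ig; transitivity (-1 * fsin g w); last by rewrite mulN1r.
rewrite /fsin -RintegralZl//; last exact: isin.
by apply: eq_Rintegral => x _; rewrite mulNr mulrN sinN mulrN mulN1r.
Qed.

(* The cross terms are odd in w. *)
Lemma csq_fourier1 : csq mu setT (fourier1 f) = csq mu setT f.
Proof.
have m2 := cmeas_normc2 cmeas_fourier1.
have mg (g : R -> R) : mu.-integrable setT (EFin \o g) -> measurable_fun setT (fun w => (fcos g w ^+ 2 + fsin g w ^+ 2)%:E).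
  move=> ig; apply/measurable_EFinP; apply: measurable_funD; apply: measurable_funX.
    exact: measurable_fcos.
  exact: measurable_fsin.
have g0 (g : R -> R) w : (0 <= (fcos g w ^+ 2 + fsin g w ^+ 2)%:E)%E.
  by rewrite lee_fin addr_ge0 ?sqr_ge0.
pose Sq := (\int[mu]_w ((fcos a w ^+ 2 + fsin a w ^+ 2)%:E + (fcos b w ^+ 2 + fsin b w ^+ 2)%:E))%E.
have SqE : Sq = csq mu setT f.
  rewrite /Sq ge0_integralD//; [|exact: mg|exact: mg].
  rewrite plancherel_real// plancherel_real// -ge0_integralD//.
  - by apply: eq_integral => x _; rewrite normc2.
  - by move=> x _; rewrite lee_fin sqr_ge0.
  - by apply/measurable_EFinP/measurable_funX; case: mf.
  - by move=> x _; rewrite lee_fin sqr_ge0.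
  - by apply/measurable_EFinP/measurable_funX; case: mf.
(* The goal is doubled so that the values at w and -w are added pointwise; no infinite integral is
   ever subtracted. *)
apply: add_ereal_inj; rewrite -SqE.
have e : csq mu setT (fun w => fourier1 f (- w)) = csq mu setT (fourier1 f).
  pose g w := (normc (fourier1 f w) ^+ 2)%:E.
  have mg' : measurable_fun setT g by exact/measurable_EFinP.
  have g0' w : (0 <= g w)%E by rewrite lee_fin sqr_ge0.
  exact: (ge0_integral_opp mg' g0').
pose u w := (normc (fourier1 f w) ^+ 2)%:E.
pose u' w := (normc (fourier1 f (- w)) ^+ 2)%:E.
pose v w := ((fcos a w ^+ 2 + fsin a w ^+ 2)%:E + (fcos b w ^+ 2 + fsin b w ^+ 2)%:E)%E.
have mu1 : measurable_fun setT u by exact/measurable_EFinP.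
have mu2 : measurable_fun setT u'.
  apply/measurable_EFinP.
  have mo : measurable_fun setT (fun x : R => - x) by exact: measurable_funN.
  exact: (measurableT_comp m2 mo).
have mv : measurable_fun setT v by apply: emeasurable_funD; exact: mg.
have u0 w : (0 <= u w)%E by rewrite lee_fin sqr_ge0.
have u'0 w : (0 <= u' w)%E by rewrite lee_fin sqr_ge0.
have v0 w : (0 <= v w)%E by exact: adde_ge0.
have e1 := ge0_integralD mu measurableT (fun x _ => u'0 x) mu2 (fun x _ => u0 x) mu1.
have e2 := ge0_integralD mu measurableT (fun x _ => v0 x) mv (fun x _ => v0 x) mv.
rewrite -{1}e; transitivity (\int[mu]_w (u' w + u w))%E; first exact/esym.
transitivity (\int[mu]_w (v w + v w))%E; last exact: e2.
apply: eq_integral => w _.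
rewrite /u' /u /v !normc2 !fourier1E /=.
rewrite (fcosN a w) (fcosN b w) (fsinN w ia) (fsinN w ib) -!EFinD; congr EFin.
move: (fcos a w) (fcos b w) (fsin a w) (fsin b w) => p q r s; ring.
Qed.

End Fourier1.

Section BorelRd.
Context {R : realType}.
Local Notation mu := (@lebesgue_measure R).
Local Notation lb d := (@lebesgue_borel R d).

Lemma measurable_dot d0 (T : measurableType d0) d (f g : T -> borelRd d) :
  measurable_fun setT f -> measurable_fun setT g ->
  measurable_fun setT (fun x => dot (f x) (g x : 'rV[R]_d)).
Proof.
move=> mf mg; apply: measurable_sum => i; apply: measurable_funM.
  exact: (measurableT_comp (measurable_coord i) mf).
exact: (measurableT_comp (measurable_coord i) mg).
Qed.

Lemma dot_consRd d (p q : R * 'rV[R]_d) :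
  dot (consRd p : 'rV[R]_d.+1) (consRd q : 'rV[R]_d.+1) = p.1 * q.1 + dot p.2 q.2.
Proof.
rewrite /dot big_ord_recl !mxE !unlift_none /=; congr (_ + _).
by apply: eq_bigr => i _; rewrite !mxE liftK.
Qed.

Lemma ge0_integral_consRd d (g : borelRd d.+1 -> \bar R) : measurable_fun setT g ->
  (forall x, 0 <= g x)%E ->
  (\int[lb d.+1]_x g x = \int[mu]_x \int[lb d]_y g (consRd (x, y)))%E.
Proof.
move=> mg g0.
transitivity (\int[(mu \x lb d)%E]_p g (consRd p))%E.
  rewrite -[RHS]/(\int[_]_(p in @consRd R d @^-1` setT) (g \o @consRd R d) p)%E.
  by rewrite -(ge0_integral_pushforward (@measurable_consRd R d)).
by rewrite fubini_tonelli1//; exact: (measurableT_comp mg (@measurable_consRd R d)).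
Qed.

(** The transform is taken against the Borel measure, which is an iterated product, so that
    induction on the dimension applies; [fourier_intE] links it to [fourier_int]. *)
Definition fourierB d (f : borelRd d -> R[i]) (w : borelRd d) : R[i] :=
  cint (lb d) setT (fun x => f x * expi (- (2 * pi * dot w x))).

Lemma cmeas_fourierB d f : cmeas setT f -> cmeas setT (@fourierB d f).
Proof.
move=> mf.
apply: (cmeas_cint_F (lb d) (F := fun p : borelRd d * borelRd d => f p.2 * expi (- (2 * pi * dot p.1 p.2)))).
apply: cmeasM.
  by case: mf => rf jf; split; [exact: (measurableT_comp rf)|exact: (measurableT_comp jf)].
by apply: cmeas_expi; apply: measurable_funN; apply: measurable_funM => //; exact: measurable_dot.
Qed.

Lemma cmeas_comp d1 d2 (T1 : measurableType d1) (T2 : measurableType d2) (f : T2 -> R[i]) (g : T1 -> T2) :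
  cmeas setT f -> measurable_fun setT g -> cmeas setT (f \o g).
Proof. by move=> [rf jf] mg; split; [exact: (measurableT_comp rf mg)|exact: (measurableT_comp jf mg)]. Qed.

Lemma measurable_consRd2 d (x : R) : measurable_fun setT (fun y : borelRd d => consRd (x, y)).
Proof. exact: (measurable_fun_pair2 x (@measurable_consRd R d)). Qed.

Lemma cint_consRd d (g : @borelRd R d.+1 -> R[i]) : cmeas setT g ->
  cintble (mu \x lb d)%E setT (fun p => g (consRd p)) ->
  cint (lb d.+1) setT g = cint (mu \x lb d)%E setT (fun p => g (consRd p)).
Proof.
move=> [rg jg] [ir ij].
have push (u : @borelRd R d.+1 -> R) : measurable_fun setT u ->
    (mu \x lb d)%E.-integrable setT (fun p => (u (consRd p))%:E) ->
    \int[lb d.+1]_x u x = \int[(mu \x lb d)%E]_p u (consRd p).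
  move=> mu1 iu; rewrite /Rintegral; congr fine.
  apply: (integral_pushforward (@measurable_consRd R d) (mu := (mu \x lb d)%E) (D := setT) (f := EFin \o u)) => //.
  exact/measurable_EFinP.
by rewrite /cint (push _ rg ir) (push _ jg ij).
Qed.

Section Step.
Variables (d : nat) (f : @borelRd R d.+1 -> R[i]).
Hypothesis mf : cmeas setT f.
Hypothesis lf : (cabs (lb d.+1) setT f < +oo)%E.
Hypothesis ih : forall g : @borelRd R d -> R[i], cmeas setT g -> (cabs (lb d) setT g < +oo)%E ->
  csq (lb d) setT (fourierB g) = csq (lb d) setT g.
Let G (x1 : R) (w : @borelRd R d) : R[i] := fourierB (fun y : @borelRd R d => f (consRd (x1, y))) w.

Let mfc : cmeas setT (fun p : measurableTypeR R * @borelRd R d => f (consRd p)).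
Proof. exact: (cmeas_comp mf (@measurable_consRd R d)). Qed.

Let mG : cmeas setT (fun p : measurableTypeR R * @borelRd R d => G p.1 p.2).
Proof.
apply: (cmeas_cint_F (lb d) (F := fun q : (measurableTypeR R * @borelRd R d) * @borelRd R d =>
  f (consRd (q.1.1, q.2)) * expi (- (2 * pi * dot q.1.2 q.2)))).
apply: cmeasM.
  apply: (@cmeas_comp _ _ _ _ (fun p : measurableTypeR R * @borelRd R d => f (consRd p)) (fun q => (q.1.1, q.2))) => //.
  by apply: measurable_fun_pair => //; exact: (measurableT_comp (@measurable_fst _ _ (measurableTypeR R) (@borelRd R d))).
apply: cmeas_expi; apply: measurable_funN; apply: measurable_funM => //; apply: measurable_dot => //.
exact: (measurableT_comp (@measurable_snd _ _ (measurableTypeR R) (@borelRd R d))).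
Qed.

Let mfx x1 : cmeas setT (fun y : @borelRd R d => f (consRd (x1, y))).
Proof. exact: (cmeas_comp mf (measurable_consRd2 x1)). Qed.

Let mnf : measurable_fun setT (fun p : measurableTypeR R * @borelRd R d => (normc (f (consRd p)))%:E).
Proof. by apply/measurable_EFinP; exact: cmeas_normc. Qed.

Let lfE : (cabs (lb d.+1) setT f = \int[mu]_x1 cabs (lb d) setT (fun y : @borelRd R d => f (consRd (x1, y))))%E.
Proof.
rewrite /cabs ge0_integral_consRd//; first by apply/measurable_EFinP; exact: cmeas_normc.
by move=> x; rewrite lee_fin normc_ge0.
Qed.

(** |G x1 w| is at most twice the integral of |f| over the section at [x1], uniformly in [w]. So the
    one-dimensional Plancherel applies for every [w], without exceptions. *)
Let lG w : (cabs mu setT (G ^~ w) < +oo)%E.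
Proof.
apply: (@le_lt_trans _ _ (\int[mu]_x1 (2%:E * cabs (lb d) setT (fun y : @borelRd R d => f (consRd (x1, y)))))%E); last first.
  rewrite ge0_integralZl//; first by rewrite -lfE; exact: lte_mul_pinfty.
  - apply: (measurable_fun_fubini_tonelli_F (m2 := lb d) _ mnf).
    by move=> p; rewrite lee_fin normc_ge0.
  - by move=> x _; exact: cabs_ge0.
apply: ge0_le_integral => //.
- by move=> x _; rewrite lee_fin normc_ge0.
- apply/measurable_EFinP; apply: cmeas_normc.
  exact: (@cmeas_comp _ _ (measurableTypeR R) _ (fun p : measurableTypeR R * @borelRd R d => G p.1 p.2) (fun x => (x, w))).
- apply: emeasurable_funM => //; apply: (measurable_fun_fubini_tonelli_F (m2 := lb d) _ mnf).
  by move=> p; rewrite lee_fin normc_ge0.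
- move=> x _; apply: le_trans (normc_cint_le _ measurableT _) _.
    by apply: cmeasM => //; apply: cmeas_expi; apply: measurable_funN; apply: measurable_funM => //; exact: measurable_dot.
  rewrite /cabs lee_pmul2l//; apply: ge0_le_integral => //.
  + by move=> y _; rewrite lee_fin normc_ge0.
  + apply/measurable_EFinP; apply: cmeas_normc; apply: cmeasM => //.
    by apply: cmeas_expi; apply: measurable_funN; apply: measurable_funM => //; exact: measurable_dot.
  + by apply/measurable_EFinP; exact: cmeas_normc.
  + by move=> y _; rewrite lee_fin normcM normc_expi mulr1.
Qed.

Let lf_prod : (cabs (mu \x lb d)%E setT (fun p => f (consRd p)) < +oo)%E.
Proof.
rewrite /cabs fubini_tonelli1//; first by move: lf; rewrite lfE.
by move=> p; rewrite lee_fin normc_ge0.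
Qed.

Let lf_ae : {ae mu, forall x1, (cabs (lb d) setT (fun y : @borelRd R d => f (consRd (x1, y))) < +oo)%E}.
Proof.
  have ia : mu.-integrable setT (fun x1 => cabs (lb d) setT (fun y : @borelRd R d => f (consRd (x1, y)))).
    apply/integrableP; split.
      by apply: (measurable_fun_fubini_tonelli_F (m2 := lb d) _ mnf) => p; rewrite lee_fin normc_ge0.
    by under eq_integral do rewrite gee0_abs ?cabs_ge0//; rewrite -lfE.
  have := integrable_ae measurableT ia; apply: (@filterS _ _ (ae_filter_ringOfSetsType mu)) => x /(_ I).
  by rewrite ge0_fin_numE ?cabs_ge0.
Qed.

(** The exponential splits along the first coordinate. Its first factor leaves the inner integral
    only for integrable sections, which is enough under the integral over [x1]. *)
Let fourierB_cons w1 w : fourierB f (consRd (w1, w)) = fourier1 (G ^~ w) w1.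
Proof.
pose F (p : measurableTypeR R * @borelRd R d) := f (consRd p) * expi (- (2 * pi * (w1 * p.1 + dot w p.2))).
have mt : measurable_fun setT (fun p : measurableTypeR R * @borelRd R d => - (2 * pi * (w1 * p.1 + dot w p.2))).
  apply: measurable_funN; apply: measurable_funM => //; apply: measurable_funD; first exact: measurable_funM.
  exact: measurable_dot.
have iF : cintble (mu \x lb d)%E setT F by exact: cintble_expi.
have -> : fourierB f (consRd (w1, w)) = cint (mu \x lb d)%E setT F.
  have E : (fun p : measurableTypeR R * @borelRd R d => f (consRd p) * expi (- (2 * pi * dot (consRd (w1, w)) (consRd p : 'rV[R]_d.+1)))) = F.
    by apply/funext => p; rewrite /F dot_consRd.
  rewrite /fourierB (cint_consRd _ (g := fun x => f x * expi (- (2 * pi * dot (consRd (w1, w)) x)))) ?E//.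
  apply: cmeasM => //; apply: cmeas_expi; apply: measurable_funN; apply: measurable_funM => //; exact: measurable_dot.
rewrite cint_prod// /fourier1.
apply: cint_ae => //.
- exact: (cmeas_cint_F (lb d) (cintble_cmeas iF)).
- apply: cmeasM.
    exact: (@cmeas_comp _ _ (measurableTypeR R) _ (fun p : measurableTypeR R * @borelRd R d => G p.1 p.2) (fun x => (x, w))).
  by apply: cmeas_expi; apply: measurable_funN; apply: measurable_funM => //; exact: measurable_funM.
apply: (@filterS _ _ (ae_filter_ringOfSetsType mu)) lf_ae => x lx _.
rewrite mulrC -cintZ//; last first.
  by apply: cintble_expi => //; apply: measurable_funN; apply: measurable_funM => //; exact: measurable_dot.
by apply: eq_cint => y _; rewrite /F /= mulrDr opprD expiD; ring.
Qed.

(** Between two uses of Tonelli, Plancherel on the line handles the first coordinate for fixed [w];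
    the induction hypothesis then handles the other coordinates for almost every [x1]. *)
Lemma csq_fourierB_step : csq (lb d.+1) setT (fourierB f) = csq (lb d.+1) setT f.
Proof.
have n0 (g : @borelRd R d.+1 -> R[i]) x : (0 <= (normc (g x) ^+ 2)%:E)%E by rewrite lee_fin sqr_ge0.
have mFf := cmeas_fourierB mf.
have mFc : cmeas setT (fun p : measurableTypeR R * @borelRd R d => fourierB f (consRd p)).
  exact: (cmeas_comp mFf (@measurable_consRd R d)).
have mnF : measurable_fun setT (fun p : measurableTypeR R * @borelRd R d => (normc (fourierB f (consRd p)) ^+ 2)%:E).
  by apply/measurable_EFinP; exact: (cmeas_normc2 mFc).
have mnG : measurable_fun setT (fun p : measurableTypeR R * @borelRd R d => (normc (G p.1 p.2) ^+ 2)%:E).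
  by apply/measurable_EFinP; exact: (cmeas_normc2 mG).
have mnfc : measurable_fun setT (fun p : measurableTypeR R * @borelRd R d => (normc (f (consRd p)) ^+ 2)%:E).
  by apply/measurable_EFinP; exact: (cmeas_normc2 mfc).
have p0 (g : measurableTypeR R * @borelRd R d -> R[i]) x : (0 <= (normc (g x) ^+ 2)%:E)%E by rewrite lee_fin sqr_ge0.
have mE (g : @borelRd R d.+1 -> R[i]) : cmeas setT g -> measurable_fun setT (fun x => (normc (g x) ^+ 2)%:E).
  by move=> mg; apply/measurable_EFinP; exact: cmeas_normc2.
rewrite /csq (ge0_integral_consRd (mE _ mFf) (n0 _)) (ge0_integral_consRd (mE _ mf) (n0 _)).
transitivity (\int[lb d]_w \int[mu]_w1 (normc (fourierB f (consRd (w1, w))) ^+ 2)%:E)%E.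
  exact: (fubini_tonelli (m1 := mu) (m2 := lb d) _ mnF (p0 _)).
transitivity (\int[lb d]_w csq mu setT (G ^~ w))%E.
  apply: eq_integral => w _; rewrite -csq_fourier1//; last first.
    exact: (@cmeas_comp _ _ (measurableTypeR R) _ (fun p : measurableTypeR R * @borelRd R d => G p.1 p.2) (fun x => (x, w))).
  by apply: eq_integral => w1 _; rewrite fourierB_cons.
transitivity (\int[mu]_x1 csq (lb d) setT (G x1))%E.
  exact/esym/(fubini_tonelli (m1 := mu) (m2 := lb d) _ mnG (p0 _)).
apply: ae_eq_integral => //.
- exact: (measurable_fun_fubini_tonelli_F (m2 := lb d) _ mnG (p0 _)).
- exact: (measurable_fun_fubini_tonelli_F (m2 := lb d) _ mnfc (p0 _)).
by apply: (@filterS _ _ (ae_filter_ringOfSetsType mu)) lf_ae => x hx _; exact: (ih (mfx x)).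
Qed.

End Step.

Lemma csq_fourierB d (f : @borelRd R d -> R[i]) : cmeas setT f -> (cabs (lb d) setT f < +oo)%E ->
  csq (lb d) setT (fourierB f) = csq (lb d) setT f.
Proof.
elim: d f => [f mf _|d ih f mf lf]; last exact: csq_fourierB_step.
(* In dimension 0 the space is one point carrying a Dirac mass, and the transform is the
   identity. *)
have h (x y : @borelRd R 0) : x = y by apply/rowP => -[].
apply: eq_integral => x _.
suff -> : fourierB f x = f x by [].
have D0 (u : @borelRd R 0 -> R) : measurable_fun setT u -> \int[lb 0]_x u x = u 0.
  by move=> mu1; rewrite /Rintegral /= integral_dirac ?diracT ?mul1e//; exact/measurable_EFinP.
rewrite /fourierB; set g := fun _ => _.
have [rg jg] : cmeas setT g.
  by apply: cmeasM => //; apply: cmeas_expi; apply: measurable_funN; apply: measurable_funM => //; exact: measurable_dot.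
rewrite /cint (D0 _ rg) (D0 _ jg) (h x 0) /g /dot big_ord0 mulr0 oppr0 expi0 mulr1.
by case: (f 0).
Qed.

Lemma ge0_integral_add1 (g : R -> \bar R) c : measurable_fun setT g -> (forall x, 0 <= g x)%E ->
  (\int[mu]_x g (x + c)%R = \int[mu]_x g x)%E.
Proof.
move=> mg g0.
have mc : measurable_fun setT (fun x : measurableTypeR R => (x + c : measurableTypeR R)).
  exact: measurable_funD.
rewrite -[LHS](@ge0_integral_pushforward _ _ (measurableTypeR R) (measurableTypeR R) R _ mc mu setT g)//.
apply: eq_measure_integral => A mA _; apply/esym/lebesgue_measure_unique => //= _ [[a b]] _ <-.
rewrite /pushforward (_ : _ @^-1` _ = `]a - c, b - c]%classic); last first.
  by apply/seteqP; split => x /=; rewrite !in_itv/= ltrBlDr lerBrDr.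
rewrite !lebesgue_measure_itv/= !lte_fin ltrD2r; case: ifP => // _.
by rewrite -!EFinB; congr EFin; ring.
Qed.

Lemma ge0_integral_addB d (g : @borelRd R d -> \bar R) (c : 'rV[R]_d) : measurable_fun setT g ->
  (forall x, 0 <= g x)%E -> (\int[lb d]_x g (x + c)%R = \int[lb d]_x g x)%E.
Proof.
elim: d g c => [g c mg g0|d ih g c mg g0].
  by apply: eq_integral => x _; congr g; apply/rowP => -[].
pose c2 : 'rV[R]_d := \row_i c 0 (lift ord0 i).
have E (x : R) (y : 'rV[R]_d) : consRd (x, y) + c = consRd (x + c 0 ord0, y + c2).
  apply/rowP => i; rewrite !mxE; case: (unliftP ord0 i) => [j|] -> /=; by rewrite ?liftK ?unlift_none /= ?mxE.
have mc : measurable_fun setT (fun x : @borelRd R d.+1 => (x + c : @borelRd R d.+1)).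
  apply: measurable_borelRd => i; rewrite (_ : (fun _ => _) = (fun x : @borelRd R d.+1 => x 0 i + c 0 i)).
    by apply: measurable_funD => //; exact: measurable_coord.
  by apply/funext => x; rewrite mxE.
have mgc : measurable_fun setT (fun p : measurableTypeR R * @borelRd R d => g (consRd p)).
  exact: (measurableT_comp mg (@measurable_consRd R d)).
transitivity (\int[mu]_x \int[lb d]_y g (consRd (x, y) + c)%R)%E.
  exact: (ge0_integral_consRd (measurableT_comp mg mc) (fun x => g0 _)).
transitivity (\int[mu]_x \int[lb d]_y g (consRd (x, y)))%E; last exact/esym/ge0_integral_consRd.
rewrite -[RHS](ge0_integral_add1 (c 0 ord0) (measurable_fun_fubini_tonelli_F (m2 := lb d) _ mgc (fun p => g0 _))); last first.
  by move=> x; apply: integral_ge0 => y _; exact: g0.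
apply: eq_integral => x _.
transitivity (\int[lb d]_y g (consRd ((x + c 0 ord0)%R, y + c2)%R))%E.
  by apply: eq_integral => y _; congr g; exact: E.
exact: (ih (fun y => g (consRd (x + c 0 ord0, y))) c2 (measurableT_comp mg (measurable_consRd2 _)) (fun y => g0 _)).
Qed.

Lemma lebesgue_borel_box (d : nat) (M : R) :
  measurable [set x : @borelRd R d | forall i, `|x 0 i| <= M] /\
  (lb d [set x : @borelRd R d | (forall i, `|x 0 i| <= M)%R] < +oo)%E.
Proof.
have mb d' : measurable [set x : @borelRd R d' | forall i, `|x 0 i| <= M].
  rewrite (_ : [set _ | _] = \bigcap_(i in [set: 'I_d']) ((fun x : @borelRd R d' => x 0 i : measurableTypeR R) @^-1` `[- M, M])); last first.
    apply/seteqP; split => [x h i _|x h i] /=; first by rewrite in_itv/= -ler_norml.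
    by have := h i I; rewrite /= in_itv/= -ler_norml.
  apply: fin_bigcap_measurable => // i _; rewrite -[X in measurable X]setTI; exact: measurable_coord.
split=> //; elim: d => [|d ih]; first by rewrite /= diracE; case: (_ \in _); rewrite ltry.
rewrite /= /cons_lebesgue /pushforward.
rewrite (_ : _ @^-1` _ = (`[- M, M] : set (measurableTypeR R)) `*` [set x : @borelRd R d | forall i, `|x 0 i| <= M]); last first.
  apply/seteqP; split => -[a y] /=.
    move=> h; split; first by have := h ord0; rewrite mxE unlift_none /= in_itv/= -ler_norml.
    by move=> i; have := h (lift ord0 i); rewrite mxE liftK.
  rewrite in_itv/= -ler_norml => -[h1 h2] i; rewrite mxE; by case: (unliftP ord0 i) => [j|] _ /=.
rewrite product_measure1E//; last exact: mb.
apply: lte_mul_pinfty => //; have := @lebesgue_measure_itv R `[- M, M]; by case: ifP => _ /= ->.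
Qed.

End BorelRd.

(** * From Borel to Lebesgue *)

Section Completion.
Context d (T : measurableType d) {R : realType} (mu : {sigma_finite_measure set T -> \bar R}).
Local Notation cT := (caratheodory_type (mu^*)%mu).
(** With [mu := lebesgue_borel d] this is convertible to [lebesgue R d]. *)
Definition completed_mu : set cT -> \bar R := @completed_measure_extension _ _ _ mu.
HB.instance Definition _ := Measure.on completed_mu.
Local Notation nu := completed_mu.

Lemma borel_cara (A : set T) : measurable A -> measurable (A : set cT).
Proof. by move=> mA; apply: sub_caratheodory; exact: sub_sigma_algebra. Qed.

Lemma completed_muE (A : set T) : measurable A -> nu A = mu A.
Proof. by move=> mA; rewrite /nu /completed_measure_extension measurable_mu_extE. Qed.

(** The identity, seen as a map from the completed space to the Borel space. It is measurable and
    pushes the completion forward to [mu], so integrals transfer by change of variables. *)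
Definition cara_id (x : cT) : T := x.

Lemma measurable_cara_id : measurable_fun setT cara_id.
Proof. by move=> _ Y mY; rewrite setTI; exact: borel_cara. Qed.

HB.instance Definition _ := isMeasurableFun.Build _ _ cT T cara_id measurable_cara_id.

Lemma measurable_fun_cara d' (Y : measurableType d') (g : T -> Y) :
  measurable_fun setT g -> measurable_fun setT (g : cT -> Y).
Proof. by move=> mg; exact: (measurableT_comp mg measurable_cara_id). Qed.

Lemma ge0_integral_cara (g : T -> \bar R) : measurable_fun setT g -> (forall x, 0 <= g x)%E ->
  (\int[nu]_x g x = \int[mu]_x g x)%E.
Proof.
move=> mg g0.
rewrite -[LHS](@ge0_integral_pushforward _ _ _ _ R _ measurable_cara_id nu setT g)//.
have E A : measurable A -> A `<=` setT -> pushforward nu cara_id A = mu A by move=> mA _; exact: completed_muE.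
exact: (eq_measure_integral mu E).
Qed.

Lemma Rintegral_cara (g : T -> R) : measurable_fun setT g -> \int[nu]_x g x = \int[mu]_x g x.
Proof.
move=> /measurable_EFinP mg; rewrite /Rintegral; congr fine; rewrite integralE [RHS]integralE.
by congr (_ - _)%E; apply: ge0_integral_cara => //; [exact: measurable_funepos|exact: measurable_funeneg].
Qed.

(** [nu] is the outer measure, so countable Borel covers come within 1/(n + 1) of it; the hull is
    their intersection. *)
Lemma borel_hull (A : set T) : (nu A < +oo)%E ->
  exists2 G : set T, measurable G & A `<=` G /\ mu G = nu A.
Proof.
move=> Aoo.
have cov n : exists2 G : set T, measurable G & A `<=` G /\ (mu G <= nu A + (n.+1%:R^-1)%:E)%E.
  have Afin : (mu^* A)%mu \is a fin_num by rewrite ge0_fin_numE//; exact: mu_ext_ge0.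
  have n0 : 0 < n.+1%:R^-1 :> R by rewrite invr_gt0.
  have [_ [F [mF AF] <-] hF] := lb_ereal_inf_adherent n0 Afin.
  exists (\bigcup_k F k); first exact: bigcupT_measurable.
  split=> //; apply: (@le_trans _ _ (\sum_(k <oo) mu (F k))%E); last exact: ltW.
  by apply: measure_sigma_subadditive => //; exact: bigcupT_measurable.
pose G n := sval (cid2 (cov n)).
have mG n : measurable (G n) by rewrite /G; case: cid2.
have AG n : A `<=` G n by rewrite /G; case: cid2 => ? ? [].
have GA n : (mu (G n) <= nu A + (n.+1%:R^-1)%:E)%E by rewrite /G; case: cid2 => ? ? [].
have mGG : measurable (\bigcap_n G n) by exact: bigcapT_measurable.
exists (\bigcap_n G n) => //; split; first by move=> x Ax n _; exact: AG.
apply/eqP; rewrite eq_le; apply/andP; split; last first.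
  by rewrite -(completed_muE mGG); apply: le_mu_ext => x Ax n _; exact: AG.
apply/lee_addgt0Pr => e e0.
have [n hn] := ltr_add_invr (y := 0) e0; rewrite add0r in hn.
apply: (@le_trans _ _ (mu (G n))).
  by apply: le_measure; rewrite ?inE// => x /(_ n I).
by apply: le_trans (GA n) _; rewrite leeD2l// lee_fin ltW.
Qed.

Lemma negligible_borel (N : set T) : nu.-negligible N ->
  exists2 G : set T, measurable G & N `<=` G /\ mu G = 0%E.
Proof.
move=> [B [mB B0 NB]].
have [|G mG [BG GB]] := @borel_hull B; first by rewrite B0.
by exists G => //; split; [exact: subset_trans BG|rewrite GB].
Qed.

Lemma borel_null_negligible (G N : set T) : measurable G -> mu G = 0%E -> N `<=` G -> nu.-negligible N.
Proof. by move=> mG G0 NG; exists G; split => //; [exact: borel_cara|rewrite completed_muE]. Qed.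

(** [A] is cut along sets of finite measure, because equality of measures makes hull minus piece
    null only when the measures are finite; the countably many differences are then collected. *)
Lemma borel_hull_ae (A : set cT) : measurable A ->
  exists2 G : set T, measurable G & A `<=` G /\ nu.-negligible (G `\` A).
Proof.
move=> mA.
have /sigma_finiteP[F [FT ndF mF]] := sigma_finiteT mu.
have mAF n : measurable (A `&` F n : set cT) by apply: measurableI => //; exact/borel_cara/(mF n).1.
have AFoo n : (nu (A `&` F n) < +oo)%E.
  apply: (@le_lt_trans _ _ (nu (F n))); first by apply: le_measure; rewrite ?inE//; exact/borel_cara/(mF n).1.
  by rewrite completed_muE; [exact: (mF n).2|exact: (mF n).1].
have hull n := borel_hull (AFoo n).
pose G n := sval (cid2 (hull n)).
have mG n : measurable (G n) by rewrite /G; case: cid2.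
have AG n : A `&` F n `<=` G n by rewrite /G; case: cid2 => ? ? [].
have GA n : mu (G n) = nu (A `&` F n) by rewrite /G; case: cid2 => ? ? [].
exists (\bigcup_n G n); first exact: bigcupT_measurable.
split.
  by move=> x Ax; have [n _ Fx] : (\bigcup_n F n) x by [rewrite -FT]; exists n => //; apply: AG.
have sub : (\bigcup_n G n) `\` A `<=` \bigcup_n (G n `\` (A `&` F n)).
  by move=> x [[n _ Gx] nA]; exists n => //; split => // -[].
apply: (@negligibleS _ cT R nu _ _ sub); apply: negligible_bigcup => n.
exists (G n `\` (A `&` F n)); split => //.
  by apply: measurableD => //; exact: borel_cara.
have mGc : measurable (G n : set cT) by exact: borel_cara.
transitivity (nu (G n) - nu (G n `&` (A `&` F n)))%E.
  by apply: measureD => //; rewrite [X in (X < _)%E](completed_muE (mG n)) GA.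
have -> : G n `&` (A `&` F n) = A `&` F n by apply: setIidr; exact: AG.
by rewrite (completed_muE (mG n)) GA subee// ge0_fin_numE//; exact: measure_ge0.
Qed.

(** Testing countably many rays lets [borel_ae_eq] gather all exceptional sets into one null set. *)
Lemma measurable_rational_rays d' (Y : measurableType d') (g : Y -> R) :
  (forall q : rat, measurable [set x | g x < ratr q]) -> measurable_fun setT g.
Proof.
move=> mg; apply: (measurability _ (RGenInftyO.measurableE R)) => _ [_ [x ->] <-]; rewrite setTI.
rewrite (_ : _ @^-1` _ = \bigcup_(q in [set: rat]) (if ratr q < x then [set y | g y < ratr q] else set0)).
  by apply: bigcupT_measurable_rat => q; case: ifP.
apply/seteqP; split => y /=.
  by rewrite in_itv/= => /rat_in_itvoo[q]; rewrite in_itv/= => /andP[gq qx]; exists q => //; rewrite qx.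
by move=> [q _]; case: ifP => // qx gq; rewrite in_itv/=; exact: lt_trans gq qx.
Qed.

(** Each rational sublevel set differs from its Borel hull by a null set. With [f] reset to 0 on one
    Borel null set [N] containing all the differences, a sublevel set is its hull minus [N],
    together with [N] when 0 lies below the level. *)
Lemma borel_ae_eq (f : cT -> R) : measurable_fun setT f ->
  exists g : T -> R, measurable_fun setT g /\ exists2 N : set T, measurable N /\ mu N = 0%E &
    forall x, ~ N x -> f x = g x.
Proof.
move=> mf.
have mA (q : rat) : measurable ([set x | f x < ratr q] : set cT).
  rewrite -[X in measurable X]setTI; rewrite (_ : [set _ | _] = f @^-1` `]-oo, ratr q[%classic).
    by apply: mf => //; exact: measurable_itv.
  by apply/seteqP; split => x /=; rewrite in_itv.
have hull q := borel_hull_ae (mA q).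
pose G q := sval (cid2 (hull q)).
have mG q : measurable (G q) by rewrite /G; case: cid2.
have AG q : [set x | f x < ratr q] `<=` G q by rewrite /G; case: cid2 => ? ? [].
have GA q : nu.-negligible (G q `\` [set x | f x < ratr q]) by rewrite /G; case: cid2 => ? ? [].
have : nu.-negligible (\bigcup_(q in [set: rat]) (G q `\` [set x | f x < ratr q])).
  pose S n := if unpickle n is Some q then G q `\` [set x | f x < ratr q] else set0.
  apply: (@negligibleS _ cT R nu (\bigcup_n S n)).
    move=> x [q _ h]; exists (pickle q); [exact: I|rewrite /S pickleK; exact: h].
  by apply: negligible_bigcup => n; rewrite /S; case: unpickle => [q|]; [exact: GA|exact: negligible_set0].
move=> /negligible_borel[N mN [GN N0]].
exists (fun x => if x \in N then 0 else f x); split; last first.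
  by exists N => // x Nx; rewrite ifF//; apply/negbTE/negP; rewrite inE.
apply: measurable_rational_rays => q.
rewrite (_ : [set _ | _] = (G q `\` N) `|` (if 0 < ratr q :> R then N else set0)); last first.
  apply/seteqP; split => x /=.
    case: (boolP (x \in N)); rewrite ?inE ?notin_setE => Nx; first by move=> ->; right.
    by move=> h; left; split => //; exact: AG.
  move=> [[Gx Nx]|]; last by case: ifP => // q0 Nx; rewrite ifT ?inE.
  rewrite ifF; last by apply/negbTE/negP; rewrite inE.
  by apply: contrapT => h; apply: Nx; apply: GN; exists q.
by apply: measurableU; [exact: measurableD|case: ifP].
Qed.

Lemma measurable_ae_eq d' (Y : measurableType d') (f g : cT -> Y) : measurable_fun setT g ->
  nu.-negligible [set x | f x <> g x] -> measurable_fun setT f.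
Proof.
move=> mg [N [mN N0 fgN]] _ B mB; rewrite setTI.
rewrite (_ : f @^-1` B = (g @^-1` B `\` N) `|` (f @^-1` B `&` N)); last first.
  apply/seteqP; split => x /=.
    move=> fx; have [Nx|Nx] := pselect (N x); [by right|left; split => //].
    by have -> // : g x = f x; apply: contrapT => h; apply: Nx; apply: fgN => /esym.
  move=> [[gx Nx]|[]//].
  by have -> // : f x = g x; apply: contrapT => h; apply: Nx; exact: fgN.
apply: measurableU; first by apply: measurableD => //; rewrite -[X in measurable X]setTI; exact: mg.
apply: measure_is_complete_caratheodory; exists N; split => //.

Qed.

End Completion.

Section AeEqual.
Context {d} {T : measurableType d} {R : realType} (mu : {measure set T -> \bar R}).
Implicit Types f g : T -> R[i].

Let aeD f g : {ae mu, forall x, f x = g x} -> {ae mu, forall x, [set: T] x -> f x = g x}.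
Proof. by apply: (@filterS _ _ (ae_filter_ringOfSetsType mu)) => x ->. Qed.

Lemma cint_aeT f g : cmeas setT f -> cmeas setT g -> {ae mu, forall x, f x = g x} ->
  cint mu setT f = cint mu setT g.
Proof. by move=> mf mg /aeD; exact: cint_ae. Qed.

Lemma csq_aeT f g : cmeas setT f -> cmeas setT g -> {ae mu, forall x, f x = g x} ->
  csq mu setT f = csq mu setT g.
Proof. by move=> mf mg /aeD; exact: csq_ae. Qed.

Lemma cabs_aeT f g : cmeas setT f -> cmeas setT g -> {ae mu, forall x, f x = g x} ->
  cabs mu setT f = cabs mu setT g.
Proof. by move=> mf mg /aeD; exact: cabs_ae. Qed.

Lemma eq_integral_aeT (f g : T -> R) : measurable_fun setT f -> measurable_fun setT g ->
  {ae mu, forall x, f x = g x} -> (\int[mu]_x (f x)%:E = \int[mu]_x (g x)%:E)%E.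
Proof.
move=> mf mg fg; apply: ae_eq_integral => //; [exact/measurable_EFinP|exact/measurable_EFinP|].
by apply: (@filterS _ _ (ae_filter_ringOfSetsType mu)) fg => x ->.
Qed.

End AeEqual.

Section LebesgueTransfer.
Context {R : realType} {d : nat}.
Local Notation mu := (lebesgue R d).
Local Notation lb := (@lebesgue_borel R d).
Local Notation bRd := (@borelRd R d).

Lemma ge0_integral_lebesgue (g : bRd -> \bar R) : measurable_fun setT g -> (forall x, 0 <= g x)%E ->
  (\int[mu]_x g x = \int[lb]_x g x)%E.
Proof. exact: ge0_integral_cara. Qed.

Lemma lebesgue_null_borel (N : set bRd) : measurable N -> lb N = 0%E -> mu.-negligible (N : set (Rd R d)).
Proof. by move=> mN N0; exact: (borel_null_negligible mN N0). Qed.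

Lemma cmeas_lebesgue (g : bRd -> R[i]) : cmeas setT g -> cmeas (T := Rd R d) setT g.
Proof. by move=> [rg jg]; split; exact: measurable_fun_cara. Qed.

Lemma cint_lebesgue (g : bRd -> R[i]) : cmeas setT g -> cint mu setT g = cint lb setT g.
Proof. by move=> [rg jg]; rewrite /cint; congr Complex; exact: Rintegral_cara. Qed.

Lemma csq_lebesgue (g : bRd -> R[i]) : cmeas setT g -> csq mu setT g = csq lb setT g.
Proof.
move=> mg; apply: ge0_integral_cara; first by apply/measurable_EFinP; exact: cmeas_normc2.
by move=> x; rewrite lee_fin sqr_ge0.
Qed.

Lemma cabs_lebesgue (g : bRd -> R[i]) : cmeas setT g -> cabs mu setT g = cabs lb setT g.
Proof.
move=> mg; apply: ge0_integral_cara; first by apply/measurable_EFinP; exact: cmeas_normc.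
by move=> x; rewrite lee_fin normc_ge0.
Qed.

Lemma cborel_version (f : Rd R d -> R[i]) : cmeas setT f ->
  exists g : bRd -> R[i], cmeas setT g /\ exists2 N : set bRd, measurable N /\ lb N = 0%E &
    forall x, ~ N x -> f x = g x.
Proof.
move=> [rf jf].
have [a [ma [N [mN N0] fa]]] := borel_ae_eq rf.
have [b [mb [M [mM M0] fb]]] := borel_ae_eq jf.
exists (fun x => a x +i* b x); split; first by split.
exists (N `|` M).
  split; first exact: measurableU.
  exact: (null_set_setU mN mM N0 M0).
by move=> x NMx; apply: complex_eqP => /=; [apply: fa|apply: fb] => h; apply: NMx; [left|right].
Qed.

Lemma lebesgue_ae (P : Rd R d -> Prop) (N : set bRd) : measurable N -> lb N = 0%E ->
  (forall x, ~ N x -> P x) -> {ae mu, forall x, P x}.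
Proof.
move=> mN N0 NP; apply: negligibleS (lebesgue_null_borel mN N0) => x /= nP.
by apply: contrapT => Nx; apply: nP; exact: NP.
Qed.

Lemma cmeas_lebesgue_ae (f g : Rd R d -> R[i]) : cmeas setT g -> {ae mu, forall x, f x = g x} -> cmeas setT f.
Proof.
move=> [rg jg] fg; split; [apply: measurable_ae_eq rg _|apply: measurable_ae_eq jg _].
  by apply: negligibleS fg => x /= h e; apply: h; rewrite e.
by apply: negligibleS fg => x /= h e; apply: h; rewrite e.
Qed.

Lemma cmeas_expo (w : 'rV[R]_d) : cmeas (T := bRd) setT (expo w).
Proof. by apply: cmeas_expi; apply: measurable_funN; apply: measurable_funM => //; exact: measurable_dot. Qed.

(** Equality holds at every frequency, since a change of the integrand on a null set affects none of
    the integrals. *)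
Lemma fourier_intE (f : cfun R d) (g : bRd -> R[i]) (N : set bRd) : cmeas (T := Rd R d) setT f ->
  cmeas setT g -> measurable N -> lb N = 0%E -> (forall x, ~ N x -> f x = g x) ->
  fourier_int f = fourierB g.
Proof.
move=> mf mg mN N0 fg; apply/funext => w.
have mge : cmeas setT (fun x : bRd => g x * expo w x) by exact: cmeasM (cmeas_expo w).
rewrite /fourierB -(cint_lebesgue mge); apply: cint_aeT.
- exact: (cmeasM mf (cmeas_lebesgue (cmeas_expo w))).
- exact: cmeas_lebesgue mge.
- by apply: (lebesgue_ae mN N0) => x /fg ->.
Qed.

Lemma cborel_L1 (f : cfun R d) (g : bRd -> R[i]) (N : set bRd) : L1 f ->
  cmeas setT g -> measurable N -> lb N = 0%E -> (forall x, ~ N x -> f x = g x) ->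
  (cabs lb setT g < +oo)%E.
Proof.
move=> [mf lf] mg mN N0 fg; rewrite -(cabs_lebesgue mg).
by rewrite -(cabs_aeT mf (cmeas_lebesgue mg) (lebesgue_ae mN N0 fg)).
Qed.

Lemma plancherel_L1 (f : cfun R d) : L1 f ->
  cmeasurable setT (fourier_int f) /\ sqint setT (fourier_int f) = sqint setT f.
Proof.
move=> Lf; have [mf lf] := Lf.
have [g [mg [N [mN N0] fg]]] := cborel_version mf.
have lg := cborel_L1 Lf mg mN N0 fg.
rewrite (fourier_intE mf mg mN N0 fg); split; first exact/cmeas_lebesgue/cmeas_fourierB.
transitivity (csq lb setT (fourierB g)); first exact/csq_lebesgue/cmeas_fourierB.
rewrite (csq_fourierB mg lg) -(csq_lebesgue mg); apply/esym.
exact: (csq_aeT mf (cmeas_lebesgue mg) (lebesgue_ae mN N0 fg)).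
Qed.

(** Both sides are the double integral of f(x) g(y) exp(-2 pi i x.y). This multiplication formula
    stands in for Fourier inversion in [is_fourier_surj]. *)
Lemma cint_fourierB_mul (f g : bRd -> R[i]) : cmeas setT f -> cmeas setT g ->
  (cabs lb setT f < +oo)%E -> (cabs lb setT g < +oo)%E ->
  cint lb setT (fun x => fourierB f x * g x) = cint lb setT (fun x => f x * fourierB g x).
Proof.
move=> mf mg lf lg.
pose F (p : bRd * bRd) := (f p.1 * g p.2) * expi (- (2 * pi * dot p.2 p.1)).
have mfst : cmeas setT (fun p : bRd * bRd => f p.1) := cmeas_comp mf (@measurable_fst _ _ bRd bRd).
have msnd : cmeas setT (fun p : bRd * bRd => g p.2) := cmeas_comp mg (@measurable_snd _ _ bRd bRd).
have mt : measurable_fun setT (fun p : bRd * bRd => - (2 * pi * dot p.2 p.1)).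
  by apply: measurable_funN; apply: measurable_funM => //; exact: measurable_dot.
have iF : cintble (lb \x lb)%E setT F.
  apply: cintble_expi => //; first exact: cmeasM.
  rewrite /cabs fubini_tonelli1//; last 2 first.
  - by apply/measurable_EFinP; apply: cmeas_normc; exact: cmeasM.
  - by move=> p; rewrite lee_fin normc_ge0.
  rewrite /fubini_F /= (_ : integral _ _ _ = (\int[lb]_x ((normc (f x))%:E * cabs lb setT g))%E).
    rewrite ge0_integralZr//.
    + by apply: lte_mul_pinfty => //; [exact: cabs_ge0|rewrite ge0_fin_numE//; exact: cabs_ge0].
    + by apply/measurable_EFinP; exact: cmeas_normc.
    + by move=> x _; rewrite lee_fin normc_ge0.
    + exact: cabs_ge0.
  apply: eq_integral => x _; rewrite /cabs -ge0_integralZl//.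
  - by apply: eq_integral => y _; rewrite normcM EFinM.
  - by apply/measurable_EFinP; exact: cmeas_normc.
  - by move=> y _; rewrite lee_fin normc_ge0.
  - by rewrite lee_fin normc_ge0.
have ie (h : bRd -> R[i]) (w : bRd) : cmeas setT h -> (cabs lb setT h < +oo)%E -> cintble lb setT (fun x => h x * expi (- (2 * pi * dot w x))).
  by move=> mh lh; apply: cintble_expi => //; apply: measurable_funN; apply: measurable_funM => //; exact: measurable_dot.
have dotC (x y : bRd) : dot x y = dot y x by apply: eq_bigr => i _; rewrite mulrC.
transitivity (cint lb setT (fun w => cint lb setT (fun x => F (x, w)))).
  apply: eq_cint => w _; rewrite mulrC -cintZ//; last exact: ie.
  by apply: eq_cint => x _; rewrite /F /=; ring.
rewrite -(cint_Fubini iF); apply: eq_cint => x _; rewrite -cintZ//; last exact: ie.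
by apply: eq_cint => y _; rewrite /F /= (dotC y x); ring.
Qed.

Lemma cintegral_fourier_mul (f g : cfun R d) : L1 f -> L1 g ->
  cintegral setT (fun x => fourier_int f x * g x) = cintegral setT (fun x => f x * fourier_int g x).
Proof.
move=> Lf Lg; have [mf _] := Lf; have [mg _] := Lg.
have [f' [mf' [N [mN N0] ff']]] := cborel_version mf.
have [g' [mg' [M [mM M0] gg']]] := cborel_version mg.
rewrite (fourier_intE mf mf' mN N0 ff') (fourier_intE mg mg' mM M0 gg').
have mF := cmeas_fourierB mf'; have mG := cmeas_fourierB mg'.
have mFl := cmeas_lebesgue mF; have mGl := cmeas_lebesgue mG.
have mFg := cmeasM mF mg'; have mfG := cmeasM mf' mG.
transitivity (cint lb setT (fun x => fourierB f' x * g' x)).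
  rewrite -(cint_lebesgue mFg).
  apply: (cint_aeT (cmeasM mFl mg) (cmeas_lebesgue mFg)).
  by apply: (lebesgue_ae mM M0) => x /gg' ->.
rewrite (cint_fourierB_mul mf' mg' (cborel_L1 Lf mf' mN N0 ff') (cborel_L1 Lg mg' mM M0 gg')).
rewrite -(cint_lebesgue mfG); apply/esym.
apply: (cint_aeT (cmeasM mf mGl) (cmeas_lebesgue mfG)).
by apply: (lebesgue_ae mN N0) => x /ff' ->.
Qed.

Lemma measurable_add_borelRd (l : 'rV[R]_d) : measurable_fun setT (fun x : bRd => (x + l : bRd)).
Proof.
apply: measurable_borelRd => i; rewrite (_ : (fun _ => _) = (fun x : bRd => x 0 i + l 0 i)).
  by apply: measurable_funD => //; exact: measurable_coord.
by apply/funext => x; rewrite mxE.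
Qed.

Lemma translate_borel_null (l : 'rV[R]_d) (N : set bRd) : measurable N -> lb N = 0%E ->
  measurable ((fun x : bRd => (x + l : bRd)) @^-1` N) /\ lb ((fun x : bRd => (x + l : bRd)) @^-1` N) = 0%E.
Proof.
move=> mN N0.
have mp : measurable ((fun x : bRd => (x + l : bRd)) @^-1` N).
  by rewrite -[X in measurable X]setTI; exact: measurable_add_borelRd.
split => //; rewrite -N0 -[in LHS](setIT (_ @^-1` _)) -[in RHS](setIT N) -!integral_indic//.
rewrite -(ge0_integral_addB l (g := fun x => (\1_N x)%:E)) => //.
exact/measurable_EFinP.
Qed.

(** The exceptional set is enlarged to a Borel null set, whose translates are null by invariance of
    the Borel measure. *)
Lemma translate_ae (l : 'rV[R]_d) (P : Rd R d -> Prop) : {ae mu, forall x, P x} ->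
  {ae mu, forall x, P (x - l)}.
Proof.
move=> /(@negligible_borel _ bRd R lb)[N mN [PN N0]].
have [mN' N'0] := translate_borel_null (- l) mN N0.
apply: (lebesgue_ae mN' N'0) => x Nx; apply: contrapT => nP; apply: Nx; exact: PN.
Qed.

Lemma cmeas_translate (l : 'rV[R]_d) (f : cfun R d) : cmeasurable setT f -> cmeasurable setT (translate l f).
Proof.
move=> mf; have [g [mg [N [mN N0] fg]]] := cborel_version mf.
apply: (@cmeas_lebesgue_ae _ (translate l g)).
  by apply: cmeas_lebesgue; exact: (cmeas_comp mg (measurable_add_borelRd (- l))).
exact: (@translate_ae l (fun x => f x = g x) (lebesgue_ae mN N0 fg)).
Qed.

Lemma ge0_integral_translate (l : 'rV[R]_d) (f : Rd R d -> R) : measurable_fun setT f -> (forall x, 0 <= f x) ->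
  (\int[mu]_x (f (x - l)%R)%:E = \int[mu]_x (f x)%:E)%E.
Proof.
move=> mf f0; have [g [mg [N [mN N0] fg]]] := borel_ae_eq mf.
have ae1 : {ae mu, forall x, f x = g x} by apply: (lebesgue_ae mN N0).
have mg1 : measurable_fun setT (fun x : bRd => `|g x|) by exact: measurableT_comp.
have mgl : measurable_fun setT (fun x : bRd => `|g (x - l)|) by exact: (measurableT_comp mg1 (measurable_add_borelRd (- l))).
(* [g] may be negative on the null set; [|g|] is a Borel version that is nonnegative everywhere. *)
have aeabs : {ae mu, forall x, f x = `|g x|}.
  by apply: (@filterS _ _ (ae_filter_ringOfSetsType mu)) ae1 => x <-; rewrite ger0_norm.
have aet := translate_ae l aeabs.
have mfl : measurable_fun setT (fun x : Rd R d => f (x - l)).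
  by apply: measurable_ae_eq (measurable_fun_cara mgl) _.
rewrite (eq_integral_aeT mfl (measurable_fun_cara mgl) aet).
rewrite (eq_integral_aeT mf (measurable_fun_cara mg1) aeabs).
transitivity (\int[lb]_x (`|g (x - l)|%R)%:E)%E.
  by apply: ge0_integral_lebesgue; [exact/measurable_EFinP|move=> x; rewrite lee_fin].
transitivity (\int[lb]_x (`|g x|%R)%:E)%E.
  by apply: (ge0_integral_addB (- l) (g := fun x => `|g x|%:E)); [exact/measurable_EFinP|move=> x; rewrite lee_fin].
by apply/esym/ge0_integral_lebesgue; [exact/measurable_EFinP|move=> x; rewrite lee_fin].
Qed.

Lemma Rintegral_addB (l : 'rV[R]_d) (g : bRd -> R) : measurable_fun setT g ->
  \int[lb]_x g (x + l) = \int[lb]_x g x.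
Proof.
move=> /measurable_EFinP mg; rewrite /Rintegral; congr fine; rewrite integralE [RHS]integralE.
congr (_ - _)%E.
  have <- := ge0_integral_addB l (measurable_funepos mg) (funepos_ge0 _).
  by apply: eq_integral => x _; rewrite !funeposE.
have <- := ge0_integral_addB l (measurable_funeneg mg) (funeneg_ge0 _).
by apply: eq_integral => x _; rewrite !funenegE.
Qed.

Lemma cintegral_translate (l : 'rV[R]_d) (f : cfun R d) : cmeasurable setT f ->
  cintegral setT (translate l f) = cintegral setT f.
Proof.
move=> mf; have [g [mg [N [mN N0] fg]]] := cborel_version mf.
have mgl : cmeas setT (fun x : bRd => g (x - l)) by exact: (cmeas_comp mg (measurable_add_borelRd (- l))).
transitivity (cint mu setT (fun x => g (x - l))).
  apply: (cint_aeT (cmeas_translate l mf) (cmeas_lebesgue mgl)).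
  exact: (@translate_ae l (fun x => f x = g x) (lebesgue_ae mN N0 fg)).
rewrite (cint_lebesgue mgl); transitivity (cint lb setT g).
  by case: mg => rg jg; congr Complex; [exact: (Rintegral_addB (- l) rg)|exact: (Rintegral_addB (- l) jg)].
by rewrite -(cint_lebesgue mg); exact/esym/(cint_aeT mf (cmeas_lebesgue mg) (lebesgue_ae mN N0 fg)).
Qed.

Lemma sqint_translate (l : 'rV[R]_d) (f : cfun R d) : cmeasurable setT f ->
  sqint setT (translate l f) = sqint setT f.
Proof.
move=> mf; apply: (ge0_integral_translate l (f := fun x => normc (f x) ^+ 2)); first exact: cmeas_normc2.
by move=> x; rewrite sqr_ge0.
Qed.

Lemma L1_translate (l : 'rV[R]_d) (f : cfun R d) : L1 f -> L1 (translate l f).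
Proof.
move=> [mf lf]; split; first exact: cmeas_translate.
by rewrite (ge0_integral_translate l (cmeas_normc mf) (fun x => normc_ge0 _)).
Qed.

Lemma lebesgue_bounded_lty (E : set (Rd R d)) : bounded_set (E : set 'rV[R]_d) -> measurable E ->
  (mu E < +oo)%E.
Proof.
(* [bounded_set] gives a bound by every real strictly above [M], hence M + 1. *)
move=> [M [Mr bE]] mE; have [mb lb_] := lebesgue_borel_box d (M + 1).
apply: (@le_lt_trans _ _ (mu [set x : Rd R d | forall i, `|x 0 i| <= M + 1])); last first.
  exact: (eq_ind_r (fun y => (y < +oo)%E) lb_ (completed_muE lb mb)).
apply: le_measure; rewrite ?inE//; first exact: (borel_cara lb mb).
move=> x Ex i; have := bE (M + 1); rewrite ltrDl ltr01 => /(_ isT x Ex) /=.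
by apply: le_trans; rewrite /Num.norm /= mx_normrE; apply: (le_bigmax _ (fun ij => `|x ij.1 ij.2|) (0, i)).
Qed.

End LebesgueTransfer.

(** * The Fourier transform on square integrable functions *)

Section SqrtNorm.
Context {R : realType} {V : lmodType R[i]} (ip : V -> V -> R[i]) (H : set V).
Hypothesis SI : semi_inner ip H.
Local Notation N := (normsq ip).

Lemma sqrt_normsqD f g : H f -> H g -> Num.sqrt (N (f + g)) <= Num.sqrt (N f) + Num.sqrt (N g).
Proof.
move=> Hf Hg; have f0 := normsq_ge0 SI Hf; have g0 := normsq_ge0 SI Hg.
rewrite -(ler_pXn2r (_ : 0 < 2)%N) ?nnegrE ?addr_ge0 ?sqrtr_ge0//.
rewrite sqr_sqrtr ?(normsq_ge0 SI (si_D SI Hf Hg))// sqrrD !sqr_sqrtr//.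
have := normsqDZ SI 1 Hf Hg; rewrite scale1r normc1 expr1n !mul1r => ->.
rewrite lerD2r lerD2l -sqrtrM// -[X in _ <= X]mulr_natl ler_pM2l//.
apply: le_trans (ler_norm _) _; apply: le_trans (Re_le_normc _) _.
rewrite -(ler_pXn2r (_ : 0 < 2)%N) ?nnegrE ?normc_ge0 ?sqrtr_ge0// sqr_sqrtr ?mulr_ge0//.
exact: (cauchy_schwarz SI).
Qed.

(** Continuity of the norm, in the form that carries an isometry from approximating sequences to
    their limits. *)
Lemma normsq_limit_eq (f g : V) (u v : nat -> V) : H f -> H g -> (forall n, H (u n)) -> (forall n, H (v n)) ->
  (forall n, N (u n) = N (v n)) ->
  (forall e, 0 < e -> exists M, forall n, (M <= n)%N -> N (u n - f) < e) ->
  (forall e, 0 < e -> exists M, forall n, (M <= n)%N -> N (v n - g) < e) -> N f = N g.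
Proof.
move=> Hf Hg Hu Hv uv uf vg.
have key a b : H a -> H b -> Num.sqrt (N a) <= Num.sqrt (N b) + Num.sqrt (N (b - a)).
  move=> Ha Hb; rewrite (normsqB_sym SI)//; have := sqrt_normsqD Hb (si_B SI Ha Hb).
  by rewrite addrC subrK.
have le e : 0 < e -> `|Num.sqrt (N f) - Num.sqrt (N g)| <= 2 * e.
  move=> e0; have e20 : 0 < e ^+ 2 by rewrite exprn_gt0.
  have [M1 h1] := uf _ e20; have [M2 h2] := vg _ e20; pose n := maxn M1 M2.
  have {}h1 := h1 n (leq_maxl _ _); have {}h2 := h2 n (leq_maxr _ _).
  have sq x : x < e ^+ 2 -> Num.sqrt x <= e.
    by move=> xe; rewrite -(ger0_norm (ltW e0)) -sqrtr_sqr ler_sqrt ?sqr_ge0// ltW.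
  have a1 := key _ _ Hf (Hu n); have a2 := key _ _ (Hu n) Hf.
  have b1 := key _ _ Hg (Hv n); have b2 := key _ _ (Hv n) Hg.
  rewrite (normsqB_sym SI) // in a2; rewrite (normsqB_sym SI) // in b2.
  have {}h1 := sq _ h1; have {}h2 := sq _ h2; rewrite uv in a1 a2.
  rewrite ler_norml; apply/andP; split; lra.
have : Num.sqrt (N f) = Num.sqrt (N g).
  apply/eqP; rewrite -subr_eq0 -normr_le0 leNgt; apply/negP => p.
  by have := le (`|Num.sqrt (N f) - Num.sqrt (N g)| / 4); rewrite divr_gt0// => /(_ isT); lra.
by move=> /(congr1 (fun x => x ^+ 2)); rewrite !sqr_sqrtr//; exact: (normsq_ge0 SI).
Qed.

End SqrtNorm.

Section Truncate.
Context {d} {T : measurableType d} {R : realType} (mu : {sigma_finite_measure set T -> \bar R}).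

(** Restrict [f] to an exhaustion by sets of finite measure. There |f| <= 1 + |f|^2 gives
    integrability, and |f|^2 dominates the error. *)
Lemma cL2_truncate (f : T -> R[i]) : cL2 mu setT f -> exists2 u : nat -> T -> R[i],
  [/\ forall n, cmeas setT (u n), forall n, (cabs mu setT (u n) < +oo)%E & forall n, (csq mu setT (u n) < +oo)%E] &
  csq mu setT (fun x => u n x - f x) @[n --> \oo] --> 0%E.
Proof.
move=> Lf; have [mf lf] := Lf.
have /sigma_finiteP[F [FT ndF mF]] := sigma_finiteT mu.
pose u n x := (\1_(F n) x)%:C * f x.
have m1 n : cmeas setT (fun x => (\1_(F n) x)%:C : R[i]).
  by apply: cmeas_ReC; apply: measurable_indic; exact: (mF n).1.
have cindic x n : (\1_(F n) x : R) = 0 \/ (\1_(F n) x : R) = 1.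
  by rewrite indicE; case: (_ \in _); [right|left].
have Lu n : cL2 mu setT (u n).
  apply: (cL2_bndM measurableT (m1 n) Lf ler01); apply: aeW => x _.
  by case: (cindic x n) => ->; rewrite ?normc0 ?normc1.
have mf2 := cmeas_normc2 mf.
have Luf n : cL2 mu setT (fun x => u n x - f x) := cL2B measurableT (Lu n) Lf.
have f20 x : (0 <= (normc (f x) ^+ 2)%:E)%E by rewrite lee_fin sqr_ge0.
exists u.
  split; [by move=> n; case: (Lu n)| |by move=> n; case: (Lu n)].
  move=> n; have [mun _] := Lu n.
  have mI : measurable_fun setT (fun x => (\1_(F n) x)%:E : \bar R).
    by apply/measurable_EFinP; apply: measurable_indic; exact: (mF n).1.
  apply: (@le_lt_trans _ _ (\int[mu]_x ((\1_(F n) x)%:E + (normc (f x) ^+ 2)%:E))%E).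
    apply: ge0_le_integral => //.
    - by move=> x _; rewrite lee_fin normc_ge0.
    - by apply/measurable_EFinP; exact: cmeas_normc.
    - by apply: emeasurable_funD => //; exact/measurable_EFinP.
    - move=> x _; rewrite -EFinD lee_fin /u normcM.
      case: (cindic x n) => ->; rewrite ?normc0 ?normc1 ?mul0r ?mul1r ?add0r ?sqr_ge0//.
      have := sqr_ge0 (normc (f x) - 1); have := normc_ge0 (f x); rewrite sqrrB1; lra.
  rewrite ge0_integralD//; last exact/measurable_EFinP.
  rewrite integral_indic ?setIT//; last exact: (mF n).1.
  by apply: lte_add_pinfty; [exact: (mF n).2|exact: lf].
have [|||||_ _] := @dominated_convergence _ T R mu setT measurableT
  (fun n x => (normc (u n x - f x) ^+ 2)%:E) (cst 0%E) (fun x => (normc (f x) ^+ 2)%:E).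
- by move=> n; apply/measurable_EFinP; apply: cmeas_normc2; case: (Luf n).
- exact: measurable_cst.
- apply: aeW => x _; have [n0 _ Fx] : (\bigcup_n F n) x by rewrite -FT.
  apply: cvg_near_cst; exists n0 => // n /= nn0.
  have Fnx : F n x by have /subsetPset h := ndF _ _ nn0; exact: h.
  by rewrite /u indicE mem_set// mul1r subrr normc0 expr0n.
- apply/integrableP; split; first exact/measurable_EFinP.
  by under eq_integral do rewrite gee0_abs ?f20//.
- apply: aeW => x n _; rewrite gee0_abs ?lee_fin ?sqr_ge0//.
  rewrite /u; case: (cindic x n) => ->; first by rewrite mul0r sub0r normcN.
  by rewrite mul1r subrr normc0 expr0n/= sqr_ge0.
by rewrite integral_cst// mul0e.
Qed.

End Truncate.

Section FourierL2.
Context {R : realType} {d : nat}.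
Local Notation mu := (lebesgue R d).
Local Notation L2T := (@L2 R d setT).
Implicit Types (f g h : cfun R d) (D : set (Rd R d)).

Lemma semi_inner_L2 D : measurable D -> semi_inner (ip D) (@L2 R d D).
Proof.
move=> mD; split.
- split; first exact: cmeas_cst.
  rewrite /sqint (_ : integral _ _ _ = 0%E) ?ltry//; apply: integral0_eq => x _.
  by rewrite normc0 expr0n.
- by move=> a f g Lf Lg; apply: (cL2D mD (cL2Z mD a Lf) Lg).
- by move=> a f g h Lf Lg Lh; exact: (cipDl mD a Lf Lg Lh).
- by move=> f g Lf Lg; exact: (cip_sym mD Lf Lg).
- by move=> f Lf; rewrite [ip _ _ _](cip_ff Lf) /= fine_ge0// csq_ge0.
Qed.

Let mT := @measurableT _ (Rd R d).
Let SI := semi_inner_L2 mT.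

Lemma sqintE D f : measurable D -> L2 D f -> sqint D f = (normsq (ip D) f)%:E.
Proof.
move=> mD Lf; rewrite /normsq [ip _ _ _](cip_ff Lf) /= fineK//.
by rewrite ge0_fin_numE; [case: Lf|exact: csq_ge0].
Qed.

Lemma cvg_sqintP D (u : nat -> cfun R d) : measurable D -> (forall n, L2 D (u n)) ->
  sqint D (u n) @[n --> \oo] --> 0%E <->
  (forall e : R, 0 < e -> exists M, forall n, (M <= n)%N -> normsq (ip D) (u n) < e).
Proof.
move=> mD Lu; have u0 n : (0 <= sqint D (u n))%E by exact: csq_ge0.
split=> h.
  move=> e e0; have [M hM] := cvge0_lt h u0 e0; exists M => n /hM.
  by rewrite (sqintE mD (Lu n)) lte_fin.
apply: cvge0_le => // e e0; have [M hM] := h e e0; exists M => n /hM /ltW.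
by rewrite (sqintE mD (Lu n)) lee_fin.
Qed.

Lemma L1_lin a f g : L1 f -> L1 g -> L1 (a *: f + g).
Proof.
move=> [mf lf] [mg lg].
have i1 := (cintbleP mu measurableT mf).2 lf; have i2 := (cintbleP mu measurableT mg).2 lg.
have i3 := cintbleD measurableT (cintbleZ measurableT a i1) i2.
have m3 := cintble_cmeas i3; split; first exact: m3.
exact: (cintbleP mu measurableT m3).1 i3.
Qed.

Lemma normc_expo (w x : 'rV[R]_d) : normc (expo w x) = 1. Proof. exact: normc_expi. Qed.

Lemma cintble_expo f (w : 'rV[R]_d) : L1 f -> cintble mu setT (fun x => f x * expo w x).
Proof.
move=> [mf lf]; have mfe := cmeasM mf (cmeas_lebesgue (cmeas_expo w)); apply/(cintbleP mu mT mfe).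
by rewrite /cabs; under eq_integral do rewrite normcM normc_expo mulr1.
Qed.

Lemma fourier_int_lin a f g : L1 f -> L1 g ->
  fourier_int (a *: f + g) = a *: fourier_int f + fourier_int g.
Proof.
move=> Lf Lg; apply/funext => w.
have i1 := cintble_expo w Lf; have i2 := cintble_expo w Lg.
transitivity (cint mu setT (fun x => a * (f x * expo w x) + g x * expo w x)).
  by apply: eq_cint => x _; rewrite mulrA -mulrDl.
by rewrite (cintD measurableT (cintbleZ measurableT a i1) i2) (cintZ measurableT a i1).
Qed.

Lemma L2_fourier_int f : L1 f -> L2T f -> L2T (fourier_int f).
Proof. by move=> L1f [_ lf]; have [mF eF] := plancherel_L1 L1f; split => //; rewrite eF. Qed.

Lemma normsq_fourier_int f : L1 f -> L2T f -> normsq (ip setT) (fourier_int f) = normsq (ip setT) f.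
Proof.
move=> L1f L2f; apply: EFin_inj.
by rewrite -(sqintE mT L2f) -(sqintE mT (L2_fourier_int L1f L2f)); exact: (plancherel_L1 L1f).2.
Qed.

Lemma is_fourier_lin a f g f' g' : L2T f -> L2T f' -> is_fourier f g -> is_fourier f' g' ->
  is_fourier (a *: f + f') (a *: g + g').
Proof.
move=> Lf Lf' [Lg [u [Lu uf ug]]] [Lg' [v [Lv vf vg]]].
split; first exact: (si_lin SI).
have Lu1 n := (Lu n).1; have Lu2 n := (Lu n).2; have Lv1 n := (Lv n).1; have Lv2 n := (Lv n).2.
have comb (p q : nat -> cfun R d) p0 q0 : (forall n, L2T (p n)) -> (forall n, L2T (q n)) -> L2T p0 -> L2T q0 ->
    sqint setT (p n - p0) @[n --> \oo] --> 0%E -> sqint setT (q n - q0) @[n --> \oo] --> 0%E ->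
    sqint setT (a *: p n + q n - (a *: p0 + q0)) @[n --> \oo] --> 0%E.
  move=> Lp Lq Lp0 Lq0 pp qq.
  have Lpp n : L2T (p n - p0) by exact: (si_B SI).
  have Lqq n : L2T (q n - q0) by exact: (si_B SI).
  (* Below, [c] is |a|^2 + 1 so that one may divide by it even when a = 0; the quarters of [e]
     offset the factor 2 of [normsqD_le]. *)
  have Lc n : L2T (a *: p n + q n - (a *: p0 + q0)) := si_B SI (si_lin SI a (Lp n) (Lq n)) (si_lin SI a Lp0 Lq0).
  apply/(cvg_sqintP mT Lc) => e e0; pose c := normc a ^+ 2 + 1.
  have c0 : 0 < c by rewrite ltr_wpDl// sqr_ge0.
  have e1 : 0 < e / (4 * c) by rewrite divr_gt0// mulr_gt0.
  have e2 : 0 < e / 4 by rewrite divr_gt0.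
  move/(cvg_sqintP mT Lpp) : pp => /(_ _ e1)[M1 h1].
  move/(cvg_sqintP mT Lqq) : qq => /(_ _ e2)[M2 h2].
  exists (maxn M1 M2) => n; rewrite geq_max => /andP[n1 n2].
  have -> : a *: p n + q n - (a *: p0 + q0) = a *: (p n - p0) + (q n - q0).
    by rewrite scalerBr opprD addrACA.
  apply: le_lt_trans (normsqD_le SI (si_Z SI a (Lpp n)) (Lqq n)) _.
  rewrite (normsqZ SI a (Lpp n)).
  have k2 := h2 n n2.
  have k1 : normsq (ip setT) (p n - p0) * (4 * c) < e by rewrite -ltr_pdivlMr ?mulr_gt0//; exact: h1.
  have k3 : normc a ^+ 2 * normsq (ip setT) (p n - p0) <= c * normsq (ip setT) (p n - p0).
    by rewrite ler_wpM2r ?(normsq_ge0 SI)// lerDl.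
  move: k1 k2 k3; move: (normsq _ (p n - p0)) (normsq _ (q n - q0)) (normc a ^+ 2) => P Q A; rewrite -/c; lra.
exists (fun n => a *: u n + v n); split.
- by move=> n; split; [exact: L1_lin|exact: (si_lin SI)].
- exact: (comb u v f f' Lu2 Lv2 Lf Lf' uf vf).
- apply: cvg_trans (comb _ _ g g' (fun n => L2_fourier_int (Lu1 n) (Lu2 n))
    (fun n => L2_fourier_int (Lv1 n) (Lv2 n)) Lg Lg' ug vg).
  apply: near_eq_cvg; apply: nearW => n /=.
  by rewrite (fourier_int_lin a (Lu1 n) (Lv1 n)).
Qed.

Lemma is_fourier_isometry f g : L2T f -> is_fourier f g -> normsq (ip setT) g = normsq (ip setT) f.
Proof.
move=> Lf [Lg [u [Lu uf ug]]].
have Lu1 n := (Lu n).1; have Lu2 n := (Lu n).2.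
have LF n := L2_fourier_int (Lu1 n) (Lu2 n).
apply: (normsq_limit_eq SI Lg Lf LF Lu2).
- by move=> n; exact: normsq_fourier_int.
- exact: (cvg_sqintP mT (fun n => si_B SI (LF n) Lg)).1 ug.
- exact: (cvg_sqintP mT (fun n => si_B SI (Lu2 n) Lf)).1 uf.
Qed.

Lemma is_fourier_ip f g f' g' : L2T f -> L2T f' -> is_fourier f g -> is_fourier f' g' ->
  ip setT f f' = ip setT g g'.
Proof.
move=> Lf Lf' fg fg'; have Lg := fg.1; have Lg' := fg'.1.
have iso a := is_fourier_isometry (si_lin SI a Lf Lf') (is_fourier_lin a Lf Lf' fg fg').
have e1 := is_fourier_isometry Lf fg; have e2 := is_fourier_isometry Lf' fg'.
apply: complex_eqP.
  have := Re_ip_polar SI Lf Lf'; have := Re_ip_polar SI Lg Lg'.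
  have := iso 1; rewrite !scale1r => ->; rewrite e1 e2; lra.
have := Im_ip_polar SI Lf Lf'; have := Im_ip_polar SI Lg Lg'; rewrite iso e1 e2; lra.
Qed.

Lemma normsq0_ae f : L2T f -> normsq (ip setT) f = 0 -> {ae mu, forall x, f x = 0}.
Proof.
move=> Lf f0; have := sqintE mT Lf; rewrite f0 => e.
have [mf _] := Lf; have := csq0_ae measurableT mf e.
by apply: (@filterS _ _ (ae_filter_ringOfSetsType mu)) => x; exact.
Qed.

(** By linearity g' - g is a transform of 0, so its norm is 0 by isometry. *)
Lemma is_fourier_unique f g g' : L2T f -> is_fourier f g -> is_fourier f g' -> {ae mu, forall x, g x = g' x}.
Proof.
move=> Lf fg fg'; have := is_fourier_lin (-1) Lf Lf fg fg'.
rewrite !scaleN1r addNr => h.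
have L0 := si_0 SI.
have := normsq0_ae h.1; rewrite (is_fourier_isometry L0 h).
rewrite {1}/normsq (ip0l SI L0) => /(_ erefl).
by apply: (@filterS _ _ (ae_filter_ringOfSetsType mu)) => x /eqP; rewrite /= addrC subr_eq0 => /eqP.
Qed.

Lemma L2_approx f : L2T f -> exists u : nat -> cfun R d,
  (forall n, (L1 `&` L2T) (u n)) /\ sqint setT (u n - f) @[n --> \oo] --> 0%E.
Proof.
move=> Lf; have [u [mu1 mu2 mu3] cu] := cL2_truncate (mu := mu) Lf.
exists u; split; last exact: cu.
by move=> n; exact: (conj (conj (mu1 n) (mu2 n)) (conj (mu1 n) (mu3 n))).
Qed.

(** Plancherel on differences makes the transforms of the approximants Cauchy, and completeness
    supplies the limit. *)
Lemma is_fourier_ex f : L2T f -> exists g, is_fourier f g.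
Proof.
move=> Lf; have [u [Lu uf]] := L2_approx Lf.
have Lu1 n := (Lu n).1; have Lu2 n := (Lu n).2.
have LF n := L2_fourier_int (Lu1 n) (Lu2 n).
have [||g Lg ug] := @riesz_fischer _ (Rd R d) R mu (fun n => fourier_int (u n)).
- exact: LF.
- move=> e e0; have e4 : 0 < e / 4 by rewrite divr_gt0.
  have Luf n : L2T (u n - f) by exact: (si_B SI).
  move/(cvg_sqintP mT Luf) : uf => /(_ _ e4)[M hM]; exists M => m n Mm Mn.
  have Lmn : L2T (u m - u n) by exact: (si_B SI).
  have -> : (fun x => fourier_int (u m) x - fourier_int (u n) x) = fourier_int (u m - u n).
    by rewrite addrC -scaleN1r (fourier_int_lin (-1) (Lu1 n) (Lu1 m)) scaleN1r addrC.
  have L1mn : L1 (u m - u n) by rewrite addrC -scaleN1r; exact: L1_lin.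
  rewrite [csq _ _ _](plancherel_L1 L1mn).2 (sqintE mT Lmn) lee_fin.
  have -> : u m - u n = (u m - f) + (f - u n) by rewrite addrA subrK.
  apply: le_trans (normsqD_le SI (Luf m) (si_B SI Lf (Lu2 n))) _.
  rewrite (normsqB_sym SI Lf (Lu2 n)); have := hM m Mm; have := hM n Mn; lra.
by exists g; split => //; exists u.
Qed.

Lemma fourierP f : L2T f -> is_fourier f (fourier f).
Proof. by move=> /is_fourier_ex; exact: xgetPex. Qed.

Lemma expoD (w x y : 'rV[R]_d) : expo w (x + y) = expo w x * expo w y.
Proof.
rewrite /expo -expiD; congr expi; rewrite (_ : dot w (x + y) = dot w x + dot w y); first by ring.
by rewrite /dot -big_split; apply: eq_bigr => i _; rewrite mxE mulrDr.
Qed.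

Lemma expoC (w x : 'rV[R]_d) : expo w x = expo x w.
Proof. by rewrite /expo; congr expi; congr (- (_ * _)); apply: eq_bigr => i _; rewrite mulrC. Qed.

Lemma fourier_int_translate l f : L1 f ->
  fourier_int (translate l f) = (fun w => expo l w * fourier_int f w).
Proof.
move=> Lf; apply/funext => w; have i1 := cintble_expo w Lf.
have m2 : cmeasurable setT (fun x => expo w l * (f x * expo w x)).
  exact: cintble_cmeas (cintbleZ measurableT (expo w l) i1).
transitivity (cint mu setT (fun x => expo w l * (f x * expo w x))); last first.
  by rewrite (cintZ measurableT _ i1) expoC.
rewrite -[RHS](cintegral_translate l m2); apply: eq_cint => x _.
rewrite /translate mulrCA; congr (_ * _); rewrite -expoD; congr (expo w _).
by rewrite addrC subrK.
Qed.

Lemma cmeasurable_expo l : cmeasurable setT (expo l : cfun R d).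
Proof. exact/cmeas_lebesgue/cmeas_expo. Qed.

Lemma L2_translate l f : L2T f -> L2T (translate l f).
Proof. by move=> [mf lf]; split; [exact: cmeas_translate|rewrite sqint_translate]. Qed.

Lemma L2_expoM l f : L2T f -> L2T (fun x => expo l x * f x).
Proof.
move=> Lf; apply: (cL2_bndM measurableT (cmeasurable_expo l) Lf ler01).
by apply: aeW => x _; rewrite normc_expo.
Qed.

Lemma is_fourier_translate l f g : L2T f -> is_fourier f g ->
  is_fourier (translate l f) (fun w => expo l w * g w).
Proof.
move=> Lf [Lg [u [Lu uf ug]]]; split; first exact: L2_expoM.
have Lu1 n := (Lu n).1; have Lu2 n := (Lu n).2.
exists (fun n => translate l (u n)); split.
- by move=> n; split; [exact: L1_translate|exact: L2_translate].
- apply: cvg_trans uf; apply: near_eq_cvg; apply: nearW => n.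
  have [mu_ _] := si_B SI (Lu2 n) Lf.
  by rewrite -(sqint_translate l mu_).
- apply: cvg_trans ug; apply: near_eq_cvg; apply: nearW => n.
  rewrite fourier_int_translate//; apply: eq_integral => x _; congr (_ ^+ 2)%:E.
  by rewrite /= -mulrBr normcM normc_expo mul1r.
Qed.

(** The preimage is the inverse transform, written as the conjugate of the transform of conj(g). For
    u in L^1 and L^2 the multiplication formula gives <u^, g> = <u, f>, and Plancherel matches the
    norms. Hence |u^ - g| = |u - f|, and any u_n -> f has transforms converging to g. *)
Lemma is_fourier_surj g : L1 g -> L2T g -> exists2 f, L2T f & is_fourier f g.
Proof.
move=> L1g L2g; pose gc : cfun R d := fun x => (g x)^*.
have L2gc : L2T gc by exact: (cL2_conj L2g).
have L1gc : L1 gc.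
  by case: L1g => mg lg; split; [exact: cmeas_conj|under eq_integral do rewrite normc_conj].
pose f : cfun R d := fun x => (fourier_int gc x)^*.
have LFc := L2_fourier_int L1gc L2gc.
have Lf : L2T f by exact: (cL2_conj LFc).
have conjN (k : cfun R d) : L2T k -> normsq (ip setT) (fun x => (k x)^*) = normsq (ip setT) k.
  move=> Lk; have Lkc : L2T (fun x => (k x)^*) := cL2_conj Lk.
  apply: EFin_inj; rewrite -(sqintE mT Lk) -(sqintE mT Lkc).
  by apply: eq_integral => x _; rewrite normc_conj.
have Nf : normsq (ip setT) f = normsq (ip setT) g.
  by rewrite (conjN _ LFc) (normsq_fourier_int L1gc L2gc) (conjN _ L2g).
exists f => //; split => //; have [u [Lu uf]] := L2_approx Lf; exists u; split => //.
have Lu1 n := (Lu n).1; have Lu2 n := (Lu n).2.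
have LF n := L2_fourier_int (Lu1 n) (Lu2 n).
apply: cvg_trans uf; apply: near_eq_cvg; apply: nearW => n.
rewrite (sqintE mT (si_B SI (Lu2 n) Lf)) (sqintE mT (si_B SI (LF n) L2g)); congr EFin.
have E : ip setT (fourier_int (u n)) g = ip setT (u n) f.
  transitivity (cintegral setT (fun x => u n x * fourier_int gc x)).
    exact: (cintegral_fourier_mul (Lu1 n) L1gc).
  by apply: eq_cint => x _; rewrite /f conjcK.
have B (a b : cfun R d) : L2T a -> L2T b -> normsq (ip setT) (a - b) =
    normsq (ip setT) a + normsq (ip setT) b - 2 * complex.Re (ip setT a b).
  move=> La Lb; rewrite addrC -scaleN1r (normsqDZ SI _ Lb La) (si_sym SI La Lb) normcN normc1 !complexRI /=; ring.
rewrite (B _ _ (Lu2 n) Lf) (B _ _ (LF n) L2g) E (normsq_fourier_int (Lu1 n) (Lu2 n)) Nf; reflexivity.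
Qed.

End FourierL2.

(** * Systems of translates *)

Section Restriction.
Context {d} {T : measurableType d} {R : realType} (mu : {measure set T -> \bar R}) (E : set T).
Hypothesis mE : measurable E.

Lemma cL2_subset (f : T -> R[i]) : cL2 mu setT f -> cL2 mu E f.
Proof.
move=> [[rf jf] lf]; have mE' : cmeas E f.
  by split; [exact: measurable_funS rf|exact: measurable_funS jf].
split => //; apply: le_lt_trans lf; apply: ge0_subset_integral => //.
  by apply/measurable_EFinP; apply: cmeas_normc2; split.
by move=> x _; rewrite lee_fin sqr_ge0.
Qed.

Lemma integral_off (u : T -> R) : measurable_fun setT u -> {ae mu, forall w, ~ E w -> u w = 0} ->
  (\int[mu]_(x in E) (u x)%:E = \int[mu]_x (u x)%:E)%E.
Proof.
move=> mu_ u0; rewrite integral_mkcond; apply: ae_eq_integral => //.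
- apply/(measurable_restrictT _ mE).1; apply: (measurable_funS measurableT) => //; exact/measurable_EFinP.
- exact/measurable_EFinP.
apply: (@filterS _ _ (ae_filter_ringOfSetsType mu)) u0 => w uw _; rewrite /patch; case: ifPn => //.
by rewrite notin_setE => /uw ->.
Qed.

End Restriction.

Section TranslateSystem.
Context {R : realType} {d : nat} {K : countType}.
Local Notation mu := (lebesgue R d).
Local Notation L2T := (@L2 R d setT).
Local Notation N := (normsq (@ip R d setT)).
Variables (E : set (Rd R d)) (lam : K -> 'rV[R]_d) (h : cfun R d).
Hypothesis E_bounded : bounded_set (E : set 'rV[R]_d).
Hypothesis mE : measurable E.
Hypothesis h_PE : PW E h.
Local Notation e k := (restr E (expo (lam k))).
Local Notation psi := (fun k => translate (lam k) h).
Hypothesis lam_frame : is_frame (ip E) (@L2 R d E) (fun k => e k).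

Let mT := @measurableT _ (Rd R d).
Let SI := @semi_inner_L2 R d setT mT.
Let SIE := @semi_inner_L2 R d E mE.
Let aeF := ae_filter_ringOfSetsType mu.
Let H : cfun R d := fourier h.
Let Lh : L2T h := h_PE.1.
Let fH : is_fourier h H := fourierP Lh.
Let LH : L2T H := fH.1.
Let mH : cmeas (T := Rd R d) setT H := LH.1.

Let H0 : {ae mu, forall w, ~ E w -> H w = 0}.
Proof.
by apply: (@filterS _ _ aeF) h_PE.2 => w hw nE; apply: contrapT => /eqP /hw.
Qed.

Let mulJ0 (a b : R[i]) : b = 0 -> a * conjc b = 0.
Proof. by move=> ->; rewrite conjc0 mulr0. Qed.

Lemma normsq_le_aeD D (k : R) (f g : cfun R d) : measurable D -> L2 D f -> L2 D g -> 0 <= k ->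
  {ae mu, forall x, D x -> normc (f x) <= k * normc (g x)} ->
  normsq (ip D) f <= k ^+ 2 * normsq (ip D) g.
Proof.
move=> mD Lf Lg k0 fg; rewrite -lee_fin EFinM -(sqintE mD Lf) -(sqintE mD Lg).
exact: (csq_le mD Lf.1 Lg.1 k0).
Qed.

Lemma normsq_le_ae (k : R) (f g : cfun R d) : L2T f -> L2T g -> 0 <= k ->
  {ae mu, forall x, normc (f x) <= k * normc (g x)} -> N f <= k ^+ 2 * N g.
Proof.
move=> Lf Lg k0 fg; apply: (normsq_le_aeD mT Lf Lg k0).
by apply: (@filterS _ _ aeF) fg => x fx _.
Qed.

Lemma L2_subset (f : cfun R d) : L2T f -> L2 E f.
Proof. exact: (cL2_subset mE). Qed.

Lemma normsq_off (f : cfun R d) : L2T f -> {ae mu, forall w, ~ E w -> f w = 0} -> normsq (ip E) f = N f.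
Proof.
move=> Lf f0; apply: EFin_inj; rewrite -(sqintE mT Lf) -(sqintE mE (L2_subset Lf)).
apply: (integral_off mE); first exact: (cmeas_normc2 Lf.1).
by apply: (@filterS _ _ aeF) f0 => w fw /fw ->; rewrite normc0 expr0n.
Qed.

Lemma cintegral_off (f : cfun R d) : cmeasurable setT f -> {ae mu, forall w, ~ E w -> f w = 0} ->
  cintegral E f = cintegral setT f.
Proof.
move=> [rf jf] f0; congr Complex; congr fine; [apply: (integral_off mE rf)|apply: (integral_off mE jf)].
  by apply: (@filterS _ _ aeF) f0 => w fw /fw; rewrite /re => ->.
by apply: (@filterS _ _ aeF) f0 => w fw /fw; rewrite /im => ->.
Qed.

Definition mulconj (F : cfun R d) : cfun R d := fun w => F w * conjc (H w).

Lemma is_fourier_psi k : is_fourier (psi k) (fun w => expo (lam k) w * H w).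
Proof. exact: is_fourier_translate. Qed.

Lemma L2_psi k : L2T (psi k). Proof. exact: L2_translate. Qed.

Lemma ip_psi f F k : L2T f -> is_fourier f F -> ip setT f (psi k) = ip E (mulconj F) (e k).
Proof.
move=> Lf fF; rewrite (is_fourier_ip Lf (L2_psi k) fF (is_fourier_psi k)).
have LF := fF.1.
pose u : cfun R d := fun w => F w * conjc (expo (lam k) w * H w).
have mu_ : cmeasurable setT u.
  exact: (cmeasM LF.1 (cmeas_conj (cmeasM (cmeasurable_expo (lam k)) mH))).
rewrite -[LHS](@cintegral_off u mu_); last first.
  by apply: (@filterS _ _ aeF) H0 => w Hw /Hw e0; apply: mulJ0; rewrite e0 mulr0.
apply: eq_cint => w Ew; rewrite /u /mulconj /restr indicE mem_set// mulr1 conjcM; ring.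
Qed.

Lemma coefsum_psi f F : L2T f -> is_fourier f F ->
  coefsum (ip setT) psi f = coefsum (ip E) (fun k => e k) (mulconj F).
Proof. by move=> Lf fF; apply: eq_esum => k _; rewrite (ip_psi k Lf fF). Qed.

Lemma mulconj_off F : {ae mu, forall w, ~ E w -> mulconj F w = 0}.
Proof. by apply: (@filterS _ _ aeF) H0 => w Hw /Hw e0; apply: mulJ0. Qed.

(** Square integrability of [mulconj F] is a hypothesis because boundedness of [H] is what the
    converse directions have yet to prove; it holds at once for indicators [F]. *)
Lemma coefsum_bounds : exists A0 B0 : R, [/\ 0 < A0, 0 < B0 &
  forall f F, L2T f -> is_fourier f F -> L2T (mulconj F) ->
    ((A0 * N (mulconj F))%:E <= coefsum (ip setT) psi f <= (B0 * N (mulconj F))%:E)%E].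
Proof.
have [_ [A0 [B0 [A00 B00 fr]]]] := lam_frame; exists A0, B0; split => // f F Lf fF Lq.
rewrite (coefsum_psi Lf fF) -(normsq_off Lq (mulconj_off F)).
exact: (fr _ (L2_subset Lq)).
Qed.

Lemma L2_mulconj (B : R) F : L2T F -> 0 <= B -> {ae mu, forall w, normc (H w) <= B} -> L2T (mulconj F).
Proof.
move=> LF B0 HB; rewrite /mulconj (_ : (fun w => _) = (fun w => conjc (H w) * F w)); last first.
  by apply/funext => w; rewrite mulrC.
apply: (cL2_bndM mT (cmeas_conj mH) LF B0).
by apply: (@filterS _ _ aeF) HB => w Hw _; rewrite normc_conj.
Qed.

Lemma bounded_bessel (B : R) : 0 < B -> {ae mu, forall w, normc (H w) <= B} ->
  exists2 C : R, 0 < C & forall f, L2T f -> (coefsum (ip setT) psi f <= (C * N f)%:E)%E.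
Proof.
move=> B0 HB; have [A0 [B1 [_ B10 fr]]] := coefsum_bounds.
exists (B1 * B ^+ 2); first by rewrite mulr_gt0// exprn_gt0.
move=> f Lf; have fF := fourierP Lf; have LF := fF.1.
have Lq := L2_mulconj LF (ltW B0) HB.
have /andP[_ h1] := fr f _ Lf fF Lq; apply: le_trans h1 _; rewrite lee_fin -mulrA ler_pM2l//.
rewrite -(is_fourier_isometry Lf fF); apply: (normsq_le_ae Lq LF (ltW B0)).
apply: (@filterS _ _ aeF) HB => w Hw; rewrite /mulconj normcM normc_conj mulrC.
by rewrite ler_wpM2r ?normc_ge0.
Qed.

(** The lower bound on |H| is asked only where the transform of [f] is nonzero, so the lemma covers
    both [PW E] (inside [E]) and the closed span (inside the support of [H]). *)
Lemma bounded_below (A B : R) : 0 < A -> 0 < B -> {ae mu, forall w, normc (H w) <= B} ->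
  exists2 C : R, 0 < C & forall f, L2T f -> {ae mu, forall w, fourier f w != 0 -> A <= normc (H w)} ->
    ((C * N f)%:E <= coefsum (ip setT) psi f)%E.
Proof.
move=> A0 B0 HB; have [A1 [B1 [A10 _ fr]]] := coefsum_bounds.
exists (A1 * A ^+ 2); first by rewrite mulr_gt0// exprn_gt0.
move=> f Lf FA; have fF := fourierP Lf; have LF := fF.1.
have Lq := L2_mulconj LF (ltW B0) HB.
have /andP[h1 _] := fr f _ Lf fF Lq; apply: le_trans h1; rewrite lee_fin -mulrA ler_pM2l//.
rewrite -(is_fourier_isometry Lf fF).
have Ai0 : 0 <= A^-1 by rewrite invr_ge0 ltW.
suff hh : N (fourier f) <= A^-1 ^+ 2 * N (mulconj (fourier f)).
  by rewrite exprVn in hh; rewrite -ler_pdivlMl// ?exprn_gt0.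
apply: (normsq_le_ae LF Lq Ai0); apply: (@filterS _ _ aeF) FA => w Fw.
rewrite /mulconj normcM normc_conj mulrC.
have [->|Fn] := eqVneq (fourier f w) 0; first by rewrite normc0 !mul0r.
by rewrite -mulrA ler_peMr ?normc_ge0// ler_pdivlMr// mul1r Fw.
Qed.

(* Test functions: 1_S is a Fourier transform for every measurable S inside E. *)
Definition cindic (S : set (Rd R d)) : cfun R d := fun w => (\1_S w)%:C.

Lemma normc_cindic S w : normc (cindic S w) = \1_S w.
Proof. by rewrite /cindic indicE; case: (_ \in _); rewrite ?normc1 ?normc0. Qed.

Lemma cindic_L12 S : measurable S -> S `<=` E -> [/\ L1 (cindic S), L2T (cindic S) & (N (cindic S))%:E = mu S].
Proof.
move=> mS SE.
have Sfin : (mu S < +oo)%E.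
  by apply: le_lt_trans (lebesgue_bounded_lty E_bounded mE); apply: le_measure; rewrite ?inE.
have mi : cmeas (T := Rd R d) setT (cindic S) by apply: cmeas_ReC; exact: measurable_indic.
have i1 : (\int[mu]_x (normc (cindic S x))%:E = mu S)%E.
  under eq_integral do rewrite normc_cindic.
  by rewrite integral_indic ?setIT.
have i2 : (\int[mu]_x (normc (cindic S x) ^+ 2)%:E = mu S)%E.
  rewrite -i1; apply: eq_integral => x _; rewrite normc_cindic indicE.
  by case: (_ \in _); rewrite ?expr1n ?expr0n.
have L2S : L2T (cindic S) by split; [exact: mi|rewrite /sqint i2].
split; first by split; [exact: mi|rewrite i1].
  exact: L2S.
by rewrite -(sqintE mT L2S).
Qed.

Lemma L2_mulconj_cindic S : measurable S -> L2T (mulconj (cindic S)).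
Proof.
move=> mS; apply: (cL2_bndM mT (k := 1) _ (cL2_conj LH) ler01).
  by apply: cmeas_ReC; exact: measurable_indic.
by apply: aeW => w _; rewrite normc_cindic indicE; case: (_ \in _).
Qed.

Lemma test_function S : measurable S -> S `<=` E ->
  exists2 f, L2T f & [/\ is_fourier f (cindic S), (N f)%:E = mu S & PW E f].
Proof.
move=> mS SE; have [L1S L2S eS] := cindic_L12 mS SE.
have [f Lf ff] := is_fourier_surj L1S L2S; exists f; first exact: Lf.
split; [exact: ff|by rewrite -(is_fourier_isometry Lf ff)|].
split; first exact: Lf.
have := is_fourier_unique Lf (fourierP Lf) ff.
apply: (@filterS _ _ aeF) => w; rewrite /supp /= => -> /eqP; rewrite /cindic indicE.
by case: (boolP (w \in S)) => // /set_mem /SE.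
Qed.

Lemma measurable_normcH : measurable_fun setT (fun w : Rd R d => normc (H w)).
Proof. exact: (cmeas_normc mH). Qed.

Lemma null_of_le (S : set (Rd R d)) (a b : R) : b < a -> 0 <= N (cindic S) -> a * N (cindic S) <= b * N (cindic S) -> N (cindic S) = 0.
Proof.
move=> ba N0; apply: contraTeq => Nn; rewrite -ltNge ltr_pM2r//.
by rewrite lt_def Nn.
Qed.

(** The inequality is assumed on [PW E] alone, where the test functions lie; in this form it serves
    all three equivalences. *)
Lemma bessel_bounded (B : R) : 0 < B -> (forall f, PW E f -> L2T f -> (coefsum (ip setT) psi f <= (B * N f)%:E)%E) ->
  exists2 M : R, 0 < M & {ae mu, forall w, normc (H w) <= M}.
Proof.
move=> B0 hB; have [A0 [B1 [A00 _ fr]]] := coefsum_bounds.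
(* Chosen so that A0 * M^2 = B + A0 exceeds [B]: on the set where |H| > M the two frame estimates
   then contradict each other unless it is null. *)
pose M := Num.sqrt (B / A0 + 1).
have M0 : 0 < M by rewrite sqrtr_gt0 ltr_wpDl// divr_ge0// ltW.
exists M => //; pose S := E `&` [set w | M < normc (H w)].
have mS : measurable S.
  apply: measurableI => //; rewrite (_ : [set _ | _] = (fun w : Rd R d => normc (H w)) @^-1` `]M, +oo[%classic).
    by rewrite -[X in measurable X]setTI; apply: measurable_normcH => //; exact: measurable_itv.
  by apply/seteqP; split => w /=; rewrite in_itv/= andbT.
have SE : S `<=` E by move=> w [].
have [L1S L2S eS] := cindic_L12 mS SE.
have [f Lf [ff Nf Pf]] := test_function mS SE.
have Lq := L2_mulconj_cindic mS.
have /andP[h1 _] := fr f _ Lf ff Lq.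
have := le_trans h1 (hB f Pf Lf); rewrite lee_fin => h2.
have NS0 := normsq_ge0 SI L2S.
have h3 : N (cindic S) <= M^-1 ^+ 2 * N (mulconj (cindic S)).
  apply: (normsq_le_ae L2S Lq); first by rewrite invr_ge0 ltW.
  apply: aeW => w; rewrite /mulconj normcM normc_conj normc_cindic indicE.
  case: (boolP (w \in S)) => [/set_mem [_ /= Mw]|_]; last by rewrite !mul0r mulr0.
  by rewrite mul1r mulrC ler_pdivlMr// mul1r ltW.
have Nff : N f = N (cindic S) by apply: EFin_inj; rewrite Nf eS.
rewrite Nff exprVn ler_pdivlMl ?exprn_gt0// sqr_sqrtr in h2 h3; last first.
  by rewrite addr_ge0// divr_ge0// ltW.
have NS : N (cindic S) = 0.
  apply: (@null_of_le S (B + A0) B) => //; first by rewrite ltrDl.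
  apply: le_trans h2; rewrite -(ler_pM2l A00) in h3; apply: le_trans h3.
  by rewrite mulrA; have -> : A0 * (B / A0 + 1) = B + A0 by field; rewrite gt_eqF.
have muS : mu S = 0%E by rewrite -eS NS.
have : {ae mu, forall w, ~ S w}.
  by exists S; split => // w /=; exact: contrapT.
apply: (filterS2 _ _ H0) => w Hw nS.
have [Ew|/Hw ->] := pselect (E w); last by rewrite normc0 ltW.
by rewrite leNgt; apply/negP => h1'; apply: nS.
Qed.

Lemma bessel_iff : is_bessel (ip setT) L2T psi <->
  (exists2 B : R, 0 < B & \forall w \ae mu, normc (H w) <= B).
Proof.
split=> [[_ [B B0 hB]]|[B B0 HB]].
  by apply: (bessel_bounded B0) => f _; exact: hB.
by split; [exact: L2_psi|exact: (bounded_bessel B0 HB)].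
Qed.

(* S_n stays away from the zeros of H, so that 1_{S_n} / H is square integrable on E. *)
Let S (ep : R) (n : nat) : set (Rd R d) := E `&` [set w | n.+1%:R^-1 < normc (H w) < ep].

Let mS ep n : measurable (S ep n).
Proof.
apply: measurableI => //; rewrite (_ : [set _ | _] = (fun w : Rd R d => normc (H w)) @^-1` `]n.+1%:R^-1, ep[%classic).
  by rewrite -[X in measurable X]setTI; apply: measurable_normcH => //; exact: measurable_itv.
by apply/seteqP; split => w /=; rewrite in_itv.
Qed.

(** The sets [S ep n] exhaust the part of [E] where 0 < |H| < ep, and outside [E] the function [H]
    vanishes a.e. *)
Let ae_S ep : (forall n, mu (S ep n) = 0%E) -> {ae mu, forall w, H w != 0 -> ep <= normc (H w)}.
Proof.
move=> S0; have : mu.-negligible (\bigcup_n S ep n).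
  by apply: negligible_bigcup => n; exists (S ep n); split; [exact: mS|exact: S0|].
move=> nS; have {}nS : {ae mu, forall w, ~ (\bigcup_n S ep n) w}.
  by apply: negligibleS nS => w /=; exact: contrapT.
apply: (filterS2 _ _ H0) nS => w Hw nSw Hn.
rewrite leNgt; apply/negP => lt; apply: nSw.
have Hp : 0 < normc (H w) by rewrite lt_def normc_ge0 andbT; apply: contra Hn => /eqP/eq0_normc ->.
have [n hn] := ltr_add_invr (y := 0) Hp; rewrite add0r in hn.
exists n => //; split; last by rewrite /= hn.
by apply: contrapT => /Hw e0; rewrite e0 eqxx in Hn.
Qed.

(** The coefficient sum of the test function is at least A mu(T) and at most B1 ep^2 mu(T), so
    [mu T] vanishes once B1 ep^2 < A. *)
Lemma null_small (A B1 : R) (T : set (Rd R d)) (ep : R) f : measurable T -> T `<=` E -> 0 <= ep ->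
  B1 * ep ^+ 2 < A -> 0 < B1 ->
  (forall f F, L2T f -> is_fourier f F -> L2T (mulconj F) -> (coefsum (ip setT) psi f <= (B1 * N (mulconj F))%:E)%E) ->
  L2T f -> is_fourier f (cindic T) -> (forall w, T w -> normc (H w) <= ep) ->
  ((A * N f)%:E <= coefsum (ip setT) psi f)%E -> mu T = 0%E.
Proof.
move=> mT' TE ep0 small B10 fr Lf ff Tep low.
have [L1S L2S eS] := cindic_L12 mT' TE.
have Lq := L2_mulconj_cindic mT'.
have := le_trans low (fr f _ Lf ff Lq); rewrite lee_fin -(is_fourier_isometry Lf ff) => h1.
have h2 : N (mulconj (cindic T)) <= ep ^+ 2 * N (cindic T).
  apply: (normsq_le_ae Lq L2S ep0); apply: aeW => w; rewrite /mulconj normcM normc_conj normc_cindic indicE.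
  case: (boolP (w \in T)) => [/set_mem Tw|_]; last by rewrite mul0r mulr0.
  by rewrite mul1r mulr1 Tep.
rewrite -eS; congr EFin; apply: (null_of_le small (normsq_ge0 SI L2S)).
by apply: le_trans h1 _; rewrite -mulrA ler_pM2l.
Qed.

Lemma small_eps (A B1 : R) : 0 < A -> 0 < B1 -> exists2 ep : R, 0 < ep & B1 * ep ^+ 2 < A.
Proof.
move=> A0 B10; exists (Num.sqrt (A / (2 * B1))); first by rewrite sqrtr_gt0 divr_gt0// mulr_gt0.
rewrite sqr_sqrtr; last by rewrite divr_ge0// ltW// mulr_gt0.
have -> : B1 * (A / (2 * B1)) = A / 2 by field; rewrite gt_eqF.
by lra.
Qed.

Lemma PW_psi k : PW E (psi k).
Proof.
split; first exact: L2_psi.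
have := is_fourier_unique (L2_psi k) (fourierP (L2_psi k)) (is_fourier_psi k).
apply: (filterS2 _ _ H0) => w Hw e0; rewrite /supp /= e0 => hw.
by apply: contrapT => /Hw z; rewrite z mulr0 eqxx in hw.
Qed.

Lemma PW_frame_iff : is_frame (ip setT) (PW E) psi <->
  (exists A B : R, [/\ 0 < A, A <= B & \forall w \ae mu, E w -> A <= normc (H w) <= B]).
Proof.
split=> [[_ [A [B [A0 B0 hAB]]]]|[A [B [A0 AB HAB]]]].
  have [M M0 HM] : exists2 M : R, 0 < M & {ae mu, forall w, normc (H w) <= M}.
    by apply: (bessel_bounded B0) => f Pf _; have /andP[] := hAB f Pf.
  have [A1 [B1 [_ B10 fr]]] := coefsum_bounds.
  have [ep ep0 small] := small_eps A0 B10.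
  pose T := E `&` [set w | normc (H w) < ep].
  have mT' : measurable T.
    apply: measurableI => //; rewrite (_ : [set _ | _] = (fun w : Rd R d => normc (H w)) @^-1` `]-oo, ep[%classic).
      by rewrite -[X in measurable X]setTI; apply: measurable_normcH => //; exact: measurable_itv.
    by apply/seteqP; split => w /=; rewrite in_itv.
  have TE : T `<=` E by move=> w [].
  have [f Lf [ff Nf Pf]] := test_function mT' TE.
  have T0 : mu T = 0%E.
    apply: (null_small mT' TE (ltW ep0) small B10 _ Lf ff).
    - by move=> g G Lg gG Lq; have /andP[] := fr g G Lg gG Lq.
    - by move=> w [_ /= /ltW].
    - by have /andP[] := hAB f Pf.
  (* The maximum secures A <= B also when [E] is null, where nothing relates [M] to [ep]. *)
  exists ep, (Num.max ep M); split; [exact: ep0|by rewrite le_max lexx|].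
  have nT : {ae mu, forall w, ~ T w} by exists T; split => // w /=; exact: contrapT.
  apply: (@filterS2 _ _ aeF _ _ _ _ HM nT) => w Mw nTw Ew; rewrite le_max Mw orbT andbT.
  by rewrite leNgt; apply/negP => lt; apply: nTw.
have B0 : 0 < B by exact: lt_le_trans AB.
have HB : {ae mu, forall w, normc (H w) <= B}.
  apply: (filterS2 _ _ H0) HAB => w Hw HABw.
  by have [/HABw/andP[]//|/Hw ->] := pselect (E w); rewrite normc0 ltW.
split; first exact: PW_psi.
have [C2 C20 up] := bounded_bessel B0 HB; have [C1 C10 low] := bounded_below A0 B0 HB.
exists C1, C2; split => // f [Lf Ef]; rewrite up// andbT; apply: low => //.
by apply: (filterS2 _ _ HAB) Ef => w hw Ew /Ew /hw /andP[].
Qed.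

Lemma fspan_psi k : fspan psi (psi k).
Proof. by exists [:: k], (fun=> 1); split => //; rewrite big_seq1 scale1r. Qed.

Let comb (s : seq K) (c : K -> R[i]) : cfun R d := \sum_(k <- s) c k *: psi k.
Let trig (s : seq K) (c : K -> R[i]) : cfun R d := fun w => \sum_(k <- s) c k * expo (lam k) w.

Let L2_comb s c : L2T (comb s c).
Proof. by apply: (si_sum SI) => k; apply: (si_Z SI); exact: L2_psi. Qed.

Let is_fourier_comb s c : is_fourier (comb s c) (fun w => trig s c w * H w).
Proof.
rewrite /comb; elim: s => [|k s ih].
  (* That 0 is a transform of 0 is read off from linearity, as -h + h. *)
  have := is_fourier_lin (-1) Lh Lh fH fH; rewrite !scaleN1r !addNr big_nil.
  by congr (is_fourier _ _); apply/funext => w; rewrite /trig big_nil mul0r.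
rewrite big_cons; have := is_fourier_lin (c k) (L2_psi k) (L2_comb s c) (is_fourier_psi k) ih.
congr (is_fourier _ _); apply/funext => w; rewrite /trig big_cons mulrDl -mulrA; reflexivity.
Qed.

Let trigE s c w : E w -> (\sum_(k <- s) c k *: e k) w = trig s c w.
Proof.
move=> Ew; rewrite /trig; elim: s => [|k s ih]; first by rewrite !big_nil.
rewrite !big_cons -ih; congr (_ + _).
by rewrite -[LHS]/(c k * (expo (lam k) w * (\1_E w)%:C)) indicE mem_set// mulr1.
Qed.

Let is_fourier_Bcomb f F s c : L2T f -> is_fourier f F ->
  is_fourier (f - comb s c) (fun w => F w - trig s c w * H w).
Proof.
move=> Lf fF; have := is_fourier_lin (-1) (L2_comb s c) Lf (is_fourier_comb s c) fF.
rewrite scaleN1r addrC; congr (is_fourier _ _); apply/funext => w; rewrite scaleN1r addrC; reflexivity.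
Qed.

Let closed_span_cindic ep n f M : 0 < M -> {ae mu, forall w, normc (H w) <= M} -> L2T f ->
  is_fourier f (cindic (S ep n)) -> closed_span (ip setT) L2T psi f.
Proof.
move=> M0 HM Lf ff; split; first exact: Lf.
(* On [S ep n], 1/H is conj(H)/|H|^2. There |H| > 1/(n + 1) bounds [r] by (n + 1)^2, so [p] is
   square integrable because [H] is. *)
move=> eta eta0; pose r : Rd R d -> R := fun w => \1_(S ep n) w * (normc (H w) ^+ 2)^-1.
have mr : measurable_fun setT r.
  apply: measurable_funM; first exact: measurable_indic.
  by apply: measurable_funV; exact: cmeas_normc2.
pose p : cfun R d := fun w => (r w)%:C * conjc (H w).
have Lp : L2T p.
  apply: (cL2_bndM mT (cmeas_ReC mr) (cL2_conj LH) (k := n.+1%:R ^+ 2)); first by rewrite exprn_ge0.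
  apply: aeW => w _; rewrite /= expr0n addr0 sqrtr_sqr /r indicE.
  case: (boolP (w \in S ep n)) => [/set_mem[_ /= /andP[nH _]]|_]; last by rewrite mul0r normr0 exprn_ge0.
  rewrite mul1r ger0_norm ?invr_ge0 ?sqr_ge0// -exprVn ler_pXn2r ?nnegrE ?invr_ge0 ?normc_ge0//.
  have Hp : 0 < normc (H w) by apply: lt_trans nH; rewrite invr_gt0.
  by rewrite -[leRHS]invrK lef_pV2 ?posrE ?invr_gt0// ltW.
have pH w : p w * H w = cindic (S ep n) w.
  rewrite /p /r /cindic indicE; case: (boolP (w \in S ep n)) => [/set_mem[_ /= /andP[nH _]]|_]; last by rewrite mul0r !mul0r.
  have Hp : 0 < normc (H w) by apply: lt_trans nH; rewrite invr_gt0.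
  rewrite -mulrA [conjc _ * _]mulrC mulcJ mul1r -rmorphM mulVf// ?gt_eqF// exprn_gt0//.
(* Multiplying the approximation of [p] by [H] costs a factor M^2 in the squared norm. *)
have e1 : 0 < eta / M ^+ 2 by rewrite divr_gt0// exprn_gt0.
have [g [s [c [_ ->]]] hg] := frame_dense SIE lam_frame.1 lam_frame (L2_subset Lp) e1.
exists s, c; have fG := is_fourier_Bcomb s c Lf ff.
have Lfc : L2T (f - comb s c) := si_B SI Lf (L2_comb s c).
have LG := fG.1.
rewrite -[X in X < _]/(N (f - comb s c)) -(is_fourier_isometry Lfc fG) -(normsq_off LG); last first.
  apply: (@filterS _ _ aeF) H0 => w Hw nE; rewrite (Hw nE) mulr0 subr0 -pH (Hw nE) mulr0; reflexivity.
have LEg : L2 E (p - \sum_(k <- s) c k *: e k).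
  by apply: (si_B SIE (L2_subset Lp)); apply: (si_sum SIE) => k; apply: (si_Z SIE); exact: lam_frame.1.
apply: (@le_lt_trans _ _ (M ^+ 2 * normsq (ip E) (p - \sum_(k <- s) c k *: e k))).
  apply: (normsq_le_aeD mE (L2_subset LG) LEg (ltW M0)).
  apply: (@filterS _ _ aeF) HM => w HMw Ew.
  rewrite -pH -mulrBl normcM mulrC.
  have -> : (p - \sum_(k <- s) c k *: e k) w = p w - trig s c w by rewrite -(trigE s c Ew).
  by rewrite ler_wpM2r ?normc_ge0.
by rewrite mulrC -ltr_pdivlMr ?exprn_gt0.
Qed.

(** Transforms of combinations are multiples of [H] and vanish on its zero set Z. So the part on Z
    of the transform of [f] is no larger than the distance from [f] to any combination, hence
    null. *)
Let closed_span_supp f : closed_span (ip setT) L2T psi f ->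
  {ae mu, forall w, H w = 0 -> fourier f w = 0}.
Proof.
move=> [Lf hf]; have fF := fourierP Lf; have LF := fF.1.
pose Z : set (Rd R d) := [set w | H w = 0].
have mZ : measurable Z.
  rewrite (_ : Z = (fun w : Rd R d => normc (H w)) @^-1` [set 0]).
    by rewrite -[X in measurable X]setTI; apply: measurable_normcH => //; exact: measurable_set1.
  by apply/seteqP; split => w /=; [move=> ->; rewrite normc0|exact: eq0_normc].
have mi : cmeas (T := Rd R d) setT (cindic Z) by apply: cmeas_ReC; exact: measurable_indic.
pose u : cfun R d := fun w => cindic Z w * fourier f w.
have i1 w : normc (cindic Z w) <= 1 by rewrite normc_cindic indicE; case: (_ \in _).
have Lu : L2T u by apply: (cL2_bndM mT mi LF ler01); apply: aeW => w _.
have u0 : N u = 0.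
  apply/eqP; rewrite eq_le (normsq_ge0 SI Lu) andbT leNgt; apply/negP => up.
  (* The accuracy requested is [N u] itself, which no combination can beat. *)
  have [s [c hc]] := hf _ up; move: hc; apply/negP; rewrite -leNgt.
  have fG := is_fourier_Bcomb s c Lf fF; have LG := fG.1.
  have Lfc : L2T (f - comb s c) := si_B SI Lf (L2_comb s c).
  rewrite -[X in _ <= X]/(N (f - comb s c)) -(is_fourier_isometry Lfc fG).
  rewrite -[leRHS]mul1r -[1](expr1n _ 2); apply: (normsq_le_ae Lu LG ler01).
  apply: aeW => w; rewrite mul1r /u normcM normc_cindic indicE.
  case: (boolP (w \in Z)) => [/set_mem /= ->|_]; last by rewrite mul0r normc_ge0.
  by rewrite mul1r mulr0 subr0.
apply: (@filterS _ _ aeF) (normsq0_ae Lu u0) => w; rewrite /u /cindic indicE => uw Hw.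
have Zw : w \in Z by apply: mem_set; exact: Hw.
by rewrite -uw Zw mul1r.
Qed.

Lemma frame_seq_iff : is_frame_seq (ip setT) L2T psi <->
  (exists A B : R, [/\ 0 < A, A <= B & \forall w \ae mu, supp H w -> A <= normc (H w) <= B]).
Proof.
split=> [[_ [A [B [A0 B0 hAB]]]]|[A [B [A0 AB HAB]]]].
  have [M M0 HM] : exists2 M : R, 0 < M & {ae mu, forall w, normc (H w) <= M}.
    (* The hypothesis bounds coefficients only on the closed span, but the test functions are not
       yet known to lie there; the Bessel inequality is therefore extended to L^2 first. *)
    apply: (bessel_bounded B0) => f _ Lf; apply: (bessel_extend SI L2_psi B0) => // g sg s us.
    rewrite -lee_fin; apply: (@le_trans _ _ (coefsum (ip setT) psi g)); first exact: psum_le_coefsum.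
    by have /andP[] := hAB g (fspan_closed_span SI L2_psi sg).
  have [A1 [B1 [_ B10 fr]]] := coefsum_bounds.
  have [ep ep0 small] := small_eps A0 B10.
  exists ep, (Num.max ep M); split; [exact: ep0|by rewrite le_max lexx|].
  suff : {ae mu, forall w, H w != 0 -> ep <= normc (H w)}.
    by move=> hE; apply: (@filterS2 _ _ aeF _ _ _ _ HM hE) => w Mw h' /h' h''; rewrite le_max Mw orbT andbT.
  apply: ae_S => n; have SE : S ep n `<=` E by move=> w [].
  have [f Lf [ff Nf Pf]] := test_function (mS ep n) SE.
  apply: (null_small (mS ep n) SE (ltW ep0) small B10 _ Lf ff).
  - by move=> g G Lg gG Lq; have /andP[] := fr g G Lg gG Lq.
  - by move=> w [_ /= /andP[_ /ltW]].
  suff Cf : closed_span (ip setT) L2T psi f by have /andP[] := hAB f Cf.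
  exact: (closed_span_cindic M0 HM Lf ff).
have B0 : 0 < B by exact: lt_le_trans AB.
have HB : {ae mu, forall w, normc (H w) <= B}.
  apply: (@filterS _ _ aeF) HAB => w HABw.
  have [e0|/HABw/andP[]//] := eqVneq (H w) 0; by rewrite e0 normc0 ltW.
split; first by move=> k; apply: (fspan_closed_span SI L2_psi); exact: fspan_psi.
have [C2 C20 up] := bounded_bessel B0 HB; have [C1 C10 low] := bounded_below A0 B0 HB.
exists C1, C2; split; [exact: C10|exact: C20|] => f Cf; have Lf := Cf.1.
apply/andP; split; last exact: up.
apply: (low f Lf).
apply: (@filterS2 _ _ aeF _ _ _ _ (closed_span_supp Cf) HAB) => w hw HABw Fn.
have Hn : supp H w by apply: contra Fn => /eqP /hw ->.
by have /andP[] := HABw Hn.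
Qed.

End TranslateSystem.

Theorem theorem4p1 (R : realType) (d : nat) (E : set (Rd R d))
    (K : countType) (lam : K -> 'rV[R]_d) (h : cfun R d)
    (E_bounded : bounded_set (E : set 'rV[R]_d))
    (E_measurable : measurable E)
    (lam_frame : is_frame (ip E) (L2 E) (fun k => restr E (expo (lam k))))
    (h_PE : PW E h) :
  [/\ is_bessel (ip setT) (L2 setT) (fun k => translate (lam k) h) <->
      (exists2 B : R, 0 < B &
        \forall w \ae lebesgue R d, normc (fourier h w) <= B),
      is_frame (ip setT) (PW E) (fun k => translate (lam k) h) <->
      (exists A B : R, [/\ 0 < A, A <= B &
        \forall w \ae lebesgue R d, E w -> A <= normc (fourier h w) <= B]) &
      is_frame_seq (ip setT) (L2 setT) (fun k => translate (lam k) h) <->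
      (exists A B : R, [/\ 0 < A, A <= B &
        \forall w \ae lebesgue R d, supp (fourier h) w ->
          A <= normc (fourier h w) <= B])].
Proof.
split.
- exact: (bessel_iff E_bounded E_measurable h_PE lam_frame).
- exact: (PW_frame_iff E_bounded E_measurable h_PE lam_frame).
- exact: (frame_seq_iff E_bounded E_measurable h_PE lam_frame).
Qed.
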